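(* Let $K\subset\mathbb R^2$ be a convex body with boundary of class $C^2$, and let $\delta\in(0,\mathrm{Vol}_2(K))$. Let $\hat\delta>0$ be the parameter of the dual body of illumination, i.e. such that $\Pi^{\hat\delta}(K)$ is the set of poles $\varphi_K(\ell)$ of the lines $\ell$ containing the chords of flotation of $K$ for $\delta$. If $\Pi_\delta(K)$, $\Gamma_\delta(K)$ and $\Pi^{\hat\delta}(K)$ are pairwise homothetic (possibly with respect to different centers), then $K$ is an ellipse.
   Context: A convex body is a compact convex set with non-empty interior. For each unit vector $\boldsymbol\xi$ let $H_{\boldsymbol\xi}$ be the line orthogonal to $\boldsymbol\xi$ such that the half-plane $H_{\boldsymbol\xi}^-$ cuts off from $K$ area exactly $\delta$; the segments $K\cap H_{\boldsymbol\xi}$ are the chords of flotation, $\Pi_\delta(K)$ is the envelope of the lines $H_{\boldsymbol\xi}$, and $\Gamma_\delta(K)$ is the locus of the centroids of $K\cap H_{\boldsymbol\xi}^-$. For $\hat\delta>0$, $\Pi^{\hat\delta}(K)$ is the set of points $p\notin K$ such that $\mathrm{Conv}(K\cup\{p\})\setminus K$ has area $\hat\delta$. For a line $\ell$ meeting the interior of $K$, its pole $\varphi_K(\ell)$ is the intersection of the lines tangent to $\partial K$ at the two points of $\ell\cap\partial K$. Two curves are homothetic if one is the image of the other under a map $x\mapsto q+\lambda(x-q)$ with $\lambda>0$. *)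

(* Defs.v *)
From HB Require Import structures.
From mathcomp Require Import all_boot all_order all_algebra.
From mathcomp Require Import all_classical all_reals all_analysis.
Set Implicit Arguments. Unset Strict Implicit. Unset Printing Implicit Defensive.
Import Order.TTheory GRing.Theory Num.Theory.
Import numFieldNormedType.Exports.
Local Open Scope classical_set_scope.
Local Open Scope ring_scope.

Section Plane.
Variable R : realType.
Notation P := (R * R)%type.

Definition padd (x y : P) : P := (x.1 + y.1, x.2 + y.2).
Definition pscale (t : R) (x : P) : P := (t * x.1, t * x.2).
Definition dot (x y : P) : R := x.1 * y.1 + x.2 * y.2.
Definition det2 (x y : P) : R := x.1 * y.2 - x.2 * y.1.

Definition D1 (f : R -> R) : R -> R := fun s => @derive1 R R^o f s.

Definition area (A : set P) : \bar R :=
  ((@lebesgue_measure R) \x (@lebesgue_measure R))%E A.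

Definition convex_set (A : set P) : Prop :=
  forall x y, A x -> A y -> forall t : R, 0 <= t <= 1 ->
    A (padd (pscale t x) (pscale (1 - t) y)).

Definition convex_body (K : set P) : Prop :=
  compact K /\ convex_set K /\ interior K !=set0.

Definition bd (K : set P) : set P := closure K `\` interior K.

Definition conv_hull (A : set P) : set P :=
  \bigcap_(C in [set C | convex_set C /\ A `<=` C]) C.

Definition C2_fun (f : R -> R) : Prop :=
  forall s, derivable f s 1 /\ derivable (fun x : R => D1 f x) s 1 /\ {for s, continuous (fun x : R => D1 (D1 f) x)}.

Definition C2_boundary_param (K : set P) (g1 g2 : R -> R) : Prop :=
  C2_fun g1 /\ C2_fun g2 /\
  (exists L : R, 0 < L /\
     (forall s, g1 (s + L) = g1 s /\ g2 (s + L) = g2 s) /\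
     (forall s t, 0 <= s < L -> 0 <= t < L -> (g1 s, g2 s) = (g1 t, g2 t) -> s = t)) /\
  (forall s, (D1 g1 s, D1 g2 s) != (0, 0)) /\
  [set (g1 s, g2 s) | s in [set: R]] = bd K.

Definition C2_boundary (K : set P) : Prop :=
  exists g1 g2, C2_boundary_param K g1 g2.

Definition tangent_dir (K : set P) (a v : P) : Prop :=
  exists g1 g2 s, C2_boundary_param K g1 g2 /\ (g1 s, g2 s) = a /\
     v = (D1 g1 s, D1 g2 s).

Definition uvec (th : R) : P := (cos th, sin th).
Definition uvec' (th : R) : P := (- sin th, cos th).

Definition halfplane (xi : P) (t : R) : set P := [set x | dot x xi <= t].
Definition line (xi : P) (t : R) : set P := [set x | dot x xi = t].

(* offset of the line of flotation with normal uvec th: the (unique) t with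
   area (K cap H^-) = delta *)
Definition flot_off (K : set P) (delta : R) (th : R) : R :=
  xget 0 [set t : R | area (K `&` halfplane (uvec th) t) = delta%:E].

(* Pi_delta(K): envelope of the lines of flotation, i.e. the characteristic
   points x with <x,u(th)> = p(th) and <x,u'(th)> = p'(th) *)
Definition flot_envelope (K : set P) (delta : R) : set P :=
  [set x | exists th : R,
     let p := flot_off K delta in
     dot x (uvec th) = p th /\ derivable p th 1 /\ dot x (uvec' th) = D1 p th].

Definition centroid (A : set P) : P :=
  let m := fine (area A) in
  (fine (\int[(@lebesgue_measure R) \x (@lebesgue_measure R)]_(x in A) (x.1)%:E)%E / m,
   fine (\int[(@lebesgue_measure R) \x (@lebesgue_measure R)]_(x in A) (x.2)%:E)%E / m).

Definition flot_centroids (K : set P) (delta : R) : set P :=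
  [set centroid (K `&` halfplane (uvec th) (flot_off K delta th)) | th in [set: R]].

Definition illum (K : set P) (dh : R) : set P :=
  [set p | ~ K p /\ area (conv_hull (K `|` [set p]) `\` K) = dh%:E].

Definition is_pole (K : set P) (l : set P) (q : P) : Prop :=
  exists a b va vb, a != b /\ (l `&` bd K) = [set a; b] /\
    tangent_dir K a va /\ tangent_dir K b vb /\ det2 va vb != 0 /\
    (exists s, q = padd a (pscale s va)) /\ (exists s, q = padd b (pscale s vb)).

Definition flot_poles (K : set P) (delta : R) : set P :=
  [set q | exists th : R, is_pole K (line (uvec th) (flot_off K delta th)) q].

Definition homothetic (A B : set P) : Prop :=
  exists (q : P) (lam : R), 0 < lam /\
    B = [set padd q (pscale lam (padd x (pscale (-1) q))) | x in A].

Definition is_ellipse (K : set P) : Prop :=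
  exists (c : P) (a b d e : R), a * e - b * d != 0 /\
    K = [set padd c (a * u.1 + b * u.2, d * u.1 + e * u.2)
         | u in [set u : P | u.1 ^+ 2 + u.2 ^+ 2 <= 1]].

End Plane.

(* Main.v *)
Require Import Defs.
From mathcomp Require Import all_boot all_order all_algebra.
From mathcomp Require Import all_classical all_reals all_analysis.
From mathcomp Require Import measurable_realfun ring lra.
(* [convex] also defines a [convex_set]; this makes the one of [Defs] visible again. *)
Import Defs.
Import Order.TTheory GRing.Theory Num.Theory.
Import numFieldNormedType.Exports.
Local Open Scope classical_set_scope.
Local Open Scope ring_scope.

(* Let A(th), B(th) be the ends of the chord of flotation with normal u = u(th),
   M its midpoint and D = (B - A)/2.
   - Turning the line of flotation about a point of the chord other than M
     changes the area cut off, because point reflection maps the short-side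
     wedge of K into the long-side one; hence the lines touch their envelope at
     M, and A' = kap (P - A), B' = - kap (P - B), where P is the pole.
   - Among the points x with area(conv(K + x) \ K) = dh the pole P is extreme in
     the direction of u: shearing the triangle PAB parallel to the chord keeps
     its area, and the cap of K behind the chord lies in that triangle.
   - The poles form a bounded set (a homothetic copy of midpoints), so by
     continuity the two tangents are never parallel. Comparing supporting lines,
     the homothety must send M(th) to P(th), i.e. P - q = lam (M - q).
   - Then M' = kap D and D' = - kap (lam - 1) (M - q). The Wronskian and energy
     of this linear system are conserved, which puts A on an ellipse; D takes
     every direction, so A covers the ellipse and K is the region it bounds. *)

(** [K] need not be strictly convex and [delta] is any value below its area, so at the outset the
    pole of a chord may lie on either side of it or fail to exist, the envelope may have cusps, and
    the sign of [lam - 1] is unknown. Heights and slopes are therefore signed throughout. The way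
    out is that the slope difference of the two tangents governs both the height of the pole and the
    radius of curvature of the envelope: once it has a constant sign, the envelope turns
    monotonically, and a maximum of a linear form on it occurs at only one direction. This is what
    makes the matching of midpoints with poles possible. No formula for the area cut off is
    differentiated. Monotonicity, continuity and comparisons of areas suffice, and the derivative of
    the offset is squeezed between lines turned about points on either side of the midpoint. In the
    final linear system the factor [kap] is an unknown function. It only changes the speed along the
    orbits, hence the use of conserved forms instead of explicit solutions; positivity of [lam - 1]
    comes out at the end, from the fact that the chord turns through all directions. *)

(** * Area in the plane: measurability, unimodular maps, strips *)

Section PlaneMeasure.
Context {R : realType}.
Notation P := (R * R)%type.
Notation mP := (measurableTypeR R * measurableTypeR R)%type.
Implicit Types A B : set P.

Definition box (x : P) (e : R) : set P :=
  [set y | `|y.1 - x.1| < e /\ `|y.2 - x.2| < e].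

Definition box_open A : Prop := forall x, A x -> exists2 e, 0 < e & box x e `<=` A.

Definition plane_measurable A : Prop := measurable (A : set mP).

Lemma measurable_box x e : plane_measurable (box x e).
Proof.
have -> : box x e = `]x.1 - e, x.1 + e[ `*` `]x.2 - e, x.2 + e[.
  apply/seteqP; split => -[y1 y2] /=; rewrite /box /= !in_itv /= !ltr_distl;
  by move=> [-> ->].
by apply: measurableX; apply: measurable_itv.
Qed.

Lemma measurable_box_open A : box_open A -> plane_measurable A.
Proof.
move=> oA.
pose F (q : rat) (r : rat) (n : rat) : set P :=
  if pselect (box (ratr q, ratr r) (ratr n) `<=` A) then
    box (ratr q, ratr r) (ratr n) else set0.
have -> : A = \bigcup_q \bigcup_r \bigcup_n F q r n.
  apply/seteqP; split => [x Ax|x [q _ [r _ [n _]]]]; last first.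
    by rewrite /F; case: pselect => // H /H.
  have [e e0 He] := oA x Ax.
  have e40 : 0 < e / 4 by rewrite divr_gt0.
  have [n] : exists n : rat, ratr n \in `]e / 4, e / 2[.
    by apply: rat_in_itvoo; lra.
  have [q] : exists n : rat, ratr n \in `]x.1 - e / 4, x.1[.
    by apply: rat_in_itvoo; lra.
  have [r] : exists n : rat, ratr n \in `]x.2 - e / 4, x.2[.
    by apply: rat_in_itvoo; lra.
  rewrite !in_itv /= => /andP[r1 r2] /andP[q1 q2] /andP[n1 n2].
  exists q => //; exists r => //; exists n => //; rewrite /F.
  case: pselect => [H|[]]; first by rewrite /box /=; split; rewrite ltr_distl; lra.
  move=> y; rewrite /box /= !ltr_distl => -[/andP[a b] /andP[c d]].
  by apply: He; split; rewrite ltr_distl; lra.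
apply: bigcupT_measurable_rat => q; apply: bigcupT_measurable_rat => r.
apply: bigcupT_measurable_rat => n.
by rewrite /F; case: pselect => H; [exact: measurable_box|exact: measurable0].
Qed.

Lemma measurable_box_closed A : box_open (~` A) -> plane_measurable A.
Proof. by move=> oA; rewrite -(setCK A); apply: measurableC; exact: measurable_box_open. Qed.

Lemma lebesgue_measure_translation (c : R) (A : set R) :
  measurable (A : set (measurableTypeR R)) ->
  lebesgue_measure ((fun x => x + c) @^-1` A) = lebesgue_measure A.
Proof.
have mf : measurable_fun [set: measurableTypeR R] (fun x : measurableTypeR R => (x + c : measurableTypeR R)).
  exact: measurable_funD.
move=> mA.
pose mu : {measure set (measurableTypeR R) -> \bar R} :=
  measure_function_pushforward__canonical__measure_function_Measure lebesgue_measure mf.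
have -> // := @lebesgue_measure_unique R mu _ A mA.
move=> _ [[a b] _ <-] /=; rewrite /pushforward.
have -> : (fun x : R => x + c) @^-1` [set` `]a, b]] = [set` `]a - c, b - c]].
  by apply/seteqP; split => x /=; rewrite !in_itv /= => /andP[? ?]; apply/andP; split; lra.
rewrite !lebesgue_measure_itv /= !lte_fin ltrD2r; case: ifP => // _.
by rewrite -!EFinD; congr (_%:E); ring.
Qed.

Definition affine (a b c d e f : R) (x : P) : P :=
  (a * x.1 + b * x.2 + e, c * x.1 + d * x.2 + f).

Lemma measurable_affine_preimage a b c d e f A :
  plane_measurable A -> plane_measurable (affine a b c d e f @^-1` A).
Proof.
move=> mA.
have m1 : measurable_fun [set: mP] (fst : mP -> measurableTypeR R) := measurable_fst.
have m2 : measurable_fun [set: mP] (snd : mP -> measurableTypeR R) := measurable_snd.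
have mf : measurable_fun [set: mP] (affine a b c d e f : mP -> mP).
  apply/measurable_fun_pair;
  by apply: measurable_funD => //; apply: measurable_funD; apply: measurable_funM.
by rewrite /plane_measurable -[X in measurable X]setTI; exact: mf.
Qed.

Lemma area_vertical_shear (s f : R) A : plane_measurable A ->
  area (affine 1 0 s 1 0 f @^-1` A) = area A.
Proof.
move=> mA; rewrite /area /product_measure1; apply: eq_integral => x _ /=.
have := lebesgue_measure_translation (s * x + f) (xsection A x)
  (measurable_xsection x mA).
move=> <-; congr (lebesgue_measure _); apply/seteqP.
by split => y; rewrite /= /xsection /= !inE /= /affine /= mul1r mul0r !addr0 mul1r;
  rewrite [s * x + y]addrC addrA.
Qed.

Lemma area_horizontal_shear (s e : R) A : plane_measurable A ->
  area (affine 1 s 0 1 e 0 @^-1` A) = area A.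
Proof.
move=> mA.
have areaE B : plane_measurable B ->
    area B = (lebesgue_measure \x^ lebesgue_measure)%E (B : set mP).
  by apply: product_measure_unique => C D mC mD; exact: product_measure2E.
rewrite !areaE //; last exact: measurable_affine_preimage.
rewrite /product_measure2; apply: eq_integral => y _ /=.
have := lebesgue_measure_translation (s * y + e) (ysection A y)
  (measurable_ysection y mA).
move=> <-; congr (lebesgue_measure _); apply/seteqP.
by split => x; rewrite /= /ysection /= !inE /= /affine /= !mul1r mul0r !addr0 add0r !addrA.
Qed.

(** Unimodular maps are products of shears, and a shear preserves area by Fubini and translation
    invariance on the line. Three shears suffice when [c] is nonzero. *)
Lemma area_affine (a b c d e f : R) A : a * d - b * c = 1 -> plane_measurable A ->
  area (affine a b c d e f @^-1` A) = area A.
Proof.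
have main a' b' c' d' e' f' B : c' != 0 -> a' * d' - b' * c' = 1 ->
    plane_measurable B -> area (affine a' b' c' d' e' f' @^-1` B) = area B.
  move=> c0 det1 mB.
  have -> : affine a' b' c' d' e' f' @^-1` B =
    affine 1 ((d' - 1) / c') 0 1 0 0 @^-1`
     (affine 1 0 c' 1 0 f' @^-1`
      (affine 1 ((a' - 1) / c') 0 1 (e' - (a' - 1) / c' * f') 0 @^-1` B)).
    apply/seteqP.
    have H x : affine a' b' c' d' e' f' x =
      affine 1 ((a' - 1) / c') 0 1 (e' - (a' - 1) / c' * f') 0
       (affine 1 0 c' 1 0 f' (affine 1 ((d' - 1) / c') 0 1 0 0 x)).
      have -> : b' = (a' * d' - 1) / c'.
        by apply/(mulIf c0); rewrite mulfVK // -det1; ring.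
      by rewrite /affine /=; congr (_, _); field.
    by split => x /=; rewrite H.
  rewrite area_horizontal_shear; last by do 2 apply: measurable_affine_preimage.
  rewrite area_vertical_shear; last exact: measurable_affine_preimage.
  by rewrite area_horizontal_shear.
(* If [c = 0], one more vertical shear replaces it by [c + d], which is nonzero. *)
move=> det1 mA; have [c0|c0] := eqVneq c 0; last exact: main.
have d0 : d != 0.
  by apply/eqP => d0; move: det1; rewrite c0 d0 !mulr0 subr0 => /esym/eqP; rewrite oner_eq0.
have -> : affine a b c d e f @^-1` A =
   affine 1 0 (-1) 1 0 0 @^-1` (affine (a + b) b (c + d) d e f @^-1` A).
  apply/seteqP.
  have H x : affine a b c d e f x = affine (a + b) b (c + d) d e f (affine 1 0 (-1) 1 0 0 x).
    by rewrite /affine /=; congr (_, _); ring.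
  by split => x /=; rewrite H.
rewrite area_vertical_shear; last exact: measurable_affine_preimage.
by apply: main => //; [rewrite c0 add0r | rewrite -det1; ring].
Qed.

Definition bounded_by (B : R) A : Prop := forall x, A x -> `|x.1| <= B /\ `|x.2| <= B.

Definition tame A : Prop := plane_measurable A /\ exists M : R, bounded_by M A.

Definition ar A : R := fine (area A).

Lemma tame_sub A B : plane_measurable A -> A `<=` B -> tame B -> tame A.
Proof. by move=> mA AB [_ [b Bb]]; split => //; exists b => x /AB /Bb. Qed.

Lemma tameI A B : tame A -> plane_measurable B -> tame (A `&` B).
Proof.
move=> tA mB; apply: (tame_sub _ A) => //; apply: measurableI => //; by case: tA.
Qed.

Lemma tameD A B : tame A -> plane_measurable B -> tame (A `\` B).
Proof.
move=> tA mB; apply: (tame_sub _ A) => //; apply: measurableD => //; by case: tA.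
Qed.

Lemma area_rect (a b c d : R) : a <= b -> c <= d ->
  area [set x : P | a <= x.1 <= b /\ c <= x.2 <= d] = ((b - a) * (d - c))%:E.
Proof.
move=> ab cd.
have -> : [set x : P | a <= x.1 <= b /\ c <= x.2 <= d] = `[a, b] `*` `[c, d].
  by apply/seteqP; split => -[x y] /=; rewrite !in_itv.
have H (u v : R) : u <= v -> (@lebesgue_measure R `[u, v] = (v - u)%:E)%E.
  rewrite lebesgue_measure_itv /= lte_fin le_eqVlt => /predU1P[->|->].
    by rewrite ltxx subrr.
  by rewrite -EFinD.
rewrite EFinM -!H //; apply: product_measure1E; exact: measurable_itv.
Qed.

Lemma area_le A B : plane_measurable A -> plane_measurable B -> A `<=` B ->
  (area A <= area B)%E.
Proof. by move=> mA mB AB; apply: le_measure; rewrite ?inE. Qed.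

Lemma measurable_rect (a b c d : R) :
  plane_measurable [set x : P | a <= x.1 <= b /\ c <= x.2 <= d].
Proof.
have -> : [set x : P | a <= x.1 <= b /\ c <= x.2 <= d] = `[a, b] `*` `[c, d].
  by apply/seteqP; split => -[x y] /=; rewrite !in_itv.
by apply: measurableX; exact: measurable_itv.
Qed.

Lemma area_tame A : tame A -> area A = (ar A)%:E.
Proof.
move=> [mA [B AB]]; rewrite /ar fineK //.
rewrite ge0_fin_numE; last exact: measure_ge0.
have [[x Ax]|A0] := pselect (exists x, A x); last first.
  have -> : A = set0 by apply/seteqP; split => // x Ax; apply: A0; exists x.
  by rewrite /area measure0 ltry.
have [B1 _] := AB _ Ax.
have B0 : 0 <= B by apply: le_trans B1.
apply: (@le_lt_trans _ _ (area [set x : P | - B <= x.1 <= B /\ - B <= x.2 <= B])).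
  apply: area_le => //; first exact: measurable_rect.
  by move=> y /AB /=; rewrite !ler_norml.
by rewrite area_rect ?ltry //; lra.
Qed.

Lemma ar_ge0 A : 0 <= ar A.
Proof. by apply: fine_ge0; exact: measure_ge0. Qed.

Lemma ar_le A B : plane_measurable A -> tame B -> A `<=` B -> ar A <= ar B.
Proof.
move=> mA tB AB; have tA : tame A by exact: tame_sub tB.
by rewrite -lee_fin -!area_tame //; apply: area_le => //; case: tB.
Qed.

Lemma ar_split A B : tame A -> plane_measurable B ->
  ar A = ar (A `&` B) + ar (A `\` B).
Proof.
move=> tA mB; have tI := tameI _ _ tA mB; have tD := tameD _ _ tA mB.
apply: EFin_inj; rewrite EFinD -!area_tame //.
rewrite -[in LHS](setUIDK A B); apply: measureU.
- by case: tI.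
- by case: tD.
- by apply/seteqP; split => // x [] [_ ?] [].
Qed.

Lemma ar_gt0 A x e : tame A -> 0 < e -> box x e `<=` A -> 0 < ar A.
Proof.
move=> tA e0 xA.
pose r := [set y : P | x.1 - e / 2 <= y.1 <= x.1 + e / 2 /\ x.2 - e / 2 <= y.2 <= x.2 + e / 2].
have rA : r `<=` A.
  by move=> y [/andP[? ?] /andP[? ?]]; apply: xA; split; rewrite ltr_distl; lra.
have mr : plane_measurable r by exact: measurable_rect.
apply: (@lt_le_trans _ _ (ar r)); last exact: ar_le.
rewrite -lte_fin -area_tame; last exact: tame_sub tA.
by rewrite area_rect ?lte_fin; nra.
Qed.

Lemma ar_affine a b c d e f A : a * d - b * c = 1 -> plane_measurable A ->
  ar (affine a b c d e f @^-1` A) = ar A.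
Proof. by move=> ? ?; rewrite /ar area_affine. Qed.

(** Rotated by [th], the set fits in a rectangle with sides [t - s] and [4 * B], because a rotated
    coordinate is at most [2 * B]. The case [s = t] makes lines null sets. *)
Lemma ar_strip th (s t B : R) A : plane_measurable A -> bounded_by B A ->
  0 <= B -> s <= t -> (forall x, A x -> s <= dot x (uvec th) <= t) ->
  ar A <= (t - s) * (4 * B).
Proof.
move=> mA AB B0 st Ast.
have cs := cos2Dsin2 th.
rewrite -(@ar_affine (cos th) (- sin th) (sin th) (cos th) 0 0) //; last by rewrite -cs; ring.
set r := [set x : P | s <= x.1 <= t /\ - (2 * B) <= x.2 <= 2 * B].
have tr : tame r.
  split; first exact: measurable_rect.
  exists (`|s| + `|t| + 2 * B) => x [/andP[? ?] /andP[? ?]].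
  have := ler_norm s; have := ler_norm (- s); rewrite normrN.
  have := ler_norm t; have := ler_norm (- t); rewrite normrN.
  by move=> *; rewrite !ler_norml; split; apply/andP; split; lra.
have -> : (t - s) * (4 * B) = ar r.
  by apply: EFin_inj; rewrite -area_tame // area_rect; [congr (_%:E); ring|lra|lra].
apply: ar_le => //; first exact: measurable_affine_preimage.
move=> [x y] /= Axy; have := Ast _ Axy; have := AB _ Axy.
rewrite /affine /dot /uvec /= !addr0.
set c := cos th in cs *; set i := sin th in cs *.
rewrite (_ : (_ * c + _) = x * (c ^+ 2 + i ^+ 2)); last by ring.
rewrite cs mulr1 => -[H1 H2] H3; split => //=.
have E : y = c * (i * x + c * y) - i * (c * x - i * y).
  by rewrite -[LHS]mulr1 -cs; ring.
rewrite -ler_norml E; apply: le_trans (ler_normB _ _) _; rewrite !normrM.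
have c1 : `|c| <= 1 by rewrite ler_norml cos_geN1 cos_le1.
have i1 : `|i| <= 1 by rewrite ler_norml sin_geN1 sin_le1.
rewrite (_ : c * x - i * y = c * x + - i * y) //; last by ring.
have := normr_ge0 (i * x + c * y); have := normr_ge0 (c * x + - i * y).
have := normr_ge0 c; have := normr_ge0 i; nra.
Qed.

End PlaneMeasure.

(** * Continuity and derivatives in explicit form *)

Section EpsilonDelta.
Context {R : realType}.
Implicit Types f g : R -> R.

Definition cts f x := forall e, 0 < e -> exists2 d, 0 < d &
  forall y, `|y - x| < d -> `|f y - f x| < e.

(** Derivative with its value as an argument, stated without quotients so that [h = 0] needs no
    separate treatment. *)
Definition dif f x l := forall e, 0 < e -> exists2 d, 0 < d &
  forall h, `|h| < d -> `|f (x + h) - f x - l * h| <= e * `|h|.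

Lemma ctsP f x : cts f x <-> {for x, continuous f}.
Proof.
split.
  move=> cf; apply/cvgrPdist_lt => e e0; have [d d0 H] := cf e e0.
  exists d => //= y /= yd; rewrite distrC; apply: H; by rewrite distrC.
move=> /cvgrPdist_lt cf e e0; have [d /= d0 H] := cf e e0.
exists d => // y yd; rewrite distrC; apply: H; by rewrite /= distrC.
Qed.

Lemma difP f x l : dif f x l <-> is_derive x 1 f l.
Proof.
have E h : h *: (1 : R^o) + x = x + h by rewrite scaler1 addrC.
split.
  move=> df.
  have cv : (fun h : R => h^-1 *: ((f \o shift x) (h *: (1 : R^o)) - f x)) @ 0^' --> l.
    apply/cvgrPdist_lt => e e0.
    have e20 : 0 < e / 2 by rewrite divr_gt0.
    have [d d0 H] := df _ e20; exists d => //= h /=; rewrite sub0r normrN => hd h0.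
    have h0' : 0 < `|h| by rewrite normr_gt0.
    rewrite /= E.
    have -> : l - h^-1 *: (f (x + h) - f x) = - (h^-1 * (f (x + h) - f x - l * h)).
      by rewrite /GRing.scale /=; field.
    rewrite normrN normrM normfV mulrC ltr_pdivrMr //.
    by apply: le_lt_trans (H h hd) _; nra.
  apply: DeriveDef; last exact: cvg_lim cv.
  by apply/cvg_ex; exists l.
move=> [df <-] e e0.
move: df => /cvgrPdist_le/(_ e e0)[d /= d0 H].
exists d => // h hd; have [->|h0] := eqVneq h 0.
  by rewrite addr0 subrr mulr0 subr0 normr0 mulr0.
have h0' : 0 < `|h| by rewrite normr_gt0.
have := H h; rewrite /= sub0r normrN => /(_ hd h0).
rewrite E.
rewrite (_ : f (x + h) - f x - _ =
  - ('D_1 f x - h^-1 *: (f (x + h) - f x)) * h); last first.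
  by rewrite /GRing.scale /=; field.
by rewrite normrM normrN ler_pM2r.
Qed.

Lemma dif_cts f x l : dif f x l -> cts f x.
Proof.
move=> /difP df; apply/ctsP.
have : derivable f x 1 by case: df.
by move=> /derivable1_diffP; apply: differentiable_continuous.
Qed.

Lemma dif_D1 f x l : dif f x l -> derivable f x 1 /\ D1 f x = l.
Proof.
by move=> /difP df; split; [case: df|rewrite /D1 derive1E; case: df].
Qed.

Lemma derivable_dif f x : derivable f x 1 -> dif f x (D1 f x).
Proof. by move=> df; apply/difP; rewrite /D1 derive1E; apply: DeriveDef. Qed.

Lemma dif_ext f g x l l' : (forall y, f y = g y) -> l = l' -> dif f x l -> dif g x l'.
Proof. by move=> /funext -> ->. Qed.

Lemma dif_const (k x : R) : dif (fun=> k) x 0.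
Proof. by apply/difP; exact: is_derive_cst. Qed.

Lemma difD f g x l m : dif f x l -> dif g x m -> dif (fun y => f y + g y) x (l + m).
Proof. by move=> /difP ? /difP ?; apply/difP; exact: is_deriveD. Qed.

Lemma difN f x l : dif f x l -> dif (fun y => - f y) x (- l).
Proof. by move=> /difP ?; apply/difP; exact: is_deriveN. Qed.

Lemma difB f g x l m : dif f x l -> dif g x m -> dif (fun y => f y - g y) x (l - m).
Proof. by move=> ? /difN; exact: difD. Qed.

Lemma difM f g x l m : dif f x l -> dif g x m ->
  dif (fun y => f y * g y) x (l * g x + f x * m).
Proof.
move=> /difP df /difP dg; apply/difP.
apply: (@is_derive_eq _ _ _ _ _ _ _ _ (is_deriveM df dg)).
by rewrite /GRing.scale /=; ring.
Qed.

Lemma dif_cos x : dif (@cos R) x (- sin x).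
Proof. by apply/difP; exact: is_derive_cos. Qed.

Lemma dif_sin x : dif (@sin R) x (cos x).
Proof. by apply/difP; exact: is_derive_sin. Qed.

(* Only continuity of [f] is needed, since [g] vanishes at [x]. *)
Lemma difM_cts0 f g x m : cts f x -> dif g x m -> g x = 0 ->
  dif (fun y => f y * g y) x (f x * m).
Proof.
move=> cf dg gx e e0.
pose C := `|m| + `|f x| + 2.
have C0 : 0 < C by rewrite /C; have := normr_ge0 m; have := normr_ge0 (f x); lra.
pose e' := Num.min (e / (2 * C)) 1.
have e'0 : 0 < e' by rewrite lt_min ltr01 divr_gt0 // mulr_gt0.
have e'e : e' * (2 * C) <= e by rewrite -ler_pdivlMr ?mulr_gt0 // ge_min lexx.
have e'1 : e' <= 1 by rewrite ge_min lexx orbT.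
have [d1 d10 H1] := cf e' e'0; have [d2 d20 H2] := dg e' e'0.
exists (Num.min d1 d2); first by rewrite lt_min d10.
move=> h; rewrite lt_min => /andP[/= h1 h2].
have := H1 (x + h); rewrite addrAC subrr add0r => /(_ h1) {}H1.
have := H2 h h2; rewrite gx mulr0 !subr0 => {}H2.
have -> : f (x + h) * g (x + h) - f x * m * h =
  (f (x + h) - f x) * (g (x + h) - m * h) + (f (x + h) - f x) * (m * h)
   + f x * (g (x + h) - m * h) by ring.
apply: le_trans (ler_normD _ _) _.
apply: le_trans (lerD (ler_normD _ _) (lexx _)) _; rewrite !normrM.
set F := `|f (x + h) - f x| in H1 *; set G := `|g (x + h) - m * h| in H2 *.
have h0 := normr_ge0 h; have F0 : 0 <= F by exact: normr_ge0. have G0 : 0 <= G by exact: normr_ge0.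
have m0 := normr_ge0 m; have f0 := normr_ge0 (f x).
have I1 : F * G <= e' * `|h| by nra.
have I2 : F * (`|m| * `|h|) <= e' * (`|m| * `|h|) by apply: ler_wpM2r; [nra|lra].
have I3 : `|f x| * G <= e' * (`|f x| * `|h|) by nra.
apply: (@le_trans _ _ (e' * C * `|h|)); first by rewrite /C; nra.
by apply: ler_wpM2r => //; nra.
Qed.

Lemma ctsD f g x : cts f x -> cts g x -> cts (fun y => f y + g y) x.
Proof. by move=> /ctsP ? /ctsP ?; apply/ctsP; exact: cvgD. Qed.

Lemma ctsN f x : cts f x -> cts (fun y => - f y) x.
Proof. by move=> /ctsP ?; apply/ctsP; exact: cvgN. Qed.

Lemma ctsM f g x : cts f x -> cts g x -> cts (fun y => f y * g y) x.
Proof. by move=> /ctsP ? /ctsP ?; apply/ctsP; exact: cvgM. Qed.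

Lemma ctsV f x : f x != 0 -> cts f x -> cts (fun y => (f y)^-1) x.
Proof. by move=> ? /ctsP ?; apply/ctsP; exact: cvgV. Qed.

Lemma cts_const (k x : R) : cts (fun=> k) x.
Proof. by apply/ctsP; exact: cvg_cst. Qed.

Lemma dif0_const f : (forall x, dif f x 0) -> forall x y, f x = f y.
Proof. by move=> df x y; apply: is_derive_0_is_cst => z; apply/difP. Qed.

Lemma cts_IVT f a b v : (forall x, cts f x) -> f a <= v <= f b -> exists x, f x = v.
Proof.
move=> cf /andP[v1 v2].
have sub A : {within A, continuous f} by apply: continuous_subspaceT => x; apply/ctsP.
have [ab|/ltW ba] := leP a b.
  by have [|c _ <-] := @IVT R f a b v ab (sub _); [rewrite ge_min le_max v1 v2 orbT|exists c].
by have [|c _ <-] := @IVT R f b a v ba (sub _); [rewrite ge_min le_max v1 v2 orbT|exists c].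
Qed.

Lemma dif_pos_lt f f' a b : a < b -> (forall x, dif f x (f' x)) ->
  (forall x, a < x < b -> 0 < f' x) -> f a < f b.
Proof.
move=> ab df f0.
have [||c] := @MVT R f f' a b ab.
- by move=> x _; apply/difP.
- by apply: continuous_subspaceT => x; apply/ctsP; exact: dif_cts (df x).
rewrite in_itv /= => cab E; rewrite -subr_gt0 E; apply: mulr_gt0; first exact: f0.
by rewrite subr_gt0.
Qed.

End EpsilonDelta.

(** * Interior points of convex bodies and the rotating frame *)

Section ConvexPlane.
Context {R : realType}.
Notation P := (R * R)%type.
Implicit Types (K : set P) (x y z : P).

Definition inner K x : Prop := exists2 e, 0 < e & box x e `<=` K.

Lemma interiorP K x : interior K x <-> inner K x.
Proof.
split.
  move=> /nbhs_ballP [e /= e0 H]; exists e => // y [y1 y2]; apply: H.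
  by split; rewrite /ball /= distrC.
move=> [e e0 H]; apply/nbhs_ballP; exists e => //= y [y1 y2]; apply: H.
by split; rewrite distrC.
Qed.

Lemma inner_sub K x : inner K x -> K x.
Proof. by move=> [e e0]; apply; split; rewrite subrr normr0. Qed.

Definition regular_body K : Prop :=
  [/\ box_open (~` K), exists M, bounded_by M K, convex_set K & exists z, inner K z].

Lemma convex_body_regular K : convex_body K -> regular_body K.
Proof.
move=> [cK [vK [z /interiorP zK]]]; split => //; last by exists z.
- have clK : closed K.
    by apply: compact_closed cK; exact: (@norm_hausdorff R P).
  have oK : open (~` K) by exact: closed_openC.
  by move=> x Kx; apply/interiorP; move: oK; rewrite openE; exact.
- have /= [M [_ H]] := @compact_bounded R P K cK.
  exists (M + 1) => x Kx.
  have := H (M + 1); rewrite ltrDl ltr01 => /(_ isT x Kx).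
  by rewrite /= prod_normE ge_max => /andP[].

Qed.

Lemma bdP K x : convex_body K -> bd K x <-> (K x /\ ~ inner K x).
Proof.
move=> bK; have [cK _] := bK.
have clK : closed K by apply: compact_closed cK; exact: (@norm_hausdorff R P).
rewrite /bd -(closure_id K).1 // /setD /=.
by split => -[Kx nx]; split => // /interiorP.
Qed.

(** The homothety with centre [x] and ratio [t] carries the box around [z] to a box of radius
    [t * e] inside [K]. *)
Lemma inner_conv K x z t : convex_set K -> K x -> inner K z -> 0 < t <= 1 ->
  inner K (padd (pscale t z) (pscale (1 - t) x)).
Proof.
move=> vK Kx [e e0 H] /andP[t0 t1]; exists (t * e); first exact: mulr_gt0.
move=> y [/= y1 y2].
pose w : P := ((y.1 - (1 - t) * x.1) / t, (y.2 - (1 - t) * x.2) / t).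
have tN : t != 0 by rewrite gt_eqF.
have -> : y = padd (pscale t w) (pscale (1 - t) x).
  by case: y @w y1 y2 => a b /= y1 y2; rewrite /padd /pscale /=; congr (_, _); field.
apply: vK => //; last by rewrite ltW.
by apply: H; split; rewrite /w /= -(ltr_pM2l t0) -{1}(gtr0_norm t0) -normrM;
  [move: y1|move: y2]; apply: le_lt_trans; rewrite le_eqVlt; apply/orP; left;
  apply/eqP; congr (`|_|); field.
Qed.

Lemma dot_padd x y (u : P) t s :
  dot (padd (pscale t x) (pscale s y)) u = t * dot x u + s * dot y u.
Proof. by rewrite /dot /padd /pscale /=; ring. Qed.

(** An interior point lies on one side of the level; the segment from it to the point of [K] on the
    other side crosses the level in the interior. *)
Lemma inner_level K (u k k' : P) c : convex_set K -> (exists z, inner K z) ->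
  K k -> K k' -> dot k u < c -> c < dot k' u -> exists2 y, inner K y & dot y u = c.
Proof.
move=> vK [z iz] Kk Kk' kc ck'.
have [zc|zc|zc] := ltgtP (dot z u) c; last by exists z.
- pose t := (dot k' u - c) / (dot k' u - dot z u).
  have d0 : 0 < dot k' u - dot z u by lra.
  exists (padd (pscale t z) (pscale (1 - t) k')); last first.
    by rewrite dot_padd /t; field; rewrite gt_eqF.
  apply: inner_conv => //; apply/andP; split; first by apply: divr_gt0; lra.
  by rewrite /t ler_pdivrMr // mul1r; lra.
- pose t := (c - dot k u) / (dot z u - dot k u).
  have d0 : 0 < dot z u - dot k u by lra.
  exists (padd (pscale t z) (pscale (1 - t) k)); last first.
    by rewrite dot_padd /t; field; rewrite gt_eqF.
  apply: inner_conv => //; apply/andP; split; first by apply: divr_gt0; lra.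
  by rewrite /t ler_pdivrMr // mul1r; lra.
Qed.

Lemma regular_tame K : regular_body K -> tame K.
Proof. by move=> [cK bK _ _]; split => //; exact: measurable_box_closed. Qed.

Lemma box_open_dot (w : P) c : box_open [set x : P | dot x w < c].
Proof.
have -> : [set x : P | dot x w < c] = [set x : P | w.1 * x.1 + w.2 * x.2 < c].
  by apply/seteqP; split => x /=; rewrite /dot ![w.1 * _]mulrC ![w.2 * _]mulrC.
move: w.1 w.2 => a b x /= xc.
have n0 : 0 < `|a| + `|b| + 1.
  by have := normr_ge0 a; have := normr_ge0 b; lra.
exists ((c - (a * x.1 + b * x.2)) / (`|a| + `|b| + 1)); first by rewrite divr_gt0 // subr_gt0.
move=> y [y1 y2] /=; move: y1 y2; set e := _ / _.
have e0 : 0 < e by rewrite divr_gt0 // subr_gt0.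
move=> /ltW y1 /ltW y2.
have E : c - (a * x.1 + b * x.2) = e * (`|a| + `|b| + 1).
  by rewrite /e mulfVK // gt_eqF.
have i1 : a * (y.1 - x.1) <= `|a| * e.
  by apply: le_trans (ler_norm _) _; rewrite normrM ler_wpM2l.
have i2 : b * (y.2 - x.2) <= `|b| * e.
  by apply: le_trans (ler_norm _) _; rewrite normrM ler_wpM2l.
nra.
Qed.

Lemma measurable_dot_lt (u : P) t : plane_measurable [set x : P | dot x u < t].
Proof. by apply: measurable_box_open; exact: box_open_dot. Qed.

Lemma measurable_halfplane (u : P) t : plane_measurable (halfplane u t).
Proof.
have -> : halfplane u t = ~` [set x : P | dot x (- u.1, - u.2) < - t].
  apply/seteqP; split => x; rewrite /halfplane /dot /=; first by move=> ?; apply/negP; lra.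
  by move/negP; rewrite -leNgt; lra.
apply: measurableC; exact: measurable_dot_lt.
Qed.

(** Frame turning with the line of flotation: [s] is measured along the normal [uvec th], [t] along
    the chord. *)
Definition pt th s t : P := (s * cos th - t * sin th, s * sin th + t * cos th).

Lemma dot_pt_u th s t : dot (pt th s t) (uvec th) = s.
Proof. by rewrite /dot /= -[RHS]mulr1 -(cos2Dsin2 th); ring. Qed.

Lemma dot_pt_u' th s t : dot (pt th s t) (uvec' th) = t.
Proof. by rewrite /dot /= -[RHS]mulr1 -(cos2Dsin2 th); ring. Qed.

Lemma ptE th x : x = pt th (dot x (uvec th)) (dot x (uvec' th)).
Proof.
case: x => a b; rewrite /pt /dot /=; congr (_, _).
  by rewrite -[LHS]mulr1 -(cos2Dsin2 th); ring.
by rewrite -[LHS]mulr1 -(cos2Dsin2 th); ring.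
Qed.

Lemma pt_conv th s t s' t' r :
  padd (pscale r (pt th s t)) (pscale (1 - r) (pt th s' t')) =
  pt th (r * s + (1 - r) * s') (r * t + (1 - r) * t').
Proof. by rewrite /padd /pscale /pt /=; congr (_, _); ring. Qed.

Lemma pt_near th s t e s' t' : `|s' - s| < e -> `|t' - t| < e ->
  box (pt th s t) (2 * e) (pt th s' t').
Proof.
move=> hs ht; have c1 : `|cos th| <= 1 by rewrite ler_norml cos_geN1 cos_le1.
have i1 : `|sin th| <= 1 by rewrite ler_norml sin_geN1 sin_le1.
have H (a b p q : R) : `|a| < e -> `|b| < e -> `|p| <= 1 -> `|q| <= 1 ->
    `|a * p + b * q| < 2 * e.
  move=> ha hb hp hq; apply: le_lt_trans (ler_normD _ _) _; rewrite !normrM.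
  have := normr_ge0 a; have := normr_ge0 b; have := normr_ge0 p; have := normr_ge0 q.
  by move=> *; nra.
split; rewrite /pt /=.
  rewrite (_ : _ - _ - _ = (s' - s) * cos th + (t' - t) * (- sin th)); last by ring.
  by apply: H => //; rewrite normrN.
rewrite (_ : _ + _ - _ = (s' - s) * sin th + (t' - t) * cos th); last by ring.
exact: H.
Qed.

End ConvexPlane.

(** * Lines of flotation and their chords *)

Section Flotation.
Context {R : realType}.
Notation P := (R * R)%type.

Lemma closed_has_max (T : set R) (M t0 : R) : T t0 -> (forall t, T t -> t <= M) ->
  (forall t, ~ T t -> exists2 e, 0 < e & forall s, `|s - t| < e -> ~ T s) ->
  exists2 b, T b & forall t, T t -> t <= b.
Proof.
move=> Tt0 TM Tcl.
have supT : has_sup T by split; [exists t0|exists M => t /TM].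
exists (sup T); last by move=> t Tt; apply: ub_le_sup => //; case: supT.
have [//|nT] := pselect (T (sup T)).
have [e e0 H] := Tcl _ nT.
have [s Ts se] := sup_adherent e0 supT.
exfalso; apply: (H s) => //.
have ss : s <= sup T by apply: ub_le_sup => //; case: supT.
by rewrite ltr_distl; apply/andP; split; lra.
Qed.

Lemma closed_convex_interval (T : set R) (M t0 : R) : T t0 ->
  (forall t, T t -> `|t| <= M) ->
  (forall t, ~ T t -> exists2 e, 0 < e & forall s, `|s - t| < e -> ~ T s) ->
  (forall s t r, T s -> T t -> 0 <= r <= 1 -> T (r * s + (1 - r) * t)) ->
  exists a b, forall t, T t <-> a <= t <= b.
Proof.
move=> Tt0 TM Tcl Tcv.
have [|b Tb Hb] := closed_has_max T M t0 Tt0 _ Tcl.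
  by move=> t /TM; apply: le_trans; exact: ler_norm.
have [|||a Ta Ha] := closed_has_max [set t | T (- t)] M (- t0).
- by rewrite /= opprK.
- by move=> t /TM; rewrite normrN; apply: le_trans; exact: ler_norm.
- move=> t /Tcl [e e0 H]; exists e => // s st; apply: H.
  by rewrite -opprD normrN.
exists (- a), b => t; split.
  move=> Tt; rewrite Hb // andbT; have := Ha (- t); rewrite /= opprK => /(_ Tt); lra.
move=> /andP[at_ tb]; have [ab|ab] := ltP (- a) b; last first.
  by have -> : t = b by lra.
pose r := (t + a) / (b + a).
have d0 : 0 < b + a by lra.
have -> : t = r * b + (1 - r) * (- a) by rewrite /r; field; rewrite gt_eqF.
apply: Tcv => //; apply/andP; split; first by apply: divr_ge0; lra.
by rewrite /r ler_pdivrMr //; lra.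
Qed.

(** The ends are recorded by their coordinates along the line. The last clause excludes a chord that
    runs in the boundary. *)
Definition chord (K : set P) (th p a b : R) : Prop :=
  [/\ a < b, forall t, K (pt th p t) <-> a <= t <= b &
      forall t, a < t < b -> inner K (pt th p t)].

Lemma chord_exists (K : set P) th p : regular_body K ->
  (exists2 y, inner K y & dot y (uvec th) = p) ->
  exists a b, chord K th p a b.
Proof.
move=> [Kcl [M KM] Kcv _] [y iy yp].
have yE := ptE th y; rewrite yp in yE; set t0 := dot y (uvec' th) in yE.
have [||||a [b H]] := closed_convex_interval [set t | K (pt th p t)] (2 * M) t0.
- by rewrite /= -yE; exact: inner_sub.
- move=> t /= /KM [x1 x2]; rewrite -(dot_pt_u' th p t) /dot /=.
  apply: le_trans (ler_normD _ _) _; rewrite !normrM normrN.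
  have c1 : `|cos th| <= 1 by rewrite ler_norml cos_geN1 cos_le1.
  have i1 : `|sin th| <= 1 by rewrite ler_norml sin_geN1 sin_le1.
  have := normr_ge0 (pt th p t).1; have := normr_ge0 (pt th p t).2.
  rewrite /pt /= in x1 x2 *.
  have := normr_ge0 (cos th); have := normr_ge0 (sin th); nra.
- move=> t /= nK; have [e e0 H] := Kcl _ nK; exists (e / 2); first by rewrite divr_gt0.
  move=> s st; apply: H.
  rewrite -[X in box _ X](_ : 2 * (e / 2) = e); last by field.
  by apply: pt_near => //; rewrite subrr normr0 divr_gt0.
- move=> s t r Ks Kt r01 /=.
  have := Kcv _ _ Ks Kt r r01; rewrite pt_conv.
  by rewrite (_ : r * p + _ = p) //; ring.
have [e e0 He] := iy.
have Kn s : `|s - t0| < e / 2 -> K (pt th p s).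
  move=> st; apply: He; rewrite yE.
  rewrite -[X in box _ X](_ : 2 * (e / 2) = e); last by field.
  by apply: pt_near => //; rewrite subrr normr0 divr_gt0.
have lo : a <= t0 - e / 4.
  have : K (pt th p (t0 - e / 4)) by apply: Kn; rewrite ltr_distl; lra.
  by case/H/andP.
have hi : t0 + e / 4 <= b.
  have : K (pt th p (t0 + e / 4)) by apply: Kn; rewrite ltr_distl; lra.
  by case/H/andP.
have ab : a < b by lra.
exists a, b; split => // t /andP[at_ tb].
have Ka : K (pt th p a) by apply/H; lra.
have Kb : K (pt th p b) by apply/H; lra.
have it0 : inner K (pt th p t0) by rewrite -yE.
have [tt|tt] := leP t t0.
- pose r := (t - a) / (t0 - a); have d0 : 0 < t0 - a by lra.
  have := inner_conv _ _ _ r Kcv Ka it0; rewrite pt_conv.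
  rewrite (_ : r * p + _ = p); last by ring.
  rewrite (_ : r * t0 + _ = t); last by rewrite /r; field; rewrite gt_eqF.
  apply; apply/andP; split; first by apply: divr_gt0; lra.
  by rewrite /r ler_pdivrMr //; lra.
- pose r := (b - t) / (b - t0); have d0 : 0 < b - t0 by lra.
  have := inner_conv _ _ _ r Kcv Kb it0; rewrite pt_conv.
  rewrite (_ : r * p + _ = p); last by ring.
  rewrite (_ : r * t0 + _ = t); last by rewrite /r; field; rewrite gt_eqF.
  apply; apply/andP; split; first by apply: divr_gt0; lra.
  by rewrite /r ler_pdivrMr //; lra.
Qed.

Context (K : set P) (delta : R).
Hypothesis Kreg : regular_body K.
Hypothesis delta_gt0 : 0 < delta.
Hypothesis delta_lt : delta < ar K.

Let Ktame : tame K := regular_tame K Kreg.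

Definition cut_area (th t : R) : R := ar (K `&` halfplane (uvec th) t).

Local Notation S := cut_area.

Lemma tame_cut th t : tame (K `&` halfplane (uvec th) t).
Proof. by apply: tameI => //; exact: measurable_halfplane. Qed.

Lemma cut_area_diff th s t : s <= t ->
  S th t = S th s + ar ((K `&` halfplane (uvec th) t) `\` halfplane (uvec th) s).
Proof.
move=> st; rewrite {1}/S (ar_split _ (halfplane (uvec th) s)); last 2 first.
- exact: tame_cut.
- exact: measurable_halfplane.
rewrite -setIA; congr (ar (K `&` _) + _).
by apply/seteqP; split => x; rewrite /halfplane /=; [case|move=> H; split => //; lra].
Qed.

Lemma cut_area_mono th s t : s <= t -> S th s <= S th t.
Proof. by move=> st; rewrite (cut_area_diff _ s t) // lerDl ar_ge0. Qed.

Lemma cut_area_lip : exists2 C, 0 <= C & forall th s t, s <= t ->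
  S th t <= S th s + (t - s) * C.
Proof.
have [_ [M KM] _ [z iz]] := Kreg.
have M0 : 0 <= M.
  by have [] := KM z (inner_sub _ _ iz); move=> /(le_trans (normr_ge0 _)).
exists (4 * M); first by lra.
move=> th s t st; rewrite (cut_area_diff _ s t) // lerD2l.
apply: (ar_strip th) => //.
- by case: (tameD _ (halfplane (uvec th) s) (tame_cut th t)) => //; exact: measurable_halfplane.
- by move=> x [[/KM]].
- move=> x [[_]]; rewrite /halfplane /= => xt /negP; rewrite -ltNge => xs.
  by rewrite xt ltW.
Qed.

Lemma cts_cut_area th t : cts (S th) t.
Proof.
have [C C0 H] := cut_area_lip => e e0.
exists (e / (C + 1)); first by rewrite divr_gt0 //; lra.
move=> s; rewrite ltr_pdivlMr; last by lra.
move=> st; have [ts|ts] := leP t s.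
  have := H th t s ts; have := cut_area_mono th t s ts.
  move: st; rewrite ger0_norm ?subr_ge0 // => st h1 h2.
  by rewrite ltr_distl; lra.
have := H th s t (ltW ts); have := cut_area_mono th s t (ltW ts).
move: st; rewrite ltr0_norm ?subr_lt0 // => st h1 h2.
by rewrite ltr_distl; lra.
Qed.

Lemma cut_below th t : S th t > 0 -> exists2 k, K k & dot k (uvec th) < t.
Proof.
move=> S0; apply: contrapT => nk.
have [_ [M KM] _ [z iz]] := Kreg.
have M0 : 0 <= M.
  by have [] := KM z (inner_sub _ _ iz); move=> /(le_trans (normr_ge0 _)).
have : S th t <= (t - t) * (4 * M).
  apply: (ar_strip th) => //; first by case: (tame_cut th t).
    by move=> x [/KM].
  move=> x [Kx]; rewrite /halfplane /= => xt; rewrite xt andbT leNgt.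
  by apply/negP => xt'; apply: nk; exists x.
by rewrite subrr mul0r leNgt S0.
Qed.

Lemma cut_above th t : S th t < ar K -> exists2 k, K k & t < dot k (uvec th).
Proof.
move=> S0; apply: contrapT => nk; move: S0; rewrite ltNge => /negP; apply.
apply: ar_le => //; [by case: Ktame|exact: tame_cut|].
move=> x Kx; split => //; rewrite /halfplane /= leNgt.
by apply/negP => xt'; apply: nk; exists x.
Qed.

Lemma cut_area_exists th : exists t, S th t = delta.
Proof.
have [_ [M KM] _ [z iz]] := Kreg.
have bnd x : K x -> `|dot x (uvec th)| <= 2 * M.
  move=> /KM [x1 x2]; rewrite /dot /=.
  apply: le_trans (ler_normD _ _) _; rewrite !normrM.
  have c1 : `|cos th| <= 1 by rewrite ler_norml cos_geN1 cos_le1.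
  have i1 : `|sin th| <= 1 by rewrite ler_norml sin_geN1 sin_le1.
  have := normr_ge0 x.1; have := normr_ge0 x.2.
  have := normr_ge0 (cos th); have := normr_ge0 (sin th); nra.
have M0 : 0 <= 2 * M by apply: le_trans (bnd z (inner_sub _ _ iz)).
apply: (@cts_IVT R (S th) (- (2 * M) - 1) (2 * M + 1)).
- exact: cts_cut_area.
apply/andP; split; rewrite leNgt; apply/negP => H.
  have /cut_below [k /bnd] : 0 < S th (- (2 * M) - 1) by exact: lt_trans H.
  by rewrite ler_norml => /andP[? ?]; lra.
have /cut_above [k /bnd] : S th (2 * M + 1) < ar K by exact: lt_trans delta_lt.
by rewrite ler_norml => /andP[? ?]; lra.
Qed.

(** Since [0 < delta < ar K], there are points of [K] below [s] and, unless the level [t] already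
    cuts off everything, also above [t]. Hence some interior point lies halfway, and a small box
    around it is in the strip. *)
Lemma cut_area_strict th s t : s < t -> S th s = delta -> S th s < S th t.
Proof.
move=> st Ss.
have [|k Kk kt] := cut_below th s; first by rewrite Ss.
have [tK|tK] := ltP (S th t) (ar K); last by rewrite Ss; exact: lt_le_trans tK.
have [k' Kk' kt'] := cut_above _ _ tK.
have [_ _ Kcv Kz] := Kreg.
have [||y [e e0 He] yc] := inner_level _ (uvec th) _ _ ((s + t) / 2) Kcv Kz Kk Kk'; [lra|lra|].
rewrite (cut_area_diff _ s t) ?ltW // ltrDl.
pose e' := Num.min e ((t - s) / 8).
have e'0 : 0 < e' by rewrite lt_min e0 /= divr_gt0 // subr_gt0.
have e'e : e' <= e by rewrite ge_min lexx.
have e't : e' <= (t - s) / 8 by rewrite ge_min lexx orbT.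
apply: (ar_gt0 _ y e') => //.
  by apply: tameD; [exact: tame_cut|exact: measurable_halfplane].
move=> x [x1 x2].
have Kx : K x by apply: He; split; exact: lt_le_trans e'e.
have : `|dot x (uvec th) - dot y (uvec th)| < (t - s) / 2.
  rewrite (_ : dot x _ - _ = (x.1 - y.1) * cos th + (x.2 - y.2) * sin th); last first.
    by rewrite /dot /=; ring.
  apply: le_lt_trans (ler_normD _ _) _; rewrite !normrM.
  have c1 : `|cos th| <= 1 by rewrite ler_norml cos_geN1 cos_le1.
  have i1 : `|sin th| <= 1 by rewrite ler_norml sin_geN1 sin_le1.
  have := normr_ge0 (x.1 - y.1); have := normr_ge0 (x.2 - y.2).
  have := normr_ge0 (cos th); have := normr_ge0 (sin th); nra.
rewrite yc ltr_distl => /andP[l1 l2]; split; first by split => //; rewrite /halfplane /=; lra.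
by rewrite /halfplane /=; apply/negP; lra.
Qed.

Local Notation p := (flot_off K delta).

Lemma cut_area_flot th : S th (p th) = delta.
Proof.
have [t St] := cut_area_exists th.
have At : area (K `&` halfplane (uvec th) t) = delta%:E.
  by rewrite area_tame ?[ar _]St //; exact: tame_cut.
(* The set of levels is not empty, so [xget] does not fall back on its default [0]. *)
have /= Ap := @xgetPex _ 0
  [set t | area (K `&` halfplane (uvec th) t) = delta%:E] (ex_intro _ t At).
by rewrite /cut_area /ar /flot_off Ap.
Qed.

Lemma flot_le th t : delta <= S th t -> p th <= t.
Proof.
move=> St; rewrite leNgt; apply/negP => tp.
have Sp := cut_area_flot th; have mono := cut_area_mono th t _ (ltW tp).
have : S th t = delta by apply/le_anti; rewrite St andbT; rewrite Sp in mono.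
by move=> /(cut_area_strict _ _ _ tp); rewrite Sp ltNge St.
Qed.

Lemma flot_ge th t : S th t <= delta -> t <= p th.
Proof.
move=> St; rewrite leNgt; apply/negP => tp.
have := cut_area_strict _ _ _ tp (cut_area_flot th).
by rewrite cut_area_flot ltNge St.
Qed.

Lemma flot_inner th : exists2 y, inner K y & dot y (uvec th) = p th.
Proof.
have Sp := cut_area_flot th.
have [|k Kk kt] := cut_below th (p th); first by rewrite Sp.
have [|k' Kk' kt'] := cut_above th (p th); first by rewrite Sp.
have [_ _ Kcv Kz] := Kreg.
exact: inner_level kt kt'.
Qed.

Lemma flot_chords : exists a b : R -> R, forall th, chord K th (p th) (a th) (b th).
Proof.
have H th : exists ab : R * R, chord K th (p th) ab.1 ab.2.
  have [a [b ab]] := chord_exists K th (p th) Kreg (flot_inner th).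
  by exists (a, b).
have [f Hf] := choice H.
by exists (fun th => (f th).1), (fun th => (f th).2).
Qed.

(** The difference lies in a strip of width [0]. With the open half-plane, the points reflected in
    [flot_turn] lie strictly between the two lines. *)
Lemma cut_area_open th t : ar (K `&` [set x | dot x (uvec th) < t]) = S th t.
Proof.
rewrite /cut_area; set A := [set x | _]; set B := halfplane _ _.
have mA : plane_measurable A by exact: measurable_dot_lt.
rewrite (ar_split (K `&` B) A) //; last exact: tame_cut.
have -> : K `&` B `&` A = K `&` A.
  apply/seteqP; split => x; first by move=> [[? _] ?].
  by move=> [Kx Ax]; split => //; split => //; apply: ltW.
rewrite (_ : ar ((K `&` B) `\` A) = 0) ?addr0 //.
apply/le_anti; rewrite ar_ge0 andbT.
have [_ [M KM] _ [z iz]] := Kreg.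
have M0 : 0 <= M.
  by have [] := KM z (inner_sub _ _ iz); move=> /(le_trans (normr_ge0 _)).
have -> : 0 = (t - t) * (4 * M) by ring.
apply: (ar_strip th) => //.
- by case: (tameD _ A (tame_cut th t)).
- by move=> x [[/KM]].
- move=> x [[_]]; rewrite /B /halfplane /= => xt /negP; rewrite -leNgt => xs.
  by rewrite xt xs.
Qed.

End Flotation.

(** * Lines of flotation touch their envelope at the midpoint of the chord *)

Section FlotationDerivative.
Context {R : realType}.
Notation P := (R * R)%type.
Implicit Type K : set P.

Lemma box_pt K th s t e : 0 < e -> box (pt th s t) e `<=` K ->
  forall s' t', `|s' - s| < e / 2 -> `|t' - t| < e / 2 -> K (pt th s' t').
Proof.
move=> e0 H s' t' hs ht; apply: H.
have -> : e = 2 * (e / 2) by field.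
exact: pt_near.
Qed.

Lemma inner_pt K th s t : inner K (pt th s t) -> exists2 e, 0 < e &
  forall s' t', `|s' - s| < e -> `|t' - t| < e -> K (pt th s' t').
Proof.
move=> [e e0 H]; exists (e / 2); first by rewrite divr_gt0.
exact: box_pt H.
Qed.

Lemma outer_pt K th s t : regular_body K -> ~ K (pt th s t) -> exists2 e, 0 < e &
  forall s' t', `|s' - s| < e -> `|t' - t| < e -> ~ K (pt th s' t').
Proof.
move=> [Kcl _ _ _] /Kcl [e e0 H]; exists (e / 2); first by rewrite divr_gt0.
exact: (@box_pt (~` K) th s t e).
Qed.

Lemma pt_pi (th s t : R) : pt (th + pi) s t = pt th (- s) (- t).
Proof. by rewrite /pt cosDpi sinDpi; congr (_, _); ring. Qed.

Lemma chord_pi K th p a b : chord K th p a b -> chord K (th + pi) (- p) (- b) (- a).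
Proof.
move=> [ab H1 H2]; split; first by lra.
  move=> t; rewrite pt_pi opprK H1; split => /andP[? ?]; apply/andP; split; lra.
by move=> t /andP[? ?]; rewrite pt_pi opprK; apply: H2; apply/andP; split; lra.
Qed.

(** Seen from the chord point with coordinate [m + eta], the end [b] is nearer than the end [a] by
    [2 * eta]. This slack absorbs the change of [K] between nearby parallel lines. *)
Lemma reflect_short_side_pos K th p a b eta : regular_body K -> chord K th p a b ->
  0 < eta < (b - a) / 2 -> exists2 e, 0 < e & forall al be, `|al| < e -> 0 <= be ->
    K (pt th (p + al) ((a + b) / 2 + eta + be)) ->
    K (pt th (p - al) ((a + b) / 2 + eta - be)).
Proof.
move=> Kreg [ab H1 H2] /andP[eta0 etal]; set m := (a + b) / 2.
have Kcv : convex_set K by case: Kreg.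
have [|e1 e10 O1] := outer_pt K th p (b + eta) Kreg.
  by move=> /H1 /andP[_]; lra.
have [|e2 e20 O2] := inner_pt K th p (a + eta) _; first by apply: H2; lra.
have [|e3 e30 O3] := inner_pt K th p (m + eta) _; first by apply: H2; rewrite /m; lra.
exists (Num.min e1 (Num.min e2 e3)); first by rewrite !lt_min e10 e20.
move=> al be; rewrite !lt_min => /and3P[al1 al2 al3] be0 Kz.
have KM : K (pt th p m) by apply/H1; rewrite /m; lra.
(* Otherwise the segment from the midpoint to the given point of [K] would pass through coordinate
   [b + eta] close to the chord line, where [K] has no points. *)
have bem : be < b - m.
  rewrite ltNge; apply/negP => bem.
  pose r := (b + eta - m) / (eta + be).
  have d0 : 0 < eta + be by lra.
  have r01 : 0 <= r <= 1.
    apply/andP; split; first by apply: divr_ge0; [rewrite /m; lra|lra].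
    by rewrite /r ler_pdivrMr //; lra.
  have := Kcv _ _ Kz KM r r01; rewrite pt_conv; apply: O1; last first.
    by rewrite (_ : _ - _ = 0) ?normr0 //; rewrite /r; field; rewrite gt_eqF.
  rewrite (_ : _ - p = r * al); last by ring.
  rewrite normrM; apply: le_lt_trans al1.
  by case/andP: r01 => r0 r1; rewrite (ger0_norm r0) ler_piMl.
have K2 : K (pt th (p - al) (a + eta)).
  by apply: O2; rewrite ?subrr ?normr0 // (_ : _ - p = - al) ?normrN //; ring.
have K3 : K (pt th (p - al) (m + eta)).
  by apply: O3; rewrite ?subrr ?normr0 // (_ : _ - p = - al) ?normrN //; ring.
(* By [bem] the reflected coordinate [m + eta - be] exceeds [a + eta], so the reflected point lies
   between those of [K2] and [K3]. *)
pose r := (m - be - a) / (m - a).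
have d0 : 0 < m - a by rewrite /m; lra.
have r01 : 0 <= r <= 1.
  apply/andP; split; first by apply: divr_ge0; [rewrite /m in bem *; lra|lra].
  by rewrite /r ler_pdivrMr //; lra.
have := Kcv _ _ K3 K2 r r01; rewrite pt_conv.
rewrite (_ : r * (p - al) + _ = p - al); last by ring.
by rewrite (_ : r * (m + eta) + _ = m + eta - be) // /r; field; rewrite gt_eqF.
Qed.

(** For [eta < 0] the frame is turned by [pi], which exchanges the two ends of the chord. *)
Lemma reflect_short_side K th p a b eta : regular_body K -> chord K th p a b ->
  0 < `|eta| < (b - a) / 2 -> exists2 e, 0 < e & forall al be, `|al| < e ->
    0 <= be * eta -> K (pt th (p + al) ((a + b) / 2 + eta + be)) ->
    K (pt th (p - al) ((a + b) / 2 + eta - be)).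
Proof.
move=> Kreg chK; case: (ltgtP eta 0) => [eta0|eta0|->]; last by rewrite normr0 ltxx.
- rewrite ltr0_norm // => H.
  have [|e e0 He] := reflect_short_side_pos _ _ _ _ _ (- eta) Kreg (chord_pi _ _ _ _ _ chK).
    by lra.
  exists e => // al be ale be0 Kz.
  have := He (- al) (- be); rewrite !pt_pi normrN => /(_ ale).
  rewrite (_ : - (- p - - al) = p - al); last by ring.
  rewrite (_ : - (- p + - al) = p + al); last by ring.
  rewrite (_ : - (_ + - be) = (a + b) / 2 + eta + be); last by ring.
  rewrite (_ : - (_ - - be) = (a + b) / 2 + eta - be); last by ring.
  by apply => //; nra.
- rewrite gtr0_norm // => H.
  have [|e e0 He] := reflect_short_side_pos _ _ _ _ _ eta Kreg chK; first by lra.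
  by exists e => // al be ale be0 Kz; apply: He => //; nra.
Qed.

Definition refl (X x : P) : P := (2 * X.1 - x.1, 2 * X.2 - x.2).

(** The common part of [U] and [V] cancels, and the point reflection in [X] embeds the rest of [U]
    in the rest of [V]. *)
Lemma ar_swap (X : P) (U V : set P) : tame U -> tame V ->
  (forall x, U (refl X x) -> ~ V (refl X x) -> V x /\ ~ U x) -> ar U <= ar V.
Proof.
move=> tU tV H; have [mU _] := tU; have [mV _] := tV.
rewrite (ar_split U V) // (ar_split V U) // setIC lerD2l.
rewrite -(@ar_affine _ (- 1) 0 0 (- 1) (2 * X.1) (2 * X.2)); last 2 first.
- by ring.
- exact: measurableD.
have E x : affine (- 1) 0 0 (- 1) (2 * X.1) (2 * X.2) x = refl X x.
  by rewrite /affine /refl; congr (_, _); ring.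
apply: ar_le; first by apply: measurable_affine_preimage; exact: measurableD.
  exact: tameD.
by move=> x [/=]; rewrite E; exact: H.
Qed.

Lemma dot_pt_turn (th h s t : R) : dot (pt th s t) (uvec (th + h)) = s * cos h + t * sin h.
Proof.
rewrite /dot /= cosD sinD.
rewrite (_ : s * cos h = s * cos h * (cos th ^+ 2 + sin th ^+ 2)); last by rewrite cos2Dsin2 mulr1.
rewrite (_ : t * sin h = t * sin h * (cos th ^+ 2 + sin th ^+ 2)); last by rewrite cos2Dsin2 mulr1.
by ring.
Qed.

Lemma refl_pt (th s t s' t' : R) : refl (pt th s t) (pt th s' t') = pt th (2 * s - s') (2 * t - t').
Proof. by rewrite /refl /pt /=; congr (_, _); ring. Qed.

Lemma small_turn (C e : R) : 0 < e -> 0 <= C -> exists2 d, 0 < d & forall h, `|h| < d ->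
  [/\ 0 < cos h, `|sin h| * C < e * cos h, `|sin h| <= 2 * `|h| & h ^+ 2 / 2 <= h * sin h].
Proof.
move=> e0 C0.
have s0 : dif (@sin R) 0 1 by rewrite -cos0; exact: dif_sin.
have [d1 d10 H1] := dif_cts _ _ _ (dif_cos (0 : R)) (1 / 2) ltac:(by lra).
have [d2 d20 H2] := s0 (1 / 2) ltac:(by lra).
exists (Num.min d1 (Num.min d2 (e / (4 * C + 4)))).
  by rewrite !lt_min d10 d20 divr_gt0 //; lra.
move=> h; rewrite !lt_min => /and3P[h1 h2 h3].
have := H1 h; rewrite subr0 cos0 => /(_ h1); rewrite ltr_distl => /andP[c1 c2].
have := H2 h h2; rewrite add0r sin0 subr0 mul1r.
move: h3; rewrite ltr_pdivlMr; last by lra.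
rewrite ler_distl => h3 /andP[i1 i2].
have I : `|sin h| <= 2 * `|h|.
  by rewrite ler_norml; have := ler_norm h; have := ler_norm (- h); rewrite normrN; lra.
split => //; first lra.
- have := normr_ge0 h; nra.
- by case: (lerP 0 h) i1 i2 => [h0|h0];
    [rewrite ger0_norm //|rewrite ltr0_norm //] => ? ?; nra.
Qed.

Lemma mul_same_sign (x y s : R) : 0 < (x * s) * (y * s) -> 0 < x * y.
Proof.
rewrite (_ : _ * _ = (x * y) * s ^+ 2); last by ring.
have [->|s0] := eqVneq s 0; first by rewrite expr0n mulr0 ltxx.
by rewrite pmulr_lgt0 // exprn_even_gt0.
Qed.

Lemma squeeze_slope (q x y k e : R) : x + (k - e) * y <= q -> q <= x + (k + e) * y ->
  x + k * y - e * y <= q <= x + k * y + e * y.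
Proof. by rewrite mulrBl mulrDl !addrA => -> ->. Qed.

(** [p th * cos h + (m + eta) * sin h] is the level, in direction [th + h], of the line turned about
    the chord point with coordinate [m + eta]. Small [eta] of both signs squeeze [p (th + h)]
    between two such levels. *)
Lemma dif_envelope (p : R -> R) (th m l : R) : 0 < l ->
  (forall eta, 0 < `|eta| < l -> exists2 d, 0 < d & forall h, `|h| < d ->
    (0 < eta * sin h -> p (th + h) <= p th * cos h + (m + eta) * sin h) /\
    (eta * sin h < 0 -> p th * cos h + (m + eta) * sin h <= p (th + h))) ->
  dif p th m.
Proof.
move=> l0 turn e e0.
(* [e / 4] because [|sin h|] is at most [2 * |h|]; the other half of [e] goes to the smooth
   comparison function [df]. *)
pose eta := Num.min (e / 4) (l / 2).
have eta0 : 0 < eta by rewrite lt_min !divr_gt0.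
have etae : eta <= e / 4 by rewrite ge_min lexx.
have etab : eta <= l / 2 by rewrite ge_min lexx orbT.
have [|d1 d10 H1] := turn eta; first by rewrite gtr0_norm // eta0; lra.
have [|d2 d20 H2] := turn (- eta); first by rewrite normrN gtr0_norm // eta0; lra.
have [d3 d30 H3] := small_turn 0 1 ltr01 (lexx 0).
have df : dif (fun h => p th * cos h + m * sin h) 0 (m).
  apply: dif_ext (difD _ _ _ _ _ (difM _ _ _ _ _ (dif_const (p th) 0) (dif_cos 0))
    (difM _ _ _ _ _ (dif_const (m) 0) (dif_sin 0))) => //=.
  by rewrite cos0 sin0; ring.
have [d4 d40 H4] := df (e / 2) ltac:(by lra).
exists (Num.min (Num.min d1 d2) (Num.min d3 d4)); first by rewrite !lt_min d10 d20 d30.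
move=> h; rewrite !lt_min => /andP[/andP[/H1 [A1 A2] /H2 [B1 B2]] /andP[/H3 [_ _ sh hs] /H4]].
rewrite add0r cos0 sin0 mulr1 mulr0 addr0 => F.
have G : `|p (th + h) - (p th * cos h + m * sin h)| <= eta * `|sin h|.
  rewrite ler_distl; case: (ltgtP (sin h) 0) => [s0|s0|s0].
  - have es : eta * sin h < 0 by rewrite pmulr_rlt0.
    rewrite ltr0_norm // mulrN -mulNr; apply: squeeze_slope; first by rewrite opprK; exact: A2.
    by apply: B1; rewrite mulNr oppr_gt0.
  - have es : 0 < eta * sin h by rewrite pmulr_rgt0.
    rewrite gtr0_norm //; apply: squeeze_slope; last exact: A1.
    by apply: B2; rewrite mulNr oppr_lt0.
  - have h0 : h = 0.
      move: hs; rewrite s0 mulr0 => hs; apply/eqP; rewrite -sqrf_eq0; apply/eqP.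
      by apply/le_anti; rewrite sqr_ge0 andbT; lra.
    by rewrite h0 addr0 cos0 sin0 normr0; lra.
rewrite (_ : _ - _ - _ = (p (th + h) - (p th * cos h + m * sin h)) +
  (p th * cos h + m * sin h - p th - m * h)); last by ring.
apply: le_trans (ler_normD _ _) _; apply: le_trans (lerD G F) _.
have : eta * `|sin h| <= e / 4 * (2 * `|h|) by apply: ler_pM => //; exact: ltW.
by lra.
Qed.

Context (K : set P) (delta : R).
Hypothesis Kreg : regular_body K.
Hypothesis delta_gt0 : 0 < delta.
Hypothesis delta_lt : delta < ar K.
Local Notation p := (flot_off K delta).
Context (a b : R -> R).
Hypothesis chK : forall th, chord K th (p th) (a th) (b th).
Local Notation m := (fun th => (a th + b th) / 2).

Let Ktame : tame K := regular_tame K Kreg.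

(* Turning the line of flotation about a point off the midpoint of the chord
   sweeps more area on the long side: reflecting in that point maps the
   short-side wedge of K into the long-side one. *)
Lemma flot_turn th eta : 0 < `|eta| < (b th - a th) / 2 ->
  exists2 d, 0 < d & forall h, `|h| < d ->
    (0 < eta * sin h -> p (th + h) <= p th * cos h + (m th + eta) * sin h) /\
    (eta * sin h < 0 -> p th * cos h + (m th + eta) * sin h <= p (th + h)).
Proof.
move=> etal; have [e e0 He] := reflect_short_side _ _ _ _ _ _ Kreg (chK th) etal.
have [_ [M KM] _ [z0 iz0]] := Kreg.
have M0 : 0 <= M.
  by have [] := KM z0 (inner_sub _ _ iz0); move=> /(le_trans (normr_ge0 _)).
(* Bound on the distance, along the chord direction, from the turning point [X] to any point of
   [K]. *)
pose C := 2 * M + `|m th + eta|.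
have C0 : 0 <= C by rewrite /C; have := normr_ge0 (m th + eta); lra.
have [d d0 Hd] := small_turn C e e0 C0.
exists d => // h /Hd [c0 sC _ _]; set t := p th * cos h + _.
pose X := pt th (p th) (m th + eta).
have bnd x : K x -> `|dot x (uvec' th) - (m th + eta)| <= C.
  move=> /KM [x1 x2]; apply: le_trans (ler_normB _ _) _; rewrite lerD2r /dot /=.
  apply: le_trans (ler_normD _ _) _; rewrite !normrM normrN.
  have c1 : `|cos th| <= 1 by rewrite ler_norml cos_geN1 cos_le1.
  have i1 : `|sin th| <= 1 by rewrite ler_norml sin_geN1 sin_le1.
  have := normr_ge0 x.1; have := normr_ge0 x.2.
  have := normr_ge0 (cos th); have := normr_ge0 (sin th); nra.
(* A point of [K] between the two lines has [|al| * cos h < |be * sin h|], so for a small turn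
   [|al| < e] and the reflection result applies. *)
have key x al be : x = pt th (p th + al) (m th + eta + be) -> K x ->
    al * (al * cos h + be * sin h) < 0 -> 0 < be * eta ->
    K (pt th (p th - al) (m th + eta - be)).
  move=> xE Kx sgn be0; apply: He; rewrite ?ltW // -?xE //.
  have := bnd x Kx; rewrite xE dot_pt_u' (_ : _ + be - _ = be); last by ring.
  move=> beC; rewrite -(ltr_pM2r c0); apply: le_lt_trans sC.
  apply: (@le_trans _ _ (`|sin h| * `|be|)); last by rewrite ler_wpM2l.
  rewrite -normrM; case: (ltgtP al 0) sgn => [al0|al0|->]; last by rewrite mul0r ltxx.
    move=> sgn; have : 0 < al * cos h + be * sin h by nra.
    by rewrite (ltr0_norm al0) [sin h * _]mulrC => ?; have := ler_norm (be * sin h); lra.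
  move=> sgn; have : al * cos h + be * sin h < 0 by nra.
  by rewrite (gtr0_norm al0) [sin h * _]mulrC => ?; have := ler_norm (- (be * sin h)); rewrite normrN; lra.
have coord x : exists al be, x = pt th (p th + al) (m th + eta + be).
  exists (dot x (uvec th) - p th), (dot x (uvec' th) - (m th + eta)).
  by rewrite {1}(ptE th x); congr pt; ring.
have xd al be : dot (pt th (p th + al) (m th + eta + be)) (uvec (th + h)) =
    t + (al * cos h + be * sin h) by rewrite dot_pt_turn /t; ring.
have rf al be : refl X (pt th (p th + al) (m th + eta + be)) =
    pt th (p th + - al) (m th + eta + - be).
  by rewrite refl_pt; congr pt; ring.
split=> es.
(* Reflection in [X] sends what the turn loses into what it gains, so the turned half-plane cuts off
   at least [delta]. The other sign of [eta * sin h] exchanges the two caps. *)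
- apply: flot_le => //; rewrite -(cut_area_flot K delta Kreg delta_gt0 delta_lt th).
  rewrite -cut_area_open //; apply: (ar_swap X).
  + by apply: tameI => //; exact: measurable_dot_lt.
  + exact: tame_cut.
  move=> x; have [al [be xE]] := coord x; rewrite xE rf.
  move=> [Ky /=]; rewrite dot_pt_u => y1 y2.
  have {}y2 : 0 < - al * cos h + - be * sin h.
    rewrite ltNge; apply/negP => H; apply: y2; split => //.
    by rewrite /halfplane /= xd; lra.
  have al0 : 0 < al by lra.
  split.
    split.
      rewrite -[al]opprK -[be]opprK; apply: (key _ (- al) (- be) erefl) => //; first by nra.
      have : 0 < (- be) * sin h by nra.
      by move=> ?; apply: (@mul_same_sign _ _ (sin h)); nra.
    by rewrite /halfplane /= xd; lra.
  by move=> [_ /=]; rewrite dot_pt_u; apply/negP; lra.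
- apply: flot_ge => //; rewrite -(cut_area_flot K delta Kreg delta_gt0 delta_lt th).
  rewrite -(cut_area_open K Kreg (th + h)); apply: (ar_swap X).
  + by apply: tameI => //; exact: measurable_dot_lt.
  + exact: tame_cut.
  move=> x; have [al [be xE]] := coord x; rewrite xE rf.
  move=> [Ky /=]; rewrite xd => y1 y2.
  have {}y2 : 0 < - al.
    rewrite ltNge; apply/negP => H; apply: y2; split => //.
    by rewrite /halfplane /= dot_pt_u; lra.
  split.
    split.
      rewrite -[al]opprK -[be]opprK; apply: (key _ (- al) (- be) erefl) => //; first by nra.
      have : (- be) * sin h < 0 by nra.
      by move=> ?; apply: (@mul_same_sign _ _ (sin h)); nra.
    by rewrite /halfplane /= dot_pt_u; lra.
  by move=> [_ /=]; rewrite xd; apply/negP; lra.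
Qed.

Lemma dif_flot th : dif p th (m th).
Proof.
have [ab _ _] := chK th.
apply: (@dif_envelope _ _ _ ((b th - a th) / 2)); first by rewrite divr_gt0 // subr_gt0.
exact: flot_turn.
Qed.

End FlotationDerivative.

(** * The boundary curve near a point and its tangent lines *)

Section BoundaryCurve.
Context {R : realType}.
Notation P := (R * R)%type.
Implicit Type K : set P.

Lemma dif_shift (f : R -> R) x l : dif (fun h => f (x + h)) 0 l -> dif f x l.
Proof. by move=> H e /H [d d0 Hd]; exists d => // h /Hd; rewrite add0r addr0. Qed.

Lemma dif_unshift (f : R -> R) x l : dif f x l -> dif (fun h => f (x + h)) 0 l.
Proof. by move=> H e /H [d d0 Hd]; exists d => // h /Hd; rewrite add0r addr0. Qed.

Lemma cts_unshift (f : R -> R) x : cts f x -> cts (fun h => f (x + h)) 0.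
Proof.
move=> H e /H [d d0 Hd]; exists d => // h; rewrite subr0 addr0 => hd.
by apply: Hd; rewrite addrAC subrr add0r.
Qed.

(** This replaces the chain rule for a point moving on a curve: the parametrization of the curve
    never has to be inverted. *)
Lemma dif_tangent (al be : R -> R) (k c : R) : dif al 0 k -> al 0 = 0 -> be 0 = 0 ->
  (forall e, 0 < e -> exists2 d, 0 < d & forall h, `|h| < d ->
     `|be h - c * al h| <= e * `|al h|) ->
  dif be 0 (c * k).
Proof.
move=> dal al0 be0 H.
have dr : dif (fun h => be h - c * al h) 0 0.
  move=> e e0.
  have [d1 d10 H1] := dal 1 ltr01.
  have k0 : 0 < `|k| + 1 by have := normr_ge0 k; lra.
  have [d2 d20 H2] := H (e / (`|k| + 1)) ltac:(by rewrite divr_gt0).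
  exists (Num.min d1 d2); first by rewrite lt_min d10.
  move=> h; rewrite lt_min => /andP[/H1 + /H2].
  rewrite !add0r al0 be0 mulr0 !subr0 mul0r subr0 mul1r => A1 A2.
  apply: le_trans A2 _; rewrite -mulrA ler_pM2l // mulrC ler_pdivrMr //.
  have -> : al h = (al h - k * h) + k * h by ring.
  by apply: le_trans (ler_normD _ _) _; rewrite normrM; lra.
apply: dif_ext (difD _ _ _ _ _ dr (difM _ _ _ _ _ (dif_const c 0) dal)).
- by move=> y /=; ring.
- by rewrite al0; ring.
Qed.

(** By compactness the squared distance [F] to the point at [s0] has a positive minimum on the arc
    away from [s0], so a nearby curve point has a parameter near [s0] modulo the period. *)
Lemma cts_periodic_local (g1 g2 : R -> R) (L s0 eta : R) :
  (forall s, cts g1 s) -> (forall s, cts g2 s) -> 0 < L ->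
  (forall s, g1 (s + L) = g1 s /\ g2 (s + L) = g2 s) ->
  (forall s t, 0 <= s < L -> 0 <= t < L -> (g1 s, g2 s) = (g1 t, g2 t) -> s = t) ->
  0 < eta -> exists2 e, 0 < e & forall s, box (g1 s0, g2 s0) e (g1 s, g2 s) ->
    exists2 s', `|s' - s0| < eta & (g1 s', g2 s') = (g1 s, g2 s).
Proof.
move=> c1 c2 L0 per inj eta0.
have perN (n : nat) s : (g1 (s + L *+ n), g2 (s + L *+ n)) = (g1 s, g2 s).
  elim: n => [|n IH]; first by rewrite mulr0n addr0.
  by rewrite mulrS addrCA addrC; have [-> ->] := per (s + L *+ n).
have perZ (n : int) s : (g1 (s + L *~ n), g2 (s + L *~ n)) = (g1 s, g2 s).
  case: n => n; first exact: perN.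
  by rewrite NegzE mulrNz -(perN n.+1 (s - _)) -pmulrn subrK.
have red (x0 s : R) : exists n : int, x0 <= s + L *~ n < x0 + L.
  exists (- Num.floor ((s - x0) / L)).
  have := floor_itv ((s - x0) / L).
  rewrite mulrNz -mulrzr; set z := (Num.floor _)%:~R.
  rewrite intrD -/z => /andP[z1 z2].
  rewrite ler_pdivlMr // in z1; rewrite ltr_pdivrMr // in z2.
  by apply/andP; split; nra.
(* Injectivity is given on one period starting at [0] and is moved here to the period starting at
   [s0]. *)
have inj' c : s0 < c < s0 + L -> (g1 c, g2 c) <> (g1 s0, g2 s0).
  move=> /andP[c1' c2'] E.
  have [n /andP[n1 n2]] := red 0 s0; have [k /andP[k1 k2]] := red 0 c.
  rewrite add0r in n2 k2.
  have EE : c + L *~ k = s0 + L *~ n.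
    apply: inj; rewrite ?n1 ?n2 ?k1 ?k2 //.
    by have := perZ k c; have := perZ n s0; move=> -> ->.
  have : c - s0 = L * (n - k)%:~R.
    by rewrite intrB mulrBr !mulrzr; lra.
  move=> D; have : 0 < L * (n - k)%:~R < L by rewrite -D; lra.
  rewrite pmulr_rgt0 // -{2}[L]mulr1 ltr_pM2l // ltr0z -[1]/(1%:~R) ltr_int.
  by case: (n - k) => [[|[|?]]|].
pose eta' := Num.min eta (L / 4).
have e'0 : 0 < eta' by rewrite lt_min eta0 divr_gt0.
have e'1 : eta' <= eta by rewrite ge_min lexx.
have e'2 : eta' <= L / 4 by rewrite ge_min lexx orbT.
pose F s := (g1 s - g1 s0) * (g1 s - g1 s0) + (g2 s - g2 s0) * (g2 s - g2 s0).
have [|c cI cmin] := @EVT_min R F (s0 + eta') (s0 + L - eta') ltac:(by lra).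
  apply: continuous_subspaceT => s; apply/ctsP.
  have d1 : cts (fun s => g1 s - g1 s0) s by apply: ctsD => //; exact: cts_const.
  have d2 : cts (fun s => g2 s - g2 s0) s by apply: ctsD => //; exact: cts_const.
  by apply: ctsD; exact: ctsM.
have Fc : 0 < F c.
  have Fge : 0 <= F c by rewrite /F -!expr2 addr_ge0 // sqr_ge0.
  rewrite lt_def Fge andbT; apply/eqP => F0.
  apply: (inj' c); first by move: cI; rewrite in_itv /= => /andP[? ?]; lra.
  have := sqr_ge0 (g1 c - g1 s0); have := sqr_ge0 (g2 c - g2 s0).
  rewrite /F -!expr2 in F0 => h1 h2.
  have /eqP : (g1 c - g1 s0) ^+ 2 = 0 by lra.
  have /eqP : (g2 c - g2 s0) ^+ 2 = 0 by lra.
  by rewrite !sqrf_eq0 !subr_eq0 => /eqP -> /eqP ->.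
(* As [e] is at most [1], differences below [e] have squares below [e], and two such squares sum to
   less than [F c]. *)
pose e := Num.min 1 (F c / 2).
have e0 : 0 < e by rewrite lt_min ltr01 divr_gt0.
have e1 : e <= 1 by rewrite ge_min lexx.
have e2 : e <= F c / 2 by rewrite ge_min lexx orbT.
exists e => // s [/= b1 b2].
have [n /andP[n1 n2]] := red s0 s.
have [s1|s1] := ltP (s + L *~ n) (s0 + eta').
  by exists (s + L *~ n); [rewrite ltr_distl; lra|exact: perZ].
have [s2|s2] := ltP (s0 + L - eta') (s + L *~ n).
  exists (s + L *~ (n - 1)); last exact: perZ.
  by rewrite mulrzBr mulr1z ltr_distl; lra.
have : F c <= F (s + L *~ n) by apply: cmin; rewrite in_itv /=; lra.
have [G1 G2] := perZ n s; rewrite /F G1 G2.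
have q1 : (g1 s - g1 s0) * (g1 s - g1 s0) < e.
  by rewrite -expr2 -real_normK ?num_real // expr2; have := normr_ge0 (g1 s - g1 s0); nra.
have q2 : (g2 s - g2 s0) * (g2 s - g2 s0) < e.
  by rewrite -expr2 -real_normK ?num_real // expr2; have := normr_ge0 (g2 s - g2 s0); nra.
by rewrite -/(F c) => ?; exfalso; lra.
Qed.

(** If the tangent separated points of [K], it would contain an interior point [y]. Step along the
    curve away from [y] and prolong the secant back through the point of tangency: the resulting [w]
    is close to [y], hence interior, and the point of tangency, lying between [w] and a point of
    [K], would be interior too. *)
Lemma tangent_supports K (g1 g2 : R -> R) s0 v1 v2 k k' : regular_body K ->
  (forall s, K (g1 s, g2 s)) -> ~ inner K (g1 s0, g2 s0) ->
  dif g1 s0 v1 -> dif g2 s0 v2 -> (v1, v2) <> (0, 0) -> K k -> K k' ->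
  ~ (det2 (v1, v2) (k.1 - g1 s0, k.2 - g2 s0) < 0 <
     det2 (v1, v2) (k'.1 - g1 s0, k'.2 - g2 s0)).
Proof.
move=> [_ _ Kcv Kz] gK nA dg1 dg2 v0 Kk Kk' /andP[k0 k'0].
pose u : P := (- v2, v1).
have [||[y1 y2] [e e0 He] yu] := inner_level _ u _ _ (dot (g1 s0, g2 s0) u) Kcv Kz Kk Kk'.
- by move: k0; rewrite /det2 /dot /u /=; lra.
- by move: k'0; rewrite /det2 /dot /u /=; lra.
have n0 : 0 < v1 ^+ 2 + v2 ^+ 2.
  have := sqr_ge0 v1; have := sqr_ge0 v2 => h1 h2.
  rewrite lt_def addr_ge0 // andbT; apply/eqP => E; apply: v0.
  have /eqP : v1 ^+ 2 = 0 by lra.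
  have /eqP : v2 ^+ 2 = 0 by lra.
  by rewrite !sqrf_eq0 => /eqP -> /eqP ->.
pose c := (v1 * (y1 - g1 s0) + v2 * (y2 - g2 s0)) / (v1 ^+ 2 + v2 ^+ 2).
have nN : v1 ^+ 2 + v2 ^+ 2 != 0 by rewrite gt_eqF.
have D : v1 * (y2 - g2 s0) = v2 * (y1 - g1 s0) by move: yu; rewrite /dot /u /=; lra.
have cn : c * (v1 ^+ 2 + v2 ^+ 2) = v1 * (y1 - g1 s0) + v2 * (y2 - g2 s0) by rewrite /c mulfVK.
have Y1 : y1 = g1 s0 + c * v1.
  apply/(mulIf nN); rewrite mulrDl [c * _ * _]mulrAC cn.
  have : v2 * (v1 * (y2 - g2 s0)) = v2 * (v2 * (y1 - g1 s0)) by rewrite D.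
  by lra.
have Y2 : y2 = g2 s0 + c * v2.
  apply/(mulIf nN); rewrite mulrDl [c * _ * _]mulrAC cn.
  have : v1 * (v1 * (y2 - g2 s0)) = v1 * (v2 * (y1 - g1 s0)) by rewrite D.
  by lra.
have iy : inner K (y1, y2) by exists e.
have [c0|c0] := eqVneq c 0; first by apply: nA; rewrite Y1 Y2 c0 !mul0r !addr0 in iy.
have c0' : 0 < `|c| by rewrite normr_gt0.
have ec0 : 0 < e / (4 * `|c|) by rewrite divr_gt0 // mulr_gt0.
have [d1 d10 H1] := dg1 _ ec0; have [d2 d20 H2] := dg2 _ ec0.
pose d := Num.min d1 d2 / 2.
have d0 : 0 < d by rewrite divr_gt0 // lt_min d10.
have dd : d < Num.min d1 d2 by rewrite /d; have : 0 < Num.min d1 d2 by [rewrite lt_min d10]; lra.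
(* The sign makes the step point away from [y = g(s0) + c * v]. With the ratio [r] below,
   [r * h = - c], so [w] differs from [y] only by [r] times a first-order error. *)
pose h := - (c / `|c|) * d.
have hN : `|h| = d by rewrite normrM normrN normf_div normr_id divff ?gt_eqF // mul1r gtr0_norm.
have h0 : h != 0 by rewrite -normr_gt0 hN.
have hd1 : `|h| < d1 by rewrite hN; apply: lt_le_trans dd _; rewrite ge_min lexx.
have hd2 : `|h| < d2 by rewrite hN; apply: lt_le_trans dd _; rewrite ge_min lexx orbT.
have {}H1 := H1 h hd1; have {}H2 := H2 h hd2; rewrite hN in H1 H2.
pose r := `|c| / d.
have r0 : 0 < r by rewrite divr_gt0.
pose w : P := (g1 s0 + r * (g1 s0 - g1 (s0 + h)), g2 s0 + r * (g2 s0 - g2 (s0 + h))).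
have cN : `|c| != 0 by rewrite normr_eq0.
have dN : d != 0 by rewrite gt_eqF.
have rh : r * h = - c by rewrite /r /h; field; rewrite dN cN.
have iw : inner K w.
  exists (e / 2); first by rewrite divr_gt0.
  move=> x [/= x1 x2]; apply: He.
  have rd : r * (e / (4 * `|c|) * d) = e / 4 by rewrite /r; field; rewrite dN cN.
  have T1 : `|w.1 - y1| <= e / 4.
    rewrite /= Y1 (_ : _ - _ = - r * (g1 (s0 + h) - g1 s0 - v1 * h)); last first.
      by rewrite -[c]opprK -rh; ring.
    by rewrite normrM normrN (gtr0_norm r0) -rd ler_pM2l.
  have T2 : `|w.2 - y2| <= e / 4.
    rewrite /= Y2 (_ : _ - _ = - r * (g2 (s0 + h) - g2 s0 - v2 * h)); last first.
      by rewrite -[c]opprK -rh; ring.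
    by rewrite normrM normrN (gtr0_norm r0) -rd ler_pM2l.
  split => /=.
    rewrite (_ : _ - _ = (x.1 - w.1) + (w.1 - y1)); last by ring.
    by apply: le_lt_trans (ler_normD _ _) _; rewrite /= in T1 *; lra.
  rewrite (_ : _ - _ = (x.2 - w.2) + (w.2 - y2)); last by ring.
  by apply: le_lt_trans (ler_normD _ _) _; rewrite /= in T2 *; lra.
apply: nA.
have := inner_conv _ _ _ (1 / (1 + r)) Kcv (gK (s0 + h)) iw.
have r1 : 0 < 1 + r by lra.
rewrite (_ : padd _ _ = (g1 s0, g2 s0)); last first.
  by rewrite /padd /pscale /w /=; congr (_, _); field; rewrite gt_eqF.
apply; rewrite divr_gt0 //= ler_pdivrMr //; lra.
Qed.

End BoundaryCurve.

(** * Continuity and derivative of the ends of the chord *)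

Section ChordEnds.
Context {R : realType}.
Notation P := (R * R)%type.
Implicit Type K : set P.

Lemma dot_pt_back (th h s t : R) :
  dot (pt (th + h) s t) (uvec th) = s * cos h - t * sin h.
Proof.
have := dot_pt_turn (th + h) (- h) s t; rewrite addrK cosN sinN => ->; ring.
Qed.

Lemma dot_pt_back' (th h s t : R) :
  dot (pt (th + h) s t) (uvec' th) = s * sin h + t * cos h.
Proof.
rewrite /dot /= cosD sinD.
rewrite (_ : t * cos h = t * cos h * (cos th ^+ 2 + sin th ^+ 2)); last by rewrite cos2Dsin2 mulr1.
rewrite (_ : s * sin h = s * sin h * (cos th ^+ 2 + sin th ^+ 2)); last by rewrite cos2Dsin2 mulr1.
by ring.
Qed.

Lemma det2_pt (v : P) (th s t s0 t0 : R) :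
  det2 v ((pt th s t).1 - (pt th s0 t0).1, (pt th s t).2 - (pt th s0 t0).2) =
  dot v (uvec th) * (t - t0) - dot v (uvec' th) * (s - s0).
Proof.
rewrite /det2 /dot /pt /=.
by ring.
Qed.

Lemma pt_curve_near (p t : R -> R) th0 e : cts p th0 -> cts t th0 -> 0 < e ->
  exists2 d, 0 < d & forall th, `|th - th0| < d ->
    box (pt th0 (p th0) (t th0)) e (pt th (p th) (t th)).
Proof.
move=> cp ct e0.
have cc : cts (@cos R) th0 by exact: dif_cts (dif_cos th0).
have ci : cts (@sin R) th0 by exact: dif_cts (dif_sin th0).
have c1 : cts (fun th => p th * cos th + - (t th * sin th)) th0.
  by apply: ctsD; [exact: ctsM|apply: ctsN; exact: ctsM].
have c2 : cts (fun th => p th * sin th + t th * cos th) th0.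
  by apply: ctsD; exact: ctsM.
have [d1 d10 H1] := c1 e e0; have [d2 d20 H2] := c2 e e0.
exists (Num.min d1 d2); first by rewrite lt_min d10.
by move=> th; rewrite lt_min => /andP[/H1 ? /H2 ?].
Qed.

Lemma norm_comb_le (x y u w B : R) : `|x| <= B -> `|y| <= B -> `|u| <= 1 -> `|w| <= 1 ->
  `|x * u + y * w| <= 2 * B.
Proof.
move=> hx hy hu hw; apply: le_trans (ler_normD _ _) _; rewrite !normrM.
have : `|x| * `|u| <= B * 1 by apply: ler_pM.
have : `|y| * `|w| <= B * 1 by apply: ler_pM.
by rewrite !mulr1; lra.
Qed.

(** [v * D + z1] is the normal coordinate of a boundary increment, and [z1], [z2] come from
    first-order errors. The choice of [e1] keeps this coordinate at least half of [|v * D|], so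
    errors relative to [D] become errors relative to it. *)
Lemma slope_estimate (v c D z1 z2 e e1 : R) : 0 < e ->
  e1 <= `|v| / 4 -> e1 * (4 * (1 + `|c|)) <= e * `|v| ->
  `|z1| <= 2 * (e1 * `|D|) -> `|z2| <= 2 * (e1 * `|D|) ->
  `|z2 - c * z1| <= e * `|v * D + z1|.
Proof.
move=> e0 e11 e12 Z1 Z2.
have L1 : `|v| / 2 * `|D| <= `|v * D + z1|.
  have := lerB_normD (v * D) z1; rewrite normrM => H; apply: le_trans H.
  have : e1 * `|D| <= `|v| / 4 * `|D| by apply: ler_wpM2r.
  by lra.
apply: le_trans (ler_normB _ _) _; rewrite normrM.
have U : `|c| * `|z1| <= `|c| * (2 * (e1 * `|D|)) by apply: ler_wpM2l.
have V : e * (`|v| / 2 * `|D|) <= e * `|v * D + z1| by rewrite ler_pM2l.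
have W : e1 * (4 * (1 + `|c|)) * `|D| <= e * `|v| * `|D| by apply: ler_wpM2r.
by lra.
Qed.

(** Nearby chords contain the points just inside the ends of the given one, which are interior, and
    miss those just outside, since the complement of [K] is open. *)
Lemma chord_cts K (p a b : R -> R) th0 : regular_body K ->
  (forall th, chord K th (p th) (a th) (b th)) -> cts p th0 -> cts a th0 /\ cts b th0.
Proof.
move=> Kreg chK cp; have [ab H1 H2] := chK th0.
have main e : 0 < e -> exists2 d, 0 < d & forall th, `|th - th0| < d ->
    `|a th - a th0| < e /\ `|b th - b th0| < e.
  move=> e0; pose e' := Num.min (e / 2) ((b th0 - a th0) / 4).
  have e'0 : 0 < e' by rewrite lt_min !divr_gt0 // subr_gt0.
  have e'1 : e' <= e / 2 by rewrite ge_min lexx.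
  have e'2 : e' <= (b th0 - a th0) / 4 by rewrite ge_min lexx orbT.
  have inn t : a th0 < t < b th0 -> exists2 d, 0 < d & forall th, `|th - th0| < d ->
      a th <= t <= b th.
    move=> /H2 [r r0 Hr]; have [d d0 Hd] := pt_curve_near p (fun=> t) th0 r cp (cts_const t th0) r0.
    by exists d => // th /Hd /Hr; have [_ H _] := chK th => /H.
  have out t : ~ (a th0 <= t <= b th0) -> exists2 d, 0 < d & forall th, `|th - th0| < d ->
      ~ (a th <= t <= b th).
    move=> nt; have [Kcl _ _ _] := Kreg.
    have [|r r0 Hr] := Kcl (pt th0 (p th0) t); first by move=> /H1.
    have [d d0 Hd] := pt_curve_near p (fun=> t) th0 r cp (cts_const t th0) r0.
    by exists d => // th /Hd /Hr; have [_ H _] := chK th => nK /H.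
  have [|d1 d10 D1] := inn (a th0 + e'); first by lra.
  have [|d2 d20 D2] := inn (b th0 - e'); first by lra.
  have [|d3 d30 D3] := out (a th0 - e'); first by move=> /andP[]; lra.
  have [|d4 d40 D4] := out (b th0 + e'); first by move=> /andP[]; lra.
  exists (Num.min (Num.min d1 d2) (Num.min d3 d4)); first by rewrite !lt_min d10 d20 d30.
  move=> th; rewrite !lt_min => /andP[/andP[/D1 /andP[A1 A2] /D2 /andP[B1 B2]]].
  move=> /andP[/D3 C /D4 D].
  have C' : a th0 - e' < a th.
    by rewrite ltNge; apply/negP => H; apply: C; rewrite H /=; lra.
  have D' : b th < b th0 + e'.
    by rewrite ltNge; apply/negP => H; apply: D; rewrite H andbT; lra.
  by rewrite !ltr_distl; split; lra.
by split=> e /main [d d0 H]; exists d => // th /H [].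
Qed.

Lemma chord_bd K th p a b : convex_body K -> chord K th p a b ->
  line (uvec th) p `&` bd K = [set pt th p a; pt th p b].
Proof.
move=> bK [ab H1 H2]; apply/seteqP; split => x.
  move=> [xp /(bdP _ _ bK) [Kx nx]]; rewrite /line /= in xp.
  have xE := ptE th x; rewrite xp in xE; set t := dot x _ in xE.
  rewrite xE in Kx nx *; have /andP[ta tb] := (H1 t).1 Kx.
  have [->|ta'] := eqVneq t a; first by left.
  have [->|tb'] := eqVneq t b; first by right.
  by exfalso; apply: nx; apply: H2; rewrite !lt_def ta tb ta' eq_sym tb'.
have nin t : (forall e, 0 < e -> exists2 t', `|t' - t| < e & ~ K (pt th p t')) ->
    ~ inner K (pt th p t).
  move=> H /inner_pt [e e0 He]; have [t' tt' nK] := H e e0.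
  by apply: nK; apply: He => //; rewrite subrr normr0.
have end_ t : K (pt th p t) ->
    (forall e, 0 < e -> exists2 t', `|t' - t| < e & ~ K (pt th p t')) ->
    (line (uvec th) p `&` bd K) (pt th p t).
  move=> Kt Ht; split; first by rewrite /line /= dot_pt_u.
  by apply/(bdP _ _ bK); split => //; exact: nin.
case=> ->; apply: end_ => //; try by apply/H1; lra.
  move=> e e0; exists (a - e / 2); first by rewrite ltr_distl; lra.
  by move=> /H1 /andP[]; lra.
move=> e e0; exists (b + e / 2); first by rewrite ltr_distl; lra.
by move=> /H1 /andP[]; lra.
Qed.

Lemma C2_param_cts K g1 g2 : C2_boundary_param K g1 g2 ->
  [/\ forall s, dif g1 s (D1 g1 s), forall s, dif g2 s (D1 g2 s),
      forall s, cts (D1 g1) s & forall s, cts (D1 g2) s].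
Proof.
move=> [C1 [C2 _]]; split => s.
- by have [d _] := C1 s; exact: derivable_dif.
- by have [d _] := C2 s; exact: derivable_dif.
- by have [_ [d _]] := C1 s; exact: dif_cts (derivable_dif _ _ d).
- by have [_ [d _]] := C2 s; exact: dif_cts (derivable_dif _ _ d).
Qed.

Lemma C2_param_bd K g1 g2 s : C2_boundary_param K g1 g2 -> bd K (g1 s, g2 s).
Proof. by move=> [_ [_ [_ [_ <-]]]]; exists s. Qed.

Lemma C2_param_local K g1 g2 s0 eta : C2_boundary_param K g1 g2 -> 0 < eta ->
  exists2 e, 0 < e & forall x, bd K x -> box (g1 s0, g2 s0) e x ->
    exists2 s, `|s - s0| < eta & (g1 s, g2 s) = x.
Proof.
move=> gK eta0; have [d1 d2 _ _] := C2_param_cts _ _ _ gK.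
have [_ [_ [[L [L0 [per inj]]] [_ bdE]]]] := gK.
have [||e e0 He] := cts_periodic_local g1 g2 L s0 eta _ _ L0 per inj eta0.
- by move=> s; exact: dif_cts (d1 s).
- by move=> s; exact: dif_cts (d2 s).
by exists e => // x; rewrite -bdE => -[s _ <-] /He.
Qed.

Context (K : set P) (p a b : R -> R).
Hypothesis bK : convex_body K.
Hypothesis chK : forall th, chord K th (p th) (a th) (b th).
Local Notation m := (fun th => (a th + b th) / 2).
Hypothesis dp : forall th, dif p th (m th).

Let Kreg := convex_body_regular K bK.

(** The tangent at a chord end is transversal to the chord: otherwise it would be the line of the
    chord, which passes through the interior point at [m th] and so has points of [K] on both
    sides. *)
Lemma tangent_dir_support th t v : tangent_dir K (pt th (p th) t) v ->
  dot v (uvec th) != 0 /\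
  forall s t' s' t'', K (pt th s t') -> K (pt th s' t'') ->
    ~ (dot v (uvec th) * (t' - t) - dot v (uvec' th) * (s - p th) < 0 <
       dot v (uvec th) * (t'' - t) - dot v (uvec' th) * (s' - p th)).
Proof.
move=> [g1 [g2 [s0 [gK [gs vE]]]]].
have gbd s := (bdP _ _ bK).1 (C2_param_bd _ _ _ s gK).
have [d1 d2 _ _] := C2_param_cts _ _ _ gK.
have v0 : (D1 g1 s0, D1 g2 s0) <> (0, 0).
  by have [_ [_ [_ [/(_ s0) /eqP]]]] := gK.
have supp k k' := tangent_supports K g1 g2 s0 _ _ k k' Kreg (fun s => (gbd s).1)
  (gbd s0).2 (d1 s0) (d2 s0) v0.
have [G1 G2] := gs; rewrite -vE G1 G2 in supp.
have S s t' s' t'' : K (pt th s t') -> K (pt th s' t'') ->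
    ~ (dot v (uvec th) * (t' - t) - dot v (uvec' th) * (s - p th) < 0 <
       dot v (uvec th) * (t'' - t) - dot v (uvec' th) * (s' - p th)).
  by move=> k1 k2; have := supp _ _ k1 k2; rewrite !det2_pt.
split => //; apply/eqP => vu.
have [ab _ /(_ (m th))] := chK th; case; first by lra.
move=> e e0 He.
have vu' : dot v (uvec' th) <> 0.
  move=> vu'; apply: v0; rewrite -vE (ptE th v) vu vu' /pt.
  by rewrite !mul0r subrr addr0.
have Kn s : `|s - p th| < e / 2 -> K (pt th s (m th)).
  by move=> hs; apply: box_pt He _ _ _ _ => //; rewrite subrr normr0 divr_gt0.
have K1 : K (pt th (p th + e / 4) (m th)) by apply: Kn; rewrite ltr_distl; lra.
have K2 : K (pt th (p th - e / 4) (m th)) by apply: Kn; rewrite ltr_distl; lra.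
have := S _ _ _ _ K1 K2; have := S _ _ _ _ K2 K1; rewrite vu !mul0r !sub0r.
rewrite (_ : p th + e / 4 - p th = e / 4); last by ring.
rewrite (_ : p th - e / 4 - p th = - (e / 4)); last by ring.
rewrite mulrN opprK oppr_lt0 !oppr_gt0 !andbb.
case: (ltgtP (dot v (uvec' th)) 0) vu' => // vs _ h1 h2.
- by apply: h1; rewrite nmulr_rlt0 // divr_gt0.
- by apply: h2; rewrite mulr_gt0 // divr_gt0.
Qed.

(** [al] and [be] are the coordinates, in the frame at [th], of the displacement of the chord end.
    The first is differentiable because [p] is and [t], so far only continuous, is multiplied by
    [sin h]; the second follows it along the boundary with slope [c]. *)
Lemma end_dif (t : R -> R) th v : cts t th ->
  (forall th, bd K (pt th (p th) (t th))) ->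
  tangent_dir K (pt th (p th) (t th)) v ->
  dif t th (- p th + dot v (uvec' th) / dot v (uvec th) * (m th - t th)).
Proof.
move=> ct bdt tv; have [vu _] := tangent_dir_support _ _ _ tv.
have [g1 [g2 [s0 [gK [gs vE]]]]] := tv.
have [d1 d2 _ _] := C2_param_cts _ _ _ gK.
set c := dot v (uvec' th) / _.
pose al h := p (th + h) * cos h - t (th + h) * sin h - p th.
pose be h := p (th + h) * sin h + t (th + h) * cos h - t th.
have dp0 := dif_unshift _ _ _ (dp th).
have ct0 := cts_unshift _ _ ct.
have dtsin : dif (fun h => t (th + h) * sin h) 0 (t th).
  have := difM_cts0 _ _ _ _ ct0 (dif_sin 0) (sin0 R); rewrite cos0 mulr1 addr0.
  by apply: dif_ext.
have dal : dif al 0 (m th - t th).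
  apply: dif_ext (difB _ _ _ _ _ (difB _ _ _ _ _
     (difM _ _ _ _ _ dp0 (dif_cos 0)) dtsin) (dif_const (p th) 0)) => //.
  by rewrite cos0 sin0; ring.
have al0 : al 0 = 0 by rewrite /al addr0 cos0 sin0; ring.
have be0 : be 0 = 0 by rewrite /be addr0 cos0 sin0; ring.
have dbe : dif be 0 (c * (m th - t th)).
  apply: (dif_tangent al) => // e e0.
  set vu_ := dot v (uvec th) in c vu *; set vu'_ := dot v (uvec' th) in c *.
  have nv : 0 < `|vu_| by rewrite normr_gt0.
  have C0 : 0 < 1 + `|c| by have := normr_ge0 c; lra.
  pose e1 := Num.min (`|vu_| / 4) (e * `|vu_| / (4 * (1 + `|c|))).
  have e10 : 0 < e1 by rewrite lt_min !divr_gt0 // mulr_gt0.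
  have e11 : e1 <= `|vu_| / 4 by rewrite ge_min lexx.
  have e12 : e1 * (4 * (1 + `|c|)) <= e * `|vu_|.
    by rewrite -ler_pdivlMr ?mulr_gt0 // ge_min lexx orbT.
  have [r1 r10 R1] := d1 s0 e1 e10; have [r2 r20 R2] := d2 s0 e1 e10.
  have [|r r0 Hr] := C2_param_local K g1 g2 s0 (Num.min r1 r2) gK; first by rewrite lt_min r10.
  have [d d0 Hd] := pt_curve_near p t th r (dif_cts _ _ _ (dp th)) ct r0.
  exists d => // h hd; have := Hd (th + h); rewrite (_ : th + h - th = h); last by ring.
  move=> /(_ hd); rewrite -gs.
  move=> /(Hr _ (bdt (th + h))) [s]; rewrite lt_min => /andP[s1 s2] gsE.
  pose D := s - s0.
  have sE : s = s0 + D by rewrite /D; ring.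
  have := R1 D s1; have := R2 D s2; rewrite -sE => X2 X1.
  pose x1 := g1 s - g1 s0 - D1 g1 s0 * D; pose x2 := g2 s - g2 s0 - D1 g2 s0 * D.
  have alE : al h = vu_ * D + (x1 * cos th + x2 * sin th).
    have -> : al h = dot (g1 s, g2 s) (uvec th) - dot (g1 s0, g2 s0) (uvec th).
      by rewrite gsE gs dot_pt_back dot_pt_u.
    by rewrite /vu_ vE /dot /x1 /x2 /=; ring.
  have beE : be h = vu'_ * D + (- x1 * sin th + x2 * cos th).
    have -> : be h = dot (g1 s, g2 s) (uvec' th) - dot (g1 s0, g2 s0) (uvec' th).
      by rewrite gsE gs dot_pt_back' dot_pt_u'.
    by rewrite /vu'_ vE /dot /x1 /x2 /=; ring.
  have c1 : `|cos th| <= 1 by rewrite ler_norml cos_geN1 cos_le1.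
  have i1 : `|sin th| <= 1 by rewrite ler_norml sin_geN1 sin_le1.
  have -> : be h - c * al h = (- x1 * sin th + x2 * cos th) - c * (x1 * cos th + x2 * sin th).
    by rewrite beE alE /c; field.
  rewrite alE; apply: (slope_estimate _ _ _ _ _ _ _ e0 e11 e12); first exact: norm_comb_le.
  by apply: norm_comb_le => //; rewrite normrN.
apply: dif_shift.
(* [t (th + h)] equals [be h + t th - p (th + h) * sin h + t (th + h) * (1 - cos h)], and continuity
   of [t] suffices to differentiate the last term. *)
have ccos : dif (fun h : R => 1 - cos h) 0 0.
  apply: dif_ext (difB _ _ _ _ _ (dif_const 1 0) (dif_cos 0)) => //.
  by rewrite sin0; ring.
have T1 := difM_cts0 _ _ _ _ ct0 ccos ltac:(by rewrite /= cos0 subrr).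
have psin := difM _ _ _ _ _ dp0 (dif_sin 0).
apply: dif_ext (difD _ _ _ _ _ (difB _ _ _ _ _ (difD _ _ _ _ _ dbe (dif_const (t th) 0)) psin) T1).
- by move=> h /=; rewrite /be; ring.
- by rewrite !addr0 sin0 cos0; ring.
Qed.

End ChordEnds.

(** * Slopes of the tangents at the ends of the chord *)

Section TangentSlopes.
Context {R : realType}.
Notation P := (R * R)%type.

Lemma cts_prod_near (f g : R -> R) s0 t0 e : cts f s0 -> cts g t0 -> 0 < e ->
  exists2 d, 0 < d & forall s t, `|s - s0| < d -> `|t - t0| < d ->
    `|f s * g t - f s0 * g t0| < e.
Proof.
move=> cf cg e0.
pose C := `|f s0| + `|g t0| + 1.
have C0 : 0 < C by rewrite /C; have := normr_ge0 (f s0); have := normr_ge0 (g t0); lra.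
pose e' := Num.min 1 (e / (2 * C)).
have e'0 : 0 < e' by rewrite lt_min ltr01 divr_gt0 // mulr_gt0.
have e'1 : e' <= 1 by rewrite ge_min lexx.
have e'e : e' * (2 * C) <= e by rewrite -ler_pdivlMr ?mulr_gt0 // ge_min lexx orbT.
have [d1 d10 H1] := cf e' e'0; have [d2 d20 H2] := cg e' e'0.
exists (Num.min d1 d2); first by rewrite lt_min d10.
move=> s t; rewrite !lt_min => /andP[/H1 F _] /andP[_ /H2 G].
rewrite (_ : _ - _ = (f s - f s0) * (g t - g t0) + (f s - f s0) * g t0 +
  f s0 * (g t - g t0)); last by ring.
apply: le_lt_trans (ler_normD _ _) _.
apply: le_lt_trans (lerD (ler_normD _ _) (lexx _)) _; rewrite !normrM.
have U1 : `|f s - f s0| * `|g t - g t0| <= e' * 1 by apply: ler_pM => //; lra.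
have U2 : `|f s - f s0| * `|g t0| <= e' * `|g t0| by apply: ler_pM => //; lra.
have U3 : `|f s0| * `|g t - g t0| <= `|f s0| * e' by apply: ler_pM => //; lra.
have : e' * C < e.
  apply: lt_le_trans e'e; rewrite ltr_pM2l //; lra.
by rewrite /C; lra.
Qed.

Lemma cts_neq0 (f : R -> R -> R) s0 t0 :
  (forall e, 0 < e -> exists2 d, 0 < d & forall s t, `|s - s0| < d -> `|t - t0| < d ->
    `|f s t - f s0 t0| < e) -> f s0 t0 != 0 ->
  exists2 d, 0 < d & forall s t, `|s - s0| < d -> `|t - t0| < d ->
    `|f s0 t0| / 2 < `|f s t|.
Proof.
move=> cf f0; have n0 : 0 < `|f s0 t0| by rewrite normr_gt0.
have [d d0 H] := cf (`|f s0 t0| / 2) ltac:(by rewrite divr_gt0).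
exists d => // s t hs ht; have := H s t hs ht; rewrite distrC => F.
by have := lerB_dist (f s0 t0) (f s t); lra.
Qed.

Lemma mul_lt0_cases (x y : R) : x * y < 0 -> x < 0 < y \/ y < 0 < x.
Proof.
case: (ltgtP x 0) => [x0|x0|->]; last by rewrite mul0r ltxx.
  by rewrite nmulr_rlt0 //; left.
by rewrite pmulr_rlt0 // => ->; right.
Qed.

Context (K : set P) (p a b : R -> R).
Hypothesis bK : convex_body K.
Hypothesis C2K : C2_boundary K.
Hypothesis chK : forall th, chord K th (p th) (a th) (b th).
Local Notation m := (fun th => (a th + b th) / 2).
Hypothesis dp : forall th, dif p th (m th).

Lemma bd_tangent_dir x : bd K x -> exists v, tangent_dir K x v.
Proof.
have [g1 [g2 gK]] := C2K; have [_ [_ [_ [_ bdE]]]] := gK.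
rewrite -bdE => -[s _ <-]; exists (D1 g1 s, D1 g2 s).
by exists g1, g2, s.
Qed.

(** [c th] is the slope of the tangent over the normal coordinate. The third clause puts [K] on the
    midpoint's side of that tangent. *)
Lemma end_slope (t : R -> R) : (forall th, cts t th) ->
  (forall th, bd K (pt th (p th) (t th))) -> (forall th, t th != m th) ->
  exists c : R -> R,
  [/\ forall th v, tangent_dir K (pt th (p th) (t th)) v ->
        dot v (uvec th) != 0 /\ dot v (uvec' th) = c th * dot v (uvec th),
      forall th, dif t th (- p th + c th * (m th - t th)),
      forall th al t', K (pt th (p th + al) t') ->
        0 <= (t' - t th - c th * al) * (m th - t th) &
      forall th, cts c th].
Proof.
move=> ct bdt tm.
pose c th := (D1 t th + p th) / (m th - t th).
have mt th : m th - t th != 0 by rewrite subr_eq0 eq_sym.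
have S1 th v : tangent_dir K (pt th (p th) (t th)) v ->
    dot v (uvec th) != 0 /\ dot v (uvec' th) = c th * dot v (uvec th).
  move=> tv; have [vu _] := tangent_dir_support K p a b bK chK _ _ _ tv; split => //.
  have [_] := dif_D1 _ _ _ (end_dif K p a b bK chK dp t th v (ct th) bdt tv).
  by rewrite /c => ->; rewrite addrAC addNr add0r mulfK // mulfVK.
have cE th v : tangent_dir K (pt th (p th) (t th)) v ->
    dot v (uvec' th) / dot v (uvec th) = c th.
  by move=> /S1 [vu ->]; rewrite mulfK.
exists c; split => //.
- move=> th; have [v tv] := bd_tangent_dir _ (bdt th).
  by rewrite -(cE _ _ tv); exact: (end_dif K p a b bK chK dp t th v).
- move=> th al t' Kk; have [v tv] := bd_tangent_dir _ (bdt th).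
  have [vu vu'] := S1 _ _ tv; have [_ supp] := tangent_dir_support K p a b bK chK _ _ _ tv.
  have KM : K (pt th (p th) (m th)) by have [ab -> _] := chK th; lra.
  have := supp _ _ _ _ Kk KM; have := supp _ _ _ _ KM Kk.
  rewrite vu' subrr mulr0 subr0 (_ : p th + al - p th = al); last by ring.
  rewrite (_ : _ * (t' - t th) - _ = dot v (uvec th) * (t' - t th - c th * al)); last by ring.
  move=> h1 h2; rewrite leNgt; apply/negP => neg.
  have : (dot v (uvec th) * (t' - t th - c th * al)) * (dot v (uvec th) * (m th - t th)) < 0.
    rewrite (_ : _ * _ = dot v (uvec th) ^+ 2 * ((t' - t th - c th * al) * (m th - t th)));
      last by ring.
    by rewrite pmulr_rlt0 // exprn_even_gt0.
  by move=> /mul_lt0_cases [/h2|/h1].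
- move=> th0 e e0.
  have [g1 [g2 gK]] := C2K; have [_ [_ [_ [_ bdE]]]] := gK.
  have [s0 _ gs] : [set (g1 s, g2 s) | s in [set: R]] (pt th0 (p th0) (t th0)).
    by rewrite bdE; exact: bdt.
  have tv0 : tangent_dir K (pt th0 (p th0) (t th0)) (D1 g1 s0, D1 g2 s0).
    by exists g1, g2, s0.
  have [vu0 vu'0] := S1 _ _ tv0.
  have [_ _ c1 c2] := C2_param_cts _ _ _ gK.
  have cc := dif_cts _ _ _ (dif_cos th0); have ci := dif_cts _ _ _ (dif_sin th0).
  (* [D] and [N] are the normal and tangential components of the velocity at [s]. They are jointly
     continuous, and [c th] is [N / D] when the curve point at [s] is the chord end. *)
  pose D s th : R := dot (D1 g1 s, D1 g2 s) (uvec th).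
  pose N s th : R := dot (D1 g1 s, D1 g2 s) (uvec' th).
  have cD r : 0 < r -> exists2 d, 0 < d & forall s th, `|s - s0| < d -> `|th - th0| < d ->
      `|D s th - D s0 th0| < r.
    move=> r0; have [d1 d10 H1] := cts_prod_near _ _ _ _ (r / 2) (c1 s0) cc ltac:(by lra).
    have [d2 d20 H2] := cts_prod_near _ _ _ _ (r / 2) (c2 s0) ci ltac:(by lra).
    exists (Num.min d1 d2); first by rewrite lt_min d10.
    move=> s th; rewrite !lt_min => /andP[s1 s2] /andP[t1 t2].
    rewrite /D /dot /= opprD addrACA; apply: le_lt_trans (ler_normD _ _) _.
    by have := H1 s th s1 t1; have := H2 s th s2 t2; lra.
  have cN r : 0 < r -> exists2 d, 0 < d & forall s th, `|s - s0| < d -> `|th - th0| < d ->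
      `|N s th - N s0 th0| < r.
    move=> r0; have [d1 d10 H1] := cts_prod_near _ _ _ _ (r / 2) (c1 s0) (ctsN _ _ ci) ltac:(by lra).
    have [d2 d20 H2] := cts_prod_near _ _ _ _ (r / 2) (c2 s0) cc ltac:(by lra).
    exists (Num.min d1 d2); first by rewrite lt_min d10.
    move=> s th; rewrite !lt_min => /andP[s1 s2] /andP[t1 t2].
    rewrite /N /dot /= opprD addrACA; apply: le_lt_trans (ler_normD _ _) _.
    by have := H1 s th s1 t1; have := H2 s th s2 t2; lra.
  have [d1 d10 H1] := cts_neq0 D s0 th0 cD vu0.
  have nD : 0 < `|D s0 th0| by rewrite normr_gt0.
  have C0 : 0 < 1 + `|c th0| by have := normr_ge0 (c th0); lra.
  pose r := e * `|D s0 th0| / (2 * (1 + `|c th0|)).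
  have r0 : 0 < r by rewrite divr_gt0 // mulr_gt0.
  have [d2 d20 H2] := cD r r0; have [d3 d30 H3] := cN r r0.
  pose d := Num.min d1 (Num.min d2 d3).
  have d0 : 0 < d by rewrite !lt_min d10 d20.
  have [e1 e10 He1] := C2_param_local K g1 g2 s0 d gK d0.
  have [q1 q10 Q1] := pt_curve_near p t th0 e1 (dif_cts _ _ _ (dp th0)) (ct th0) e10.
  exists (Num.min d q1); first by rewrite lt_min d0.
  move=> th; rewrite lt_min => /andP[thd thq1].
  have := Q1 th thq1; rewrite -gs.
  move=> /(He1 _ (bdt th)) [s sd gsE].
  have [|vu vu'] := S1 th (D1 g1 s, D1 g2 s); first by exists g1, g2, s.
  rewrite -/(D s th) -/(N s th) in vu vu'; rewrite -/(D s0 th0) -/(N s0 th0) in vu0 vu'0.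
  move: thd sd; rewrite /d !lt_min => /and3P[t1 t2 t3] /and3P[s1 s2 s3].
  have A1 := H1 s th s1 t1; have A2 := H2 s th s2 t2; have A3 := H3 s th s3 t3.
  have E : (c th - c th0) * D s th = (N s th - N s0 th0) - c th0 * (D s th - D s0 th0).
    by rewrite vu' vu'0; ring.
  have nDs : 0 < `|D s th| by rewrite normr_gt0.
  rewrite -(ltr_pM2r nDs) -normrM E; apply: le_lt_trans (ler_normB _ _) _; rewrite normrM.
  have U : `|c th0| * `|D s th - D s0 th0| <= `|c th0| * r by apply: ler_wpM2l => //; exact: ltW.
  have rE : r * (1 + `|c th0|) = e * (`|D s0 th0| / 2) by rewrite /r; field; rewrite gt_eqF.
  have V : e * (`|D s0 th0| / 2) < e * `|D s th| by rewrite ltr_pM2l.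
  apply: le_lt_trans (lerD (ltW A3) U) _; apply: le_lt_trans V; rewrite -rE.
  by rewrite mulrDr mulr1 [r * `|_|]mulrC.
Qed.

End TangentSlopes.

(** * The pole is extreme among the points of the illumination curve *)

Section Illumination.
Context {R : realType}.
Notation P := (R * R)%type.
Implicit Type K : set P.

(** The segments from [x] to [K] already form a convex set. In the case [s = 0] the combination is
    [x] itself, and any point of [K] serves as the other end. *)
Lemma conv_hullE K x : convex_set K -> K !=set0 ->
  conv_hull (K `|` [set x]) =
  [set z | exists k w, [/\ K k, 0 <= w <= 1 & z = padd (pscale w x) (pscale (1 - w) k)]].
Proof.
move=> Kcv [k0 Kk0]; apply/seteqP; split => z.
  apply; split; last first.
    move=> y [Ky|->]; [exists y, 0|exists k0, 1]; split; rewrite ?lexx ?ler01 //.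
      by case: y Ky => y1 y2 _; rewrite /padd /pscale /=; congr (_, _); ring.
    by case: x => x1 x2; rewrite /padd /pscale /=; congr (_, _); ring.
  move=> _ _ [k [w [Kk /andP[w0 w1] ->]]] [k' [w' [Kk' /andP[w'0 w'1] ->]]] t /andP[t0 t1].
  pose s := t * (1 - w) + (1 - t) * (1 - w').
  have s1 : 0 <= t * (1 - w) by apply: mulr_ge0; lra.
  have s2 : 0 <= (1 - t) * (1 - w') by apply: mulr_ge0; lra.
  have s3 : 0 <= t * w by apply: mulr_ge0.
  have s4 : 0 <= (1 - t) * w' by apply: mulr_ge0; lra.
  have [s0|s0] := eqVneq s 0.
    exists k0, 1; split => //; first by rewrite ler01 lexx.
    have e1 : t * (1 - w) = 0 by rewrite /s in s0; lra.
    have e2 : (1 - t) * (1 - w') = 0 by rewrite /s in s0; lra.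
    rewrite /padd /pscale /=; congr (_, _).
      transitivity (x.1 + t * (1 - w) * (k.1 - x.1) + (1 - t) * (1 - w') * (k'.1 - x.1)); first by ring.
      by rewrite e1 e2; ring.
    transitivity (x.2 + t * (1 - w) * (k.2 - x.2) + (1 - t) * (1 - w') * (k'.2 - x.2)); first by ring.
    by rewrite e1 e2; ring.
  have s_gt0 : 0 < s by rewrite lt_def s0 addr_ge0.
  exists (padd (pscale (t * (1 - w) / s) k) (pscale (1 - t * (1 - w) / s) k')), (1 - s).
  split.
  - apply: Kcv => //; apply/andP; split; first exact: divr_ge0 s1 (ltW s_gt0).
    by rewrite ler_pdivrMr // mul1r /s; lra.
  - by rewrite /s; apply/andP; split; lra.
  - by rewrite /padd /pscale /=; congr (_, _); rewrite /s in s0 *; field.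
move=> [k [w [Kk w01 ->]]] C [Ccv CK]; apply: Ccv => //; apply: CK; [by right|by left].
Qed.

(** Measurability comes from compactness: the hull is a continuous image of the product of [K] and
    [[0, 1]]. *)
Lemma conv_hull_tame K x : convex_body K -> tame (conv_hull (K `|` [set x])).
Proof.
move=> bK; have [_ [M KM] Kcv [z iz]] := convex_body_regular _ bK.
have Kz := inner_sub _ _ iz.
have cE := conv_hullE K x Kcv (ex_intro _ z Kz).
split; last first.
  exists (`|x.1| + `|x.2| + M); rewrite cE => _ [k [w [/KM [k1 k2] /andP[w0 w1] ->]]].
  have H (s t : R) : `|t| <= M -> `|w * s + (1 - w) * t| <= `|s| + M.
    move=> tM; apply: le_trans (ler_normD _ _) _; rewrite !normrM.
    have w1' : 0 <= 1 - w by rewrite subr_ge0.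
    rewrite (ger0_norm w0) (ger0_norm w1').
    apply: lerD; first by rewrite ler_piMl.
    by apply: le_trans tM; rewrite ler_piMl // lerBlDr lerDl.
  have := H x.1 k.1 k1; have := H x.2 k.2 k2.
  have := normr_ge0 x.1; have := normr_ge0 x.2; move=> n1 n2 h2 h1.
  by split; rewrite /=; lra.
pose f (y : P * R) : P := (y.2 * x.1 + (1 - y.2) * y.1.1, y.2 * x.2 + (1 - y.2) * y.1.2).
have cf : continuous f.
  have c1 : continuous (fun y : P * R => y.1) by move=> y; exact: cvg_fst.
  have c2 : continuous (fun y : P * R => y.2) by move=> y; exact: cvg_snd.
  have c11 : continuous (fun y : P * R => y.1.1).
    by move=> y; apply: cvg_comp (c1 y) _; exact: cvg_fst.
  have c12 : continuous (fun y : P * R => y.1.2).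
    by move=> y; apply: cvg_comp (c1 y) _; exact: cvg_snd.
  move=> y; apply: (@cvg_pair _ _ _ (nbhs y) (nbhs (f y).1) (nbhs (f y).2)) => /=.
    apply: cvgD; first by apply: cvgM; [exact: c2|exact: cvg_cst].
    apply: cvgM; last exact: c11.
    by apply: cvgB; [exact: cvg_cst|exact: c2].
  apply: cvgD; first by apply: cvgM; [exact: c2|exact: cvg_cst].
  apply: cvgM; last exact: c12.
  by apply: cvgB; [exact: cvg_cst|exact: c2].
have -> : conv_hull (K `|` [set x]) = f @` (K `*` `[0, 1]).
  rewrite cE; apply/seteqP; split => [z' [k [w [Kk w01 ->]]]|z' [[k w] [/= Kk]]].
    by exists (k, w) => //; split => //=; rewrite in_itv.
  by rewrite in_itv /= => w01 <-; exists k, w.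
have cpt : compact (f @` (K `*` `[0, 1])).
  apply: continuous_compact; first exact: continuous_subspaceT.
  by apply: compact_setX; [case: bK|exact: segment_compact].
have cl : closed (f @` (K `*` `[0, 1])).
  by apply: compact_closed cpt; exact: (@norm_hausdorff R P).
apply: measurable_box_closed => y ny; apply/interiorP.
by have := closed_openC cl; rewrite openE; exact.
Qed.

Lemma box_openI (A B : set P) : box_open A -> box_open B -> box_open (A `&` B).
Proof.
move=> oA oB x [/oA [d d0 Hd] /oB [e e0 He]].
exists (Num.min d e); first by rewrite lt_min d0.
by move=> y [y1 y2]; split; [apply: Hd|apply: He]; split;
   [move: y1|move: y2|move: y1|move: y2]; rewrite lt_min => /andP[].
Qed.

Lemma measurable_dot_ge (w : P) c : plane_measurable [set x : P | c <= dot x w].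
Proof.
have -> : [set x : P | c <= dot x w] = ~` [set x : P | dot x w < c].
  by apply/seteqP; split => x /=; rewrite leNgt => /negP.
by apply: measurableC; exact: measurable_dot_lt.
Qed.

Lemma sum_compare (s x y x' y' : R) : s = x + y -> s = x' + y' -> x' <= x -> y <= y'.
Proof. lra. Qed.

Context (K : set P) (th p a b cA cB tau tP : R).
Hypothesis bK : convex_body K.
Hypothesis chK : chord K th p a b.
Hypothesis wedgeA : forall al t, K (pt th (p + al) t) -> a + cA * al <= t.
Hypothesis wedgeB : forall al t, K (pt th (p + al) t) -> t <= b + cB * al.
Hypothesis tau0 : tau != 0.
Hypothesis tPA : tP = a + cA * tau.
Hypothesis tPB : tP = b + cB * tau.

Let Kreg := convex_body_regular K bK.
Let Kcv : convex_set K. Proof. by case: Kreg. Qed.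
Let Kne : K !=set0. Proof. by case: Kreg => _ _ _ [z /inner_sub]; exists z. Qed.
Let ab : a < b. Proof. by case: chK. Qed.

(** Height above the chord in units of the signed height [tau] of the pole: [0] on the chord and [1]
    at the pole, on whichever side it lies. *)
Let rr (z : P) : R := (dot z (uvec th) - p) / tau.
Let tt (z : P) : R := dot z (uvec' th).

Let zE z : z = pt th (p + tau * rr z) (tt z).
Proof. by rewrite {1}(ptE th z) /rr mulrC mulfVK // addrC subrK. Qed.

Let z_ext z z' : rr z = rr z' -> tt z = tt z' -> z = z'.
Proof. by move=> r t; rewrite (zE z) (zE z') r t. Qed.

Let rr_conv w x y : rr (padd (pscale w x) (pscale (1 - w) y)) = w * rr x + (1 - w) * rr y.
Proof. by rewrite /rr dot_padd; field. Qed.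

Let tt_conv w x y : tt (padd (pscale w x) (pscale (1 - w) y)) = w * tt x + (1 - w) * tt y.
Proof. by rewrite /tt dot_padd. Qed.

Let wedge z : K z -> a + (tP - a) * rr z <= tt z <= b + (tP - b) * rr z.
Proof.
move=> Kz; rewrite (zE z) in Kz; have := wedgeA _ _ Kz; have := wedgeB _ _ Kz.
have -> : (tP - a) * rr z = cA * (tau * rr z) by rewrite tPA; ring.
have -> : (tP - b) * rr z = cB * (tau * rr z) by rewrite tPB; ring.
by move=> -> ->.
Qed.

Let rr_le1 (t r : R) : a + (t - a) * r <= b + (t - b) * r -> r <= 1.
Proof.
move=> H; have : (b - a) * r <= (b - a) * 1 by lra.
by rewrite ler_pM2l // subr_gt0.
Qed.

Let chordK z : rr z = 0 -> a <= tt z <= b -> K z.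
Proof. by move=> r t; rewrite (zE z) r mulr0 addr0; have [_ -> _] := chK. Qed.

(** Triangle on the chord with apex at height [1] and coordinate [t]; the two sides cross there, so
    nothing of it lies higher. *)
Definition tri (t : R) : set P :=
  [set z | [/\ 0 <= rr z, a + (t - a) * rr z <= tt z & tt z <= b + (t - b) * rr z]].

Let tri_hull x z : 0 < rr x -> 0 <= rr z <= rr x ->
  a + (tt x - a) * (rr z / rr x) <= tt z <= b + (tt x - b) * (rr z / rr x) ->
  conv_hull (K `|` [set x]) z.
Proof.
move=> x0 /andP[z0 zx] /andP[z1 z2]; rewrite conv_hullE //.
pose w := rr z / rr x; rewrite -/w in z1 z2.
have rE : rr z = w * rr x by rewrite /w mulfVK // gt_eqF.
have w01 : 0 <= w <= 1.
  by apply/andP; split; [exact: divr_ge0 z0 (ltW x0)|rewrite ler_pdivrMr // mul1r].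
have [k0 Kk0] := Kne; have [w1|w1] := eqVneq w 1.
  exists k0, 1; split => //; first by rewrite ler01 lexx.
  apply: z_ext; first by rewrite rr_conv rE w1; ring.
  rewrite tt_conv subrr mul0r addr0 mul1r; rewrite w1 in z1 z2; lra.
have w1' : 0 < 1 - w by rewrite subr_gt0 lt_def eq_sym w1; case/andP: w01.
(* The point where the line from [x] through [z] meets the chord. *)
pose k := padd (pscale (1 / (1 - w)) z) (pscale (1 - 1 / (1 - w)) x).
have w1N : 1 - w != 0 by rewrite gt_eqF.
exists k, w; split => //; last first.
  apply: z_ext; first by rewrite rr_conv rr_conv; field.
  by rewrite tt_conv tt_conv; field.
apply: chordK; first by rewrite rr_conv rE; field.
rewrite tt_conv (_ : _ + _ = (tt z - w * tt x) / (1 - w)); last by field.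
by rewrite ler_pdivlMr // ler_pdivrMr //; apply/andP; split; lra.
Qed.

(** Above the chord this is the wedge of the two tangents. A hull point [z] below it lies on a
    segment from [x] to a point [k] of [K]; the segment crosses the chord in a point [y] of [K], so
    [z] is between [y] and [k], hence in [K]. *)
Let hull_tri x : rr x = 1 -> tt x = tP -> conv_hull (K `|` [set x]) `\` K `<=` tri tP.
Proof.
move=> x1 xt z [+ nKz]; rewrite conv_hullE // => -[k [w [Kk /andP[w0 w1] zE']]].
have /andP[k1 k2] := wedge k Kk.
have rz : rr z = w * 1 + (1 - w) * rr k by rewrite zE' rr_conv x1.
have tz : tt z = w * tP + (1 - w) * tt k by rewrite zE' tt_conv xt.
have z1 : a + (tP - a) * rr z <= tt z.
  have : 0 <= (1 - w) * (tt k - (a + (tP - a) * rr k)) by apply: mulr_ge0; lra.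
  by rewrite rz tz; lra.
have z2 : tt z <= b + (tP - b) * rr z.
  have : 0 <= (1 - w) * (b + (tP - b) * rr k - tt k) by apply: mulr_ge0; lra.
  by rewrite rz tz; lra.
split => //; rewrite leNgt; apply/negP => z0; apply: nKz.
have k0 : rr k < 0.
  rewrite ltNge; apply/negP => k0; move: z0; rewrite rz ltNge => /negP; apply.
  by rewrite mulr1 addr_ge0 // mulr_ge0 // subr_ge0.
pose w0' := - rr k / (1 - rr k).
have d0 : 0 < 1 - rr k by lra.
have dN : 1 - rr k != 0 by rewrite gt_eqF.
have w0'0 : 0 < w0' by apply: divr_gt0; lra.
have w0'1 : 0 < 1 - w0'.
  by rewrite (_ : 1 - w0' = 1 / (1 - rr k)) ?divr_gt0 // /w0'; field.
pose y := padd (pscale w0' x) (pscale (1 - w0') k).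
have ry : rr y = 0 by rewrite /y rr_conv x1 /w0'; field.
have Ky : K y.
  apply: chordK => //; rewrite tt_conv xt.
  have e1 : w0' * (1 - rr k) = - rr k by rewrite /w0' mulfVK.
  have h1 : 0 <= (1 - w0') * (tt k - (a + (tP - a) * rr k)) by apply: mulr_ge0; lra.
  have h2 : 0 <= (1 - w0') * (b + (tP - b) * rr k - tt k) by apply: mulr_ge0; lra.
  have E1 : w0' * tP + (1 - w0') * (a + (tP - a) * rr k) = a.
    by rewrite /w0'; field.
  have E2 : w0' * tP + (1 - w0') * (b + (tP - b) * rr k) = b.
    by rewrite /w0'; field.
  by apply/andP; split; lra.
have w0N : w0' != 0 by rewrite gt_eqF.
have ww : w <= w0'.
  have : w * (1 - rr k) < w0' * (1 - rr k) by rewrite /w0' mulfVK //; lra.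
  by rewrite ltr_pM2r // => /ltW.
have -> : z = padd (pscale (w / w0') y) (pscale (1 - w / w0') k).
  apply: z_ext; first by rewrite rr_conv rr_conv x1 rz; field.
  by rewrite tt_conv tt_conv xt tz; field.
apply: Kcv => //; apply/andP; split; first exact: divr_ge0 w0 (ltW w0'0).
by rewrite ler_pdivrMr // mul1r.
Qed.

Let rr_dot z : rr z = dot z (pscale tau^-1 (uvec th)) - p / tau.
Proof. by rewrite /rr /dot /pscale /=; field. Qed.

Let lin_dot (k : R) z : tt z - k * rr z =
  dot z (padd (uvec' th) (pscale (- k / tau) (uvec th))) + k * p / tau.
Proof. by rewrite /rr /tt /dot /padd /pscale /=; field. Qed.

Lemma measurable_tri t : plane_measurable (tri t).
Proof.
have -> : tri t = [set z | p / tau <= dot z (pscale tau^-1 (uvec th))] `&`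
  ([set z | a - (t - a) * p / tau <=
            dot z (padd (uvec' th) (pscale (- (t - a) / tau) (uvec th)))] `&`
   halfplane (padd (uvec' th) (pscale (- (t - b) / tau) (uvec th))) (b - (t - b) * p / tau)).
  have E z : tri t z <-> [/\ p / tau <= dot z (pscale tau^-1 (uvec th)),
      a - (t - a) * p / tau <= dot z (padd (uvec' th) (pscale (- (t - a) / tau) (uvec th)))
    & dot z (padd (uvec' th) (pscale (- (t - b) / tau) (uvec th))) <= b - (t - b) * p / tau].
    rewrite /tri /=; have := rr_dot z; have := lin_dot (t - a) z; have := lin_dot (t - b) z.
    by move=> e1 e2 e3; split => -[? ? ?]; split; lra.
  apply/seteqP; split => z; first by move=> /E [].
  by move=> [? [? ?]]; apply/E.
apply: measurableI; first exact: measurable_dot_ge.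
by apply: measurableI; [exact: measurable_dot_ge|exact: measurable_halfplane].
Qed.

(** Shear parallel to the chord in the original coordinates: it fixes the base of [tri] and moves
    the apex. *)
Let shear (k : R) : P -> P :=
  affine (1 - k / tau * cos th * sin th) (- (k / tau * sin th ^+ 2))
         (k / tau * cos th ^+ 2) (1 + k / tau * sin th * cos th)
         (k / tau * p * sin th) (- (k / tau * p * cos th)).

Let rr_shear k z : rr (shear k z) = rr z.
Proof.
rewrite /rr; congr ((_ - _) / _); rewrite /dot /shear /affine /=; ring.
Qed.

Let tt_shear k z : tt (shear k z) = tt z + k * rr z.
Proof.
have cs := cos2Dsin2 th.
rewrite /rr /tt /dot /shear /affine /=; set c := cos th in cs *; set s := sin th in cs *.
transitivity (z.1 * - s + z.2 * c + (k / tau * (z.1 * c + z.2 * s - p)) * (c ^+ 2 + s ^+ 2)).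
  by ring.
by rewrite cs mulr1; field.
Qed.

Lemma ar_tri t t' : ar (tri t) = ar (tri t').
Proof.
rewrite -(ar_affine (1 - (t - t') / tau * cos th * sin th) (- ((t - t') / tau * sin th ^+ 2))
         ((t - t') / tau * cos th ^+ 2) (1 + (t - t') / tau * sin th * cos th)
         ((t - t') / tau * p * sin th) (- ((t - t') / tau * p * cos th))); last 2 first.
- by ring.
- exact: measurable_tri.
congr (ar _); apply/seteqP; split => z; rewrite /preimage /= -/(shear (t - t') z);
  rewrite /tri /= rr_shear tt_shear => -[? ? ?]; split; lra.
Qed.

Let open_tt_lt (k c : R) : box_open [set z | tt z < c + k * rr z].
Proof.
have -> : [set z | tt z < c + k * rr z] =
    [set z | dot z (padd (uvec' th) (pscale (- k / tau) (uvec th))) < c - k * p / tau].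
  by apply/seteqP; split => z /=; have := lin_dot k z => e; lra.
exact: box_open_dot.
Qed.

Let open_tt_gt (k c : R) : box_open [set z | c + k * rr z < tt z].
Proof.
have -> : [set z | c + k * rr z < tt z] = [set z |
    dot z (pscale (-1) (padd (uvec' th) (pscale (- k / tau) (uvec th)))) < k * p / tau - c].
  have dN z y : dot z (pscale (-1) y) = - dot z y by rewrite /dot /pscale /=; ring.
  by apply/seteqP; split => z /=; rewrite dN; have := lin_dot k z => e; lra.
exact: box_open_dot.
Qed.

Let open_rr_lt (c : R) : box_open [set z | rr z < c].
Proof.
have -> : [set z | rr z < c] = [set z | dot z (pscale tau^-1 (uvec th)) < c + p / tau].
  by apply/seteqP; split => z /=; rewrite rr_dot => e; lra.
exact: box_open_dot.
Qed.

Let open_rr_gt (c : R) : box_open [set z | c < rr z].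
Proof.
have -> : [set z | c < rr z] =
    [set z | dot z (pscale (-1) (pscale tau^-1 (uvec th))) < - c - p / tau].
  have dN z y : dot z (pscale (-1) y) = - dot z y by rewrite /dot /pscale /=; ring.
  by apply/seteqP; split => z /=; rewrite dN rr_dot => e; lra.
exact: box_open_dot.
Qed.

(** Open tip, above height [1], of the triangle spanned by the chord and [x]. It avoids [K] and
    every [tri t], and so carries the excess area. *)
Let far (x : P) : set P := [set z | [/\ 1 < rr z, rr z < rr x,
  a + (tt x - a) / rr x * rr z < tt z & tt z < b + (tt x - b) / rr x * rr z]].

Let box_open_far x : box_open (far x).
Proof.
have -> : far x = ([set z | 1 < rr z] `&` [set z | rr z < rr x]) `&`
    ([set z | a + (tt x - a) / rr x * rr z < tt z] `&`
     [set z | tt z < b + (tt x - b) / rr x * rr z]).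
  by apply/seteqP; split => z; [move=> [? ? ? ?]|move=> [[? ?] [? ?]]].
by do 2 apply: box_openI; [exact: open_rr_gt|exact: open_rr_lt|exact: open_tt_gt|exact: open_tt_lt].
Qed.

Let far_hull x : 0 < rr x -> far x `<=` conv_hull (K `|` [set x]).
Proof.
move=> x0 z [z1 z2 z3 z4]; apply: tri_hull => //.
  by apply/andP; split; [apply: ltW; exact: lt_trans z1|exact: ltW].
by rewrite ![(tt x - _) * _]mulrCA ![rr z * _]mulrC; apply/andP; split; exact: ltW.
Qed.

Let far_tri x t z : far x z -> ~ (a + (t - a) * rr z <= tt z <= b + (t - b) * rr z).
Proof.
move=> [z1 _ _ _] /andP[k1 k2]; have := rr_le1 t (rr z) (le_trans k1 k2).
by rewrite leNgt z1.
Qed.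

Let far_nonempty x : 1 < rr x -> exists y, far x y.
Proof.
move=> rx1; have ab' := ab; pose m := (a + b) / 2; have rx0 : 0 < rr x by lra.
pose r0 := (1 + rr x) / 2; pose i := (rr x)^-1.
have iE : i * rr x = 1 by rewrite /i mulVf // gt_eqF.
have i0 : 0 < i by rewrite invr_gt0.
exists (pt th (p + tau * r0) (m + (tt x - m) * i * r0)).
have E1 : rr (pt th (p + tau * r0) (m + (tt x - m) * i * r0)) = r0.
  by rewrite /rr dot_pt_u; field.
have E2 : tt (pt th (p + tau * r0) (m + (tt x - m) * i * r0)) = m + (tt x - m) * i * r0.
  by rewrite /tt dot_pt_u'.
rewrite /far /= E1 E2 -/i.
have ir : i * r0 < 1.
  have : i * r0 < i * rr x by rewrite ltr_pM2l // /r0; lra.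
  by rewrite iE.
have g : 0 < (b - a) * (1 - i * r0) by apply: mulr_gt0; lra.
have r1 : 1 < r0 by rewrite /r0; lra.
have r2 : r0 < rr x by rewrite /r0; lra.
move: g r1 r2; rewrite /m; move: (tt x) (rr x) i r0 {E1 E2 iE i0 ir rx0 rx1} => T X i r g r1 r2.
by split => //; lra.
Qed.

Let apex_tri x z : 1 < rr x ->
  tri ((a + b) / 2 + (tt x - (a + b) / 2) / rr x) z -> conv_hull (K `|` [set x]) z.
Proof.
move=> rx1; set t' := _ + _ / rr x => -[z0 z1 z2]; have ab' := ab.
have rx0 : 0 < rr x by lra.
have r1 : rr z <= 1 by apply: (rr_le1 t'); exact: le_trans z2.
apply: tri_hull => //; first by rewrite z0 (le_trans r1) // ltW.
have u1 : (rr x)^-1 <= 1 by rewrite invf_le1 // ltW.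
have g : 0 <= rr z * (1 - (rr x)^-1) * (b - a).
  by apply: mulr_ge0; [apply: mulr_ge0|]; lra.
move: z1 z2 g; rewrite /t'; move: (rr x)^-1 (rr z) (tt z) (tt x) {rx1 rx0 u1 r1 z0 t'} => i r t T z1 z2 g.
by apply/andP; split; lra.
Qed.

(** For a higher [x], [dh] is at most the area of [tri tP] outside [K], which is at most that of
    [tri t'] outside [K]: both triangles have the same area, and the part of [K] in [tri t'] is in
    [tri tP] by the wedge. The hull of [x] contains [tri t'] and also the tip [far x], so its area
    outside [K] exceeds [dh]. *)
Lemma pole_extremal dh x :
  area (conv_hull (K `|` [set pt th (p + tau) tP]) `\` K) = dh%:E ->
  area (conv_hull (K `|` [set x]) `\` K) = dh%:E ->
  (dot x (uvec th) - (p + tau)) * tau <= 0.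
Proof.
move=> hP hx; rewrite leNgt; apply/negP => xtau; have ab' := ab.
set q := pt th (p + tau) tP in hP.
have rq : rr q = 1 by rewrite /rr dot_pt_u; field.
have tq : tt q = tP by rewrite /tt dot_pt_u'.
have rx1 : 1 < rr x.
  have t2 : 0 < tau ^+ 2 by rewrite exprn_even_gt0.
  rewrite -(ltr_pM2r t2) -subr_gt0.
  rewrite (_ : _ - _ = (dot x (uvec th) - (p + tau)) * tau) //.
  by rewrite /rr; field.
have rx0 : 0 < rr x by lra.
have rxN : rr x != 0 by rewrite gt_eqF.
(* Where the segment from the midpoint of the chord to [x] crosses height [1]; this keeps [tri t']
   inside the hull of [x]. *)
pose t' := (a + b) / 2 + (tt x - (a + b) / 2) / rr x.
have mK : plane_measurable K by case: (regular_tame K Kreg).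
have thx := conv_hull_tame K x bK; have thq := conv_hull_tame K q bK.
set U := conv_hull (K `|` [set x]) `\` K in hx.
have tU : tame U by exact: tameD.
have arU : ar U = dh by rewrite /ar hx.
have T'hull : tri t' `<=` conv_hull (K `|` [set x]) by move=> z; exact: apex_tri.
have Thull : tri tP `<=` conv_hull (K `|` [set q]).
  move=> z [z0 z1 z2]; have r1 : rr z <= 1 by apply: (rr_le1 tP); lra.
  by apply: tri_hull; rewrite ?rq ?tq ?ltr01 ?divr1 //; apply/andP.
have tT : tame (tri tP) by apply: tame_sub thq => //; exact: measurable_tri.
have tT' : tame (tri t') by apply: tame_sub thx => //; exact: measurable_tri.
have lower : dh <= ar (tri tP `\` K).
  have <- : ar (conv_hull (K `|` [set q]) `\` K) = dh by rewrite /ar hP.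
  apply: ar_le; [by case: (tameD _ _ thq mK)|exact: tameD|].
  by move=> z zq; split; [exact: (hull_tri q)|case: zq].
have cmp : ar (tri tP `\` K) <= ar (tri t' `\` K).
  have := ar_split _ _ tT mK; have := ar_split _ _ tT' mK; rewrite (ar_tri t' tP).
  have : ar (tri t' `&` K) <= ar (tri tP `&` K).
    apply: ar_le; [by case: (tameI _ _ tT' mK)|exact: tameI|].
    by move=> z [[z0 _ _] Kz]; split => //; have /andP[? ?] := wedge z Kz; split.
  by move=> c1 e1 e2; exact: sum_compare e2 e1 c1.
have [y Dy] := far_nonempty x rx1; have [e e0 He] := box_open_far x y Dy.
set D := far x in Dy He.
have mD : plane_measurable D by apply: measurable_box_open; exact: box_open_far.
have UD : D `<=` U.
  by move=> z Dz; split; [exact: far_hull|move=> /wedge; exact: far_tri Dz].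
have := ar_split U D tU mD.
have : 0 < ar (U `&` D).
  by apply: (ar_gt0 _ y e) => //; [exact: tameI|move=> z /He Dz; split => //; exact: UD].
have : ar (tri t' `\` K) <= ar (U `\` D).
  apply: ar_le; [by case: (tameD _ _ tT' mK)|exact: tameD|].
  move=> z [Tz nKz]; split; first by split => //; exact: T'hull.
  by move=> Dz; case: Tz => _ k1 k2; apply: (far_tri x t' z Dz); rewrite k1.
rewrite arU => h1 h2 h3; have : dh <= ar (U `\` D).
  by apply: le_trans lower _; apply: le_trans cmp _.
by rewrite {1}h3 gerDr leNgt h2.
Qed.

End Illumination.

(** * From the linear system to an ellipse *)

Section Ellipse.
Context {R : realType}.
Notation P := (R * R)%type.

Lemma polar_angle (x y : R) : x ^+ 2 + y ^+ 2 = 1 -> exists th, cos th = x /\ sin th = y.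
Proof.
move=> xy; have y2 := sqr_ge0 y; have x2 := sqr_ge0 x.
have x1 : -1 <= x <= 1.
  by rewrite -ler_norml -(@ler_pXn2r _ 2) ?nnegrE // expr1n real_normK ?num_real //; lra.
have sE : sin (acos x) ^+ 2 = y ^+ 2.
  have := cos2Dsin2 (acos x); rewrite acosK ?in_itv //=; lra.
have : (sin (acos x) == y) || (sin (acos x) == - y) by rewrite -eqf_sqr sE.
move=> /orP[] /eqP sy; [exists (acos x)|exists (- acos x)].
  by rewrite acosK ?in_itv.
by rewrite cosN sinN sy opprK acosK ?in_itv.
Qed.

Lemma polar_normal (x y : R) : (x, y) <> (0, 0) ->
  exists th r, [/\ 0 < r, x = - (r * sin th) & y = r * cos th].
Proof.
move=> xy; pose r := Num.sqrt (x ^+ 2 + y ^+ 2).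
have n0 : 0 < x ^+ 2 + y ^+ 2.
  have h1 := sqr_ge0 x; have h2 := sqr_ge0 y.
  rewrite lt_def addr_ge0 // andbT; apply/eqP => E; apply: xy.
  have /eqP : x ^+ 2 = 0 by lra.
  have /eqP : y ^+ 2 = 0 by lra.
  by rewrite !sqrf_eq0 => /eqP -> /eqP ->.
have r0 : 0 < r by rewrite sqrtr_gt0.
have rN : r != 0 by rewrite gt_eqF.
have rE : r ^+ 2 = x ^+ 2 + y ^+ 2 by rewrite sqr_sqrtr // ltW.
have [|th [c s]] := polar_angle (y / r) (- x / r).
  by rewrite !expr_div_n sqrrN -mulrDl addrC -rE divff // expf_neq0.
by exists th, r; split => //; rewrite ?c ?s; field.
Qed.

(** Horizontal chords of the disk bring its image into [K]. A point of [K] beyond the ellipse would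
    make the boundary point on its ray from the centre an interior one. *)
Lemma ellipse_of_boundary (K : set P) (c e1 e2 : P) : convex_body K ->
  e1.1 * e2.2 - e2.1 * e1.2 != 0 ->
  (forall u : P, u.1 ^+ 2 + u.2 ^+ 2 = 1 ->
     bd K (padd c (e1.1 * u.1 + e2.1 * u.2, e1.2 * u.1 + e2.2 * u.2))) ->
  is_ellipse K.
Proof.
move=> bK d0 Hbd; have [_ _ Kcv _] := convex_body_regular _ bK.
pose phi (u : P) := padd c (e1.1 * u.1 + e2.1 * u.2, e1.2 * u.1 + e2.2 * u.2).
have phi_conv t u w : phi (padd (pscale t u) (pscale (1 - t) w)) =
    padd (pscale t (phi u)) (pscale (1 - t) (phi w)).
  by rewrite /phi /padd /pscale /=; congr (_, _); ring.
have diskK u : u.1 ^+ 2 + u.2 ^+ 2 <= 1 -> K (phi u).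
  move=> u1; pose s := Num.sqrt (1 - u.2 ^+ 2).
  have s2 : s ^+ 2 = 1 - u.2 ^+ 2 by rewrite sqr_sqrtr //; have := sqr_ge0 u.1; lra.
  have s0 : 0 <= s by exact: sqrtr_ge0.
  have us : - s <= u.1 <= s.
    by rewrite -ler_norml -(@ler_pXn2r _ 2) ?nnegrE // real_normK ?num_real //; lra.
  have Kp : K (phi (s, u.2)) by apply: ((bdP _ _ bK).1 (Hbd _ _)).1; rewrite /= s2; ring.
  have Km : K (phi (- s, u.2)) by apply: ((bdP _ _ bK).1 (Hbd _ _)).1; rewrite /= sqrrN s2; ring.
  have [s00|s00] := eqVneq s 0.
    have u1s : u.1 = s by lra.
    by rewrite [u]surjective_pairing u1s.
  have sp : 0 < s by rewrite lt_def s00.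
  pose t := (u.1 + s) / (2 * s).
  have uE : padd (pscale t (s, u.2)) (pscale (1 - t) (- s, u.2)) = u.
    by rewrite [RHS]surjective_pairing /padd /pscale /=; congr (_, _); rewrite /t; field.
  rewrite -uE phi_conv; apply: Kcv => //; apply/andP; split.
    by apply: divr_ge0; lra.
  by rewrite ler_pdivrMr; lra.
exists c, e1.1, e2.1, e1.2, e2.2; split; first by [].
apply/seteqP; split => [x Kx|_ [u u1 <-]]; last exact: diskK.
set d := e1.1 * e2.2 - e2.1 * e1.2 in d0.
have inv y : exists u, y = phi u.
  exists (((y.1 - c.1) * e2.2 - (y.2 - c.2) * e2.1) / d,
          ((y.2 - c.2) * e1.1 - (y.1 - c.1) * e1.2) / d).
  by case: y => y1 y2; rewrite /phi /padd /=; congr (_, _); rewrite /d in d0 *; field.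
have [u uE] := inv x; exists u; last by rewrite uE.
rewrite /= leNgt; apply/negP => u1.
have ic : inner K (phi (0, 0)).
  (* [S] bounds the inverse matrix, so a box of radius [1 / (2 * S)] pulls back to coordinates of
     size at most [1 / 2], inside the disk. *)
  pose S := (`|e1.1| + `|e2.1| + `|e1.2| + `|e2.2|) / `|d| + 1.
  have dn : 0 < `|d| by rewrite normr_gt0.
  have S1 : 1 <= S by rewrite lerDr divr_ge0 // !addr_ge0.
  exists (1 / (2 * S)); first by rewrite divr_gt0 //; lra.
  have S0 : 0 < S by lra.
  move=> y [/= y1 y2]; rewrite !mulr0 !addr0 in y1 y2.
  have -> : y = phi (((y.1 - c.1) * e2.2 - (y.2 - c.2) * e2.1) / d,
          ((y.2 - c.2) * e1.1 - (y.1 - c.1) * e1.2) / d).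
    by case: y {y1 y2} => y1 y2; rewrite /phi /padd /=; congr (_, _); rewrite /d in d0 *; field.
  apply: diskK => /=.
  have B (f g : R) : `|f| / `|d| + `|g| / `|d| <= S ->
      (((y.1 - c.1) * f - (y.2 - c.2) * g) / d) ^+ 2 <= 1 / 4.
    move=> fg; rewrite -real_normK ?num_real //.
    have : `|((y.1 - c.1) * f - (y.2 - c.2) * g) / d| <= 1 / 2.
      rewrite mulrBl; apply: le_trans (ler_normB _ _) _.
      rewrite -!mulrA !normrM !normfV.
      apply: (@le_trans _ _ (1 / (2 * S) * (`|f| / `|d| + `|g| / `|d|))).
        rewrite mulrDr; apply: lerD; apply: ler_wpM2r; rewrite ?divr_ge0 //; exact: ltW.
      apply: (@le_trans _ _ (1 / (2 * S) * S)).
        by apply: ler_wpM2l => //; rewrite divr_ge0 //; lra.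
      by rewrite le_eqVlt; apply/orP; left; apply/eqP; field; rewrite gt_eqF.
    move: `|_ / d| (normr_ge0 (((y.1 - c.1) * f - (y.2 - c.2) * g) / d)) => z z0 z1; nra.
  have E (f : R) : `|f| / `|d| = `|f| * `|d|^-1 by [].
  have i0 : 0 <= `|d|^-1 by rewrite invr_ge0.
  have b1 := B e2.2 e2.1; have b2 := B (- e1.2) (- e1.1).
  have -> : ((y.2 - c.2) * e1.1 - (y.1 - c.1) * e1.2) = ((y.1 - c.1) * - e1.2 - (y.2 - c.2) * - e1.1) by ring.
  rewrite !normrN in b2.
  have SE : S = `|e1.1| / `|d| + `|e2.1| / `|d| + `|e1.2| / `|d| + `|e2.2| / `|d| + 1.
    by rewrite /S !mulrDl.
  have p1 : 0 <= `|e1.1| / `|d| by rewrite divr_ge0.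
  have p2 : 0 <= `|e2.1| / `|d| by rewrite divr_ge0.
  have p3 : 0 <= `|e1.2| / `|d| by rewrite divr_ge0.
  have p4 : 0 <= `|e2.2| / `|d| by rewrite divr_ge0.
  have {}b1 := b1 ltac:(by lra); have {}b2 := b2 ltac:(by lra).
  by lra.
pose n := Num.sqrt (u.1 ^+ 2 + u.2 ^+ 2).
have n1 : 1 < n by rewrite -sqrtr1 ltr_sqrt //; lra.
have n2 : n ^+ 2 = u.1 ^+ 2 + u.2 ^+ 2 by rewrite sqr_sqrtr //; lra.
have nN : n != 0 by rewrite gt_eqF //; lra.
have un : (u.1 / n) ^+ 2 + (u.2 / n) ^+ 2 = 1.
  by rewrite !expr_div_n -mulrDl -n2 divff // expf_neq0.
have [_] := (bdP _ _ bK).1 (Hbd (u.1 / n, u.2 / n) un).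
apply; rewrite -/(phi _).
rewrite (_ : (u.1 / n, u.2 / n) = padd (pscale (1 - 1 / n) (0, 0)) (pscale (1 - (1 - 1 / n)) u)); last first.
  by rewrite /padd /pscale /=; congr (_, _); field.
rewrite phi_conv; apply: inner_conv => //; first by rewrite -uE.
have : 0 < 1 / n < 1.
  by rewrite divr_gt0 ?ltr_pdivrMr //; lra.
by move=> /andP[? ?]; apply/andP; split; lra.
Qed.

(* For the linear system X' = kap Y, Y' = - kap k X, the Wronskian and the
   energy forms are conserved; they pin Y to an ellipse and X to a linear
   image of Y. *)
Lemma conserved (kap x y x' y' : R -> R) (k : R) :
  (forall t, dif x t (kap t * y t)) -> (forall t, dif y t (- kap t * k * x t)) ->
  (forall t, dif x' t (kap t * y' t)) -> (forall t, dif y' t (- kap t * k * x' t)) ->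
  forall t s, k * x t * x' t + y t * y' t = k * x s * x' s + y s * y' s /\
              x t * y' t - y t * x' t = x s * y' s - y s * x' s.
Proof.
move=> dx dy dx' dy' t s; split.
  apply: (@dif0_const _ (fun t => k * x t * x' t + y t * y' t)) => z.
  apply: dif_ext (difD _ _ _ _ _
    (difM _ _ _ _ _ (difM _ _ _ _ _ (dif_const k z) (dx z)) (dx' z))
    (difM _ _ _ _ _ (dy z) (dy' z))) => //.
  by ring.
apply: (@dif0_const _ (fun t => x t * y' t - y t * x' t)) => z.
apply: dif_ext (difB _ _ _ _ _
    (difM _ _ _ _ _ (dx z) (dy' z)) (difM _ _ _ _ _ (dy z) (dx' z))) => //.
by ring.
Qed.

Lemma dif_lin (f g : R -> R) (al be l m : R) z : dif f z l -> dif g z m ->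
  dif (fun t => al * f t + be * g t) z (al * l + be * m).
Proof.
move=> df dg; apply: dif_ext (difD _ _ _ _ _ (difM _ _ _ _ _ (dif_const al z) df)
  (difM _ _ _ _ _ (dif_const be z) dg)) => //.
by ring.
Qed.

(** [X] stands for the midpoint seen from the centre and [Y = l * uvec'] for half the chord, so
    [X - Y] is the end [A]. Since [Y] takes every direction, the orbit fills the whole ellipse. *)
Lemma harmonic_motion_ellipse (X1 X2 l kap : R -> R) (k : R) :
  (forall t, 0 < l t) ->
  (forall t, dif X1 t (kap t * - (l t * sin t))) ->
  (forall t, dif X2 t (kap t * (l t * cos t))) ->
  (forall t, dif (fun t => - (l t * sin t)) t (- kap t * k * X1 t)) ->
  (forall t, dif (fun t => l t * cos t) t (- kap t * k * X2 t)) ->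
  X1 0 != 0 ->
  0 < k /\ exists e1 e2 : P, e1.1 * e2.2 - e2.1 * e1.2 != 0 /\
    forall u : P, u.1 ^+ 2 + u.2 ^+ 2 = 1 -> exists t,
      (e1.1 * u.1 + e2.1 * u.2, e1.2 * u.1 + e2.2 * u.2) =
      (X1 t + l t * sin t, X2 t - l t * cos t).
Proof.
move=> l0 dX1 dX2 dY1 dY2 X10.
pose Y1 t := - (l t * sin t); pose Y2 t := l t * cos t.
have Y10 : Y1 0 = 0 by rewrite /Y1 sin0 mulr0 oppr0.
pose L := l 0; have Y20 : Y2 0 = L by rewrite /Y2 cos0 mulr1.
have L0 : L != 0 by rewrite gt_eqF //; exact: l0.
pose A := X1 0; pose B := X2 0; rewrite -/A in X10.
(* Coordinates in the basis X(0) = (A, B), Y(0) = (0, L). *)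
pose x1 t := A^-1 * X1 t + 0 * X2 t; pose y1 t := A^-1 * Y1 t + 0 * Y2 t.
pose x2 t := - (B / (A * L)) * X1 t + L^-1 * X2 t.
pose y2 t := - (B / (A * L)) * Y1 t + L^-1 * Y2 t.
have dx1 t : dif x1 t (kap t * y1 t).
  by apply: dif_ext (dif_lin _ _ A^-1 0 _ _ _ (dX1 t) (dX2 t)) => //; rewrite /y1 /Y1 /Y2; ring.
have dx2 t : dif x2 t (kap t * y2 t).
  by apply: dif_ext (dif_lin _ _ _ _ _ _ _ (dX1 t) (dX2 t)) => //; rewrite /y2 /Y1 /Y2; ring.
have dy1 t : dif y1 t (- kap t * k * x1 t).
  by apply: dif_ext (dif_lin _ _ A^-1 0 _ _ _ (dY1 t) (dY2 t)) => //; rewrite /x1; ring.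
have dy2 t : dif y2 t (- kap t * k * x2 t).
  by apply: dif_ext (dif_lin _ _ _ _ _ _ _ (dY1 t) (dY2 t)) => //; rewrite /x2; ring.
have x10 : x1 0 = 1 by rewrite /x1 -/A mul0r addr0 mulVf.
have x20 : x2 0 = 0 by rewrite /x2 -/A -/B; field; rewrite ?X10 ?L0.
have y10 : y1 0 = 0 by rewrite /y1 Y10; ring.
have y20 : y2 0 = 1 by rewrite /y2 Y10 Y20 mulr0 add0r mulVf.
have E1 t : k * x1 t * x1 t + y1 t * y1 t = k.
  by have [-> _] := conserved _ _ _ _ _ _ dx1 dy1 dx1 dy1 t 0; rewrite x10 y10; ring.
have E2 t : k * x2 t * x2 t + y2 t * y2 t = 1.
  by have [-> _] := conserved _ _ _ _ _ _ dx2 dy2 dx2 dy2 t 0; rewrite x20 y20; ring.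
have E3 t : x1 t * y2 t - y1 t * x2 t = 1.
  by have [_ ->] := conserved _ _ _ _ _ _ dx1 dy1 dx2 dy2 t 0; rewrite x10 y10 x20 y20; ring.
have Y1E t : Y1 t = A * y1 t by rewrite /y1; field.
have Y2E t : Y2 t = B * y1 t + L * y2 t by rewrite /y1 /y2; field; rewrite ?X10 ?L0.
have X1E t : X1 t = A * x1 t by rewrite /x1; field.
have X2E t : X2 t = B * x1 t + L * x2 t by rewrite /x1 /x2; field; rewrite ?X10 ?L0.
(* At the angle where [Y] is a positive multiple of [X 0], the coordinate [y2] vanishes and the
   energy identity [E2] reads [k * x2 ^ 2 = 1]. *)
have k0 : 0 < k.
  have [|th [r [r0 Ar Br]]] := polar_normal A B; first by move=> [/eqP]; rewrite (negPf X10).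
  have y2th : y2 th = 0.
    rewrite /y2 /Y1 /Y2.
    have s0 : sin th != 0.
      by apply: contraNneq X10 => s0; rewrite Ar s0 mulr0 oppr0.
    by rewrite Ar Br; field; rewrite s0 L0 gt_eqF.
  have := E3 th; have := E2 th; rewrite y2th !mulr0 sub0r addr0 => e2 e3.
  have x0 : x2 th != 0.
    by apply/eqP => x0; move: e3; rewrite x0 mulr0 oppr0 => /esym/eqP; rewrite oner_eq0.
  have : 0 < k * (x2 th ^+ 2) by rewrite expr2 mulrA e2.
  by rewrite pmulr_lgt0 // exprn_even_gt0.
split => //.
have kN : k != 0 by rewrite gt_eqF.
(* The combination [E1 + k * E2 - 2 * k * E3] is a sum of two squares with positive weights, and its
   value is [k + k - 2 * k = 0]. *)
have F t : x1 t = y2 t /\ k * x2 t = - y1 t.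
  have z : k * (x1 t - y2 t) ^+ 2 + (y1 t + k * x2 t) ^+ 2 = 0.
    transitivity ((k * x1 t * x1 t + y1 t * y1 t) + k * (k * x2 t * x2 t + y2 t * y2 t)
       - 2 * k * (x1 t * y2 t - y1 t * x2 t)); first by ring.
    by rewrite E1 E2 E3; ring.
  have p1 : 0 <= k * (x1 t - y2 t) ^+ 2 by rewrite mulr_ge0 ?sqr_ge0 // ltW.
  have p2 : 0 <= (y1 t + k * x2 t) ^+ 2 by exact: sqr_ge0.
  have /eqP : k * (x1 t - y2 t) ^+ 2 = 0 by lra.
  have /eqP : (y1 t + k * x2 t) ^+ 2 = 0 by lra.
  by rewrite sqrf_eq0 mulf_eq0 (negPf kN) /= sqrf_eq0 => /eqP ? /eqP ?; split; lra.
(* By [F] and the energy, the coordinates of [X - Y] satisfy [X ^ 2 + k * Y ^ 2 = 1 + k], an ellipse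
   with semi-axes [g] and [g / h] in the chosen basis. *)
pose g := Num.sqrt (1 + k); pose h := Num.sqrt k.
have g2 : g ^+ 2 = 1 + k by rewrite sqr_sqrtr //; lra.
have h2 : h ^+ 2 = k by rewrite sqr_sqrtr // ltW.
have g0 : g != 0 by rewrite gt_eqF // sqrtr_gt0; lra.
have h0 : h != 0 by rewrite gt_eqF // sqrtr_gt0.
exists (g * A, g * B), (0, g / h * L); split.
  by rewrite /= mul0r subr0 !mulf_neq0 // invr_neq0.
move=> [u1 u2] /= u.
pose X := g * u1; pose Y := g / h * u2.
have XY : X ^+ 2 + k * Y ^+ 2 = 1 + k.
  rewrite -h2 /X /Y; transitivity (g ^+ 2 * (u1 ^+ 2 + u2 ^+ 2)); first by field.
  by rewrite u g2 h2 mulr1.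
(* Solution of [z2 - z1 = X] and [- z1 / k - z2 = Y], which is the requirement on [y1], [y2] once
   [F] has eliminated [x1], [x2]. *)
pose z1 := - (k * (X + Y)) / (1 + k); pose z2 := (X - k * Y) / (1 + k).
have k1N : 1 + k != 0 by rewrite gt_eqF //; lra.
have zz : z1 * z1 + k * (z2 * z2) = k.
  transitivity (k * (X ^+ 2 + k * Y ^+ 2) / (1 + k)); first by rewrite /z1 /z2; field.
  by rewrite XY mulfK.
have [|th [r [r0 vA vB]]] := polar_normal (A * z1) (B * z1 + L * z2).
  move=> [/eqP]; rewrite mulf_eq0 (negPf X10) /= => /eqP z10.
  rewrite z10 mulr0 add0r => /eqP; rewrite mulf_eq0 (negPf L0) /= => /eqP z20.
  by move: zz; rewrite z10 z20 !mulr0 addr0 => /esym/eqP; rewrite (negPf kN).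
(* At [th] the half-chord has the required direction, hence is [s] times the required vector;
   conservation of energy forces [s = 1]. *)
pose s := l th / r.
have s0 : 0 < s by rewrite divr_gt0.
have rN : r != 0 by rewrite gt_eqF.
have sY1 : y1 th = s * z1.
  by apply: (mulfI X10); rewrite -Y1E mulrCA vA /Y1 /s; field.
have sY2 : y2 th = s * z2.
  apply: (mulfI L0).
  have -> : L * y2 th = Y2 th - B * y1 th by rewrite Y2E; ring.
  rewrite sY1; have -> : Y2 th = s * (B * z1 + L * z2) by rewrite vB /Y2 /s; field.
  by ring.
have [F1 F2] := F th.
have s1 : s = 1.
  have : k * (k * x2 th * x2 th + y2 th * y2 th) = s ^+ 2 * k.
    rewrite mulrDr (_ : k * (k * x2 th * x2 th) = (k * x2 th) * (k * x2 th)); last by ring.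
    by rewrite F2 sY1 sY2 -{2}zz; ring.
  rewrite E2 mulr1 => e; have /eqP : s ^+ 2 = 1 by apply: (mulIf kN); rewrite mul1r -e.
  by rewrite sqrf_eq1 => /orP[/eqP //|/eqP s1]; move: s0; rewrite s1; lra.
rewrite s1 !mul1r in sY1 sY2.
have x2E : x2 th = - z1 / k by apply: (mulfI kN); rewrite F2 sY1; field.
exists th.
have -> : X1 th + l th * sin th = A * (x1 th - y1 th) by rewrite X1E mulrBr -Y1E /Y1; ring.
have -> : X2 th - l th * cos th = B * (x1 th - y1 th) + L * (x2 th - y2 th).
  by rewrite -/(Y2 th) X2E Y2E; ring.
rewrite F1 x2E sY1 sY2.
have -> : z2 - z1 = X by rewrite /z1 /z2; field.
have -> : - z1 / k - z2 = Y by rewrite /z1 /z2; field; rewrite ?kN ?k1N.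
by rewrite /X /Y; congr (_, _); ring.
Qed.

End Ellipse.

(** * The homothety matches each midpoint with the pole of its own chord *)

Section Matching.
Context {R : realType}.
Notation P := (R * R)%type.

Lemma dif_max (f : R -> R) t l : dif f t l -> (forall s, f s <= f t) -> l = 0.
Proof.
move=> df fmax; apply/eqP; apply: contraT => l0.
have nl : 0 < `|l| by rewrite normr_gt0.
have [d d0 H] := df (`|l| / 2) ltac:(by rewrite divr_gt0).
pose h := l / `|l| * (d / 2).
have hN : `|h| = d / 2.
  by rewrite normrM normf_div normr_id divff ?gt_eqF // mul1r gtr0_norm // divr_gt0.
have := H h; rewrite hN => /(_ ltac:(by lra)).
have lh : l * h = `|l| * (d / 2).
  rewrite /h mulrA; congr (_ * _); rewrite mulrA -expr2 -real_normK ?num_real // expr2.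
  by rewrite mulfK // gt_eqF.
rewrite lh ler_distl => /andP[H1 _]; have := fmax (t + h).
have : 0 < `|l| * (d / 2) by rewrite mulr_gt0 // divr_gt0.
lra.
Qed.

Context (K : set P) (dh : R) (q : P) (lam : R) (p a b cA cB : R -> R).
Local Notation m := (fun th => (a th + b th) / 2).
Hypothesis bK : convex_body K.
Hypothesis chK : forall th, chord K th (p th) (a th) (b th).
Hypothesis dp : forall th, dif p th (m th).
Hypothesis da : forall th, dif a th (- p th + cA th * (m th - a th)).
Hypothesis db : forall th, dif b th (- p th + cB th * (m th - b th)).
Hypothesis ccA : forall th, cts cA th.
Hypothesis ccB : forall th, cts cB th.
Hypothesis wedgeA : forall th al t, K (pt th (p th + al) t) -> a th + cA th * al <= t.
Hypothesis wedgeB : forall th al t, K (pt th (p th + al) t) -> t <= b th + cB th * al.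
Hypothesis p_uvec : forall th th', uvec th = uvec th' :> P -> p th = p th'.

Definition midpoint th : P := pt th (p th) (m th).
Definition hom (x : P) : P := padd q (pscale lam (padd x (pscale (-1) q))).
(* The reciprocal of the signed height of the pole above the chord (0 if there is no pole). *)
Definition wht th : R := (cA th - cB th) / (b th - a th).
Definition pole th : P := pt th (p th + (wht th)^-1) (a th + cA th * (wht th)^-1).

Hypothesis pole_illum : forall th, cA th != cB th -> illum K dh (pole th).
Hypothesis illum_pole : forall x, illum K dh x -> exists2 th, cA th != cB th & x = pole th.
Hypothesis hom_illum : forall th, illum K dh (hom (midpoint th)).
Hypothesis illum_hom : forall x, illum K dh x -> exists th, x = hom (midpoint th).
Hypothesis lam0 : 0 < lam.

Let ab th : 0 < b th - a th. Proof. by have [? _ _] := chK th; rewrite subr_gt0. Qed.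
Let abN th : b th - a th != 0. Proof. by rewrite gt_eqF. Qed.

Lemma dot_hom x u : dot (hom x) u = (1 - lam) * dot q u + lam * dot x u.
Proof. by rewrite /dot /hom /padd /pscale /=; ring. Qed.

Lemma wht_neq0 th : (wht th != 0) = (cA th != cB th).
Proof. by rewrite /wht mulf_eq0 invr_eq0 (negPf (abN th)) orbF subr_eq0. Qed.

Lemma dot_uvec_le (x : P) th : `|dot x (uvec th)| <= `|x.1| + `|x.2|.
Proof.
rewrite /dot /=; apply: le_trans (ler_normD _ _) _; rewrite !normrM.
have c1 : `|cos th| <= 1 by rewrite ler_norml cos_geN1 cos_le1.
have i1 : `|sin th| <= 1 by rewrite ler_norml sin_geN1 sin_le1.
by apply: lerD; rewrite ler_piMr.
Qed.

(** An existing pole is the homothetic image of a point of [K], which bounds its height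
    [(wht th)^-1] by [C]. Parallel tangents, where [wht] is [0], are still possible here. *)
Lemma wht_away0 : exists2 c0, 0 < c0 & forall th, wht th != 0 -> c0 <= `|wht th|.
Proof.
have [_ [B KB] _ _] := convex_body_regular _ bK.
have midK th : K (midpoint th).
  by have [? H _] := chK th; apply/H; apply/andP; split; lra.
have midB th th' : `|dot (midpoint th) (uvec th')| <= 2 * B.
  by apply: le_trans (dot_uvec_le _ _) _; have [] := KB _ (midK th); lra.
pose C := `|1 - lam| * (`|q.1| + `|q.2|) + lam * (2 * B) + 2 * B + 1.
have B0 : 0 <= 2 * B by apply: le_trans (midB 0 0).
have C0 : 0 < C.
  have : 0 <= `|1 - lam| * (`|q.1| + `|q.2|) by rewrite mulr_ge0 // addr_ge0.
  have : 0 <= lam * (2 * B) by rewrite mulr_ge0 // ltW.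
  by rewrite /C; lra.
exists C^-1; first by rewrite invr_gt0.
move=> th w0; have nw : 0 < `|wht th| by rewrite normr_gt0.
have [t pt_] : exists t, pole th = hom (midpoint t).
  by apply: illum_hom; apply: pole_illum; rewrite -wht_neq0.
have : p th + (wht th)^-1 = (1 - lam) * dot q (uvec th) + lam * dot (midpoint t) (uvec th).
  by rewrite -dot_hom -pt_ dot_pt_u.
have pE : p th = dot (midpoint th) (uvec th) by rewrite dot_pt_u.
rewrite pE => E.
have : `|(wht th)^-1| <= C.
  have -> : (wht th)^-1 = (1 - lam) * dot q (uvec th) + lam * dot (midpoint t) (uvec th)
     - dot (midpoint th) (uvec th) by rewrite -E; ring.
  apply: le_trans (ler_normB _ _) _; apply: le_trans (lerD (ler_normD _ _) (lexx _)) _.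
  rewrite !normrM (gtr0_norm lam0).
  have h1 : `|1 - lam| * `|dot q (uvec th)| <= `|1 - lam| * (`|q.1| + `|q.2|).
    by apply: ler_wpM2l => //; exact: dot_uvec_le.
  have h2 : lam * `|dot (midpoint t) (uvec th)| <= lam * (2 * B) by rewrite ler_pM2l.
  have h3 := midB th th.
  by apply: le_trans (lerD (lerD h1 h2) h3) _; rewrite /C lerDl ler01.
rewrite normfV => H; rewrite -[`|wht th|]invrK lef_pV2 ?posrE ?invr_gt0 //.
Qed.

Lemma cts_wht th : cts wht th.
Proof.
have ca := dif_cts _ _ _ (da th); have cb := dif_cts _ _ _ (db th).
apply: ctsM; first by apply: ctsD => //; exact: ctsN.
by apply: ctsV => //; apply: ctsD => //; exact: ctsN.
Qed.

(* The poles stay bounded, so the continuous function [wht] cannot approach 0. *)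
Lemma wht_same_sign th th' : 0 < wht th * wht th'.
Proof.
have [c0 c00 H] := wht_away0.
(* Some chord does have a pole, because the illumination curve contains the image of a midpoint. *)
have [t0 t0N _] := illum_pole _ (hom_illum 0); rewrite -wht_neq0 in t0N.
have main t : 0 < wht t0 * wht t.
  rewrite ltNge; apply/negP => neg.
  pose s := wht t0 / `|wht t0|.
  have n0 : 0 < `|wht t0| by rewrite normr_gt0.
  have ss : `|s| = 1 by rewrite normf_div normr_id divff // gt_eqF.
  have f1 : c0 <= s * wht t0.
    rewrite /s mulrAC -expr2 -real_normK ?num_real // expr2 mulfK ?gt_eqF //.
    exact: H.
  have f2 : s * wht t <= 0.
    by rewrite /s mulrAC; apply: mulr_le0_ge0 => //; rewrite invr_ge0.
  have [z zE] : exists z, s * wht z = c0 / 2.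
    apply: (@cts_IVT _ (fun z => s * wht z) t t0).
      by move=> x; apply: ctsM; [exact: cts_const|exact: cts_wht].
    by apply/andP; split; lra.
  have zn : `|wht z| = c0 / 2.
    have : `|s * wht z| = c0 / 2 by rewrite zE gtr0_norm // divr_gt0.
    by rewrite normrM ss mul1r.
  have : wht z != 0 by rewrite -normr_gt0 zn divr_gt0.
  by move=> /H; rewrite zn; lra.
apply: (@mul_same_sign _ _ _ (wht t0)).
by apply: mulr_gt0; rewrite mulrC; exact: main.
Qed.

Let wN th : wht th != 0.
Proof. by apply/eqP => w; have := wht_same_sign th th; rewrite w mul0r ltxx. Qed.

(** Signed radius of curvature of the envelope. By [wht_rho] it never vanishes and has a constant
    sign, so the envelope has no cusp. *)
Let rho th : R := (cA th - cB th) * (b th - a th) / 4.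

Lemma dif_mid th : dif m th (- p th + rho th).
Proof.
apply: dif_ext (difM _ _ _ _ _ (difD _ _ _ _ _ (da th) (db th)) (dif_const 2^-1 th)) => //.
by rewrite /rho; field.
Qed.

Lemma dif_midpoint th : dif (fun t => (midpoint t).1) th (- (rho th * sin th)) /\
  dif (fun t => (midpoint t).2) th (rho th * cos th).
Proof.
split.
  apply: dif_ext (difB _ _ _ _ _ (difM _ _ _ _ _ (dp th) (dif_cos th))
     (difM _ _ _ _ _ (dif_mid th) (dif_sin th))) => //.
  by ring.
apply: dif_ext (difD _ _ _ _ _ (difM _ _ _ _ _ (dp th) (dif_sin th))
     (difM _ _ _ _ _ (dif_mid th) (dif_cos th))) => //.
by ring.
Qed.

Lemma wht_rho th t : 0 < wht th * rho t.
Proof.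
have -> : rho t = wht t * ((b t - a t) ^+ 2 / 4) by rewrite /rho /wht; field; exact: abN.
by rewrite mulrA mulr_gt0 ?wht_same_sign // divr_gt0 // exprn_gt0.
Qed.

Lemma chord_uvec th th' : uvec th = uvec th' :> P -> midpoint th = midpoint th'.
Proof.
move=> /[dup] /p_uvec pE [c s].
have ptE' t : pt th (p th) t = pt th' (p th') t by rewrite /pt c s pE.
have [l1 H1 _] := chK th; have [l2 H2 _] := chK th'.
have E t : a th <= t <= b th <-> a th' <= t <= b th'.
  by rewrite -H1 -H2 ptE'.
have /andP[i1 i2] : a th' <= a th <= b th' by apply/E; rewrite lexx ltW.
have /andP[i3 i4] : a th' <= b th <= b th' by apply/E; rewrite lexx ltW.
have /andP[i5 i6] : a th <= a th' <= b th by apply/E; rewrite lexx ltW.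
have /andP[i7 i8] : a th <= b th' <= b th by apply/E; rewrite lexx ltW.
rewrite /midpoint ptE'; congr pt; congr (_ / _); lra.
Qed.

(* The homothety must send the midpoint of each chord to its own pole: both
   curves have supporting lines parallel to the chord there. *)
Lemma pole_midpoint th : pole th = hom (midpoint th).
Proof.
have plI : illum K dh (pole th) by apply: pole_illum; rewrite -wht_neq0.
have [t ptE'] := illum_hom _ plI.
pose F s := dot (midpoint s) (uvec th).
(* [pole_extremal] compares the pole with the images of all midpoints; as [lam > 0], the comparison
   passes to the midpoints themselves. The factor [wht th] carries the sign of the height. *)
have Fmax s : wht th * F s <= wht th * F t.
  have [_ hP] := plI; have [_ hx] := hom_illum s.
  have := @pole_extremal R K th (p th) (a th) (b th) (cA th) (cB th) (wht th)^-1
    (a th + cA th * (wht th)^-1) bK (chK th) (wedgeA th) (wedgeB th)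
    (invr_neq0 (wN th)) erefl _ dh (hom (midpoint s)) hP hx.
  have -> : p th + (wht th)^-1 = dot (hom (midpoint t)) (uvec th).
    by rewrite -ptE' dot_pt_u.
  rewrite !dot_hom -/(F s) -/(F t) => H.
  have {}H : (lam * (F s - F t)) / wht th <= 0.
    rewrite (_ : lam * _ = (1 - lam) * dot q (uvec th) + lam * F s -
      ((1 - lam) * dot q (uvec th) + lam * F t)); last by ring.
    apply: H; rewrite /wht; have := wN th; rewrite wht_neq0 -subr_eq0 => cN.
    by field; rewrite cN abN.
  have w2 : 0 < wht th ^+ 2 / lam by rewrite divr_gt0 // exprn_even_gt0 // wN.
  have : (lam * (F s - F t)) / wht th * (wht th ^+ 2 / lam) <= 0.
    by rewrite pmulr_lle0.
  rewrite (_ : _ * _ = wht th * F s - wht th * F t); first by rewrite subr_le0.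
  by field; rewrite wN gt_eqF.
have dF s : dif (fun s => wht th * F s) s (wht th * rho s * sin (th - s)).
  have [d1 d2] := dif_midpoint s.
  apply: dif_ext (dif_lin _ _ (wht th * cos th) (wht th * sin th) _ _ _ d1 d2).
    by move=> y; rewrite /F /dot /=; ring.
  by rewrite sinB; ring.
(* At a maximum [sin (th - t)] vanishes, so the two normals agree or are opposite. *)
have /eqP := dif_max _ _ _ (dF t) Fmax.
rewrite mulf_eq0 (gt_eqF (wht_rho th t)) /= => /eqP s0.
have : cos (th - t) ^+ 2 = 1 by rewrite -(cos2Dsin2 (th - t)) s0 expr0n addr0.
move/eqP; rewrite sqrf_eq1 => /orP[] /eqP c1.
  rewrite ptE'; congr hom; apply: chord_uvec.
  have := cosB th (th - t); have := sinB th (th - t).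
  by rewrite /uvec subKr s0 c1 !mulr0 !mulr1 addr0 subr0 => -> ->.
(* With opposite normals the derivative is positive throughout the half-turn after [t], against the
   maximality of [F t]. *)
exfalso; have : wht th * F t < wht th * F (t + pi).
  apply: (dif_pos_lt _ _ _ _ _ dF); first by rewrite ltrDl pi_gt0.
  move=> x /andP[x1 x2]; rewrite mulr_gt0 ?wht_rho //.
  have -> : th - x = (th - t) - (x - t) by ring.
  rewrite sinB s0 c1 mul0r mulN1r sub0r opprK; apply: sin_gt0_pi.
  by apply/andP; split; lra.
by rewrite ltNge Fmax.
Qed.

Lemma matching_ellipse : is_ellipse K.
Proof.
pose X1 t := (midpoint t).1 - q.1; pose X2 t := (midpoint t).2 - q.2.
pose l t := (b t - a t) / 2; pose kap t := (cA t - cB t) / 2; pose k := lam - 1.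
have wE th : (wht th)^-1 * (cA th - cB th) = b th - a th.
  have := wN th; rewrite wht_neq0 -subr_eq0 => cN.
  by rewrite /wht; field; rewrite cN abN.
(* [P1] and [P2] are the coordinates of [k * (M - q) = P - M], another form of
   [P - q = lam * (M - q)]. *)
have P1 th : k * X1 th = (wht th)^-1 * cos th -
    (a th + cA th * (wht th)^-1 - m th) * sin th.
  have -> : k * X1 th = (hom (midpoint th)).1 - (midpoint th).1.
    by rewrite /k /X1 /hom /padd /pscale /=; ring.
  by rewrite -pole_midpoint /pole /midpoint /pt /=; ring.
have P2 th : k * X2 th = (wht th)^-1 * sin th +
    (a th + cA th * (wht th)^-1 - m th) * cos th.
  have -> : k * X2 th = (hom (midpoint th)).2 - (midpoint th).2.
    by rewrite /k /X2 /hom /padd /pscale /=; ring.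
  by rewrite -pole_midpoint /pole /midpoint /pt /=; ring.
have dl th : dif l th (- ((b th - a th) * (cA th + cB th) / 4)).
  apply: dif_ext (difM _ _ _ _ _ (difB _ _ _ _ _ (db th) (da th)) (dif_const 2^-1 th)) => //.
  by field.
have [||||||_ [e1 [e2 [e0 He]]]] := harmonic_motion_ellipse X1 X2 l kap k.
- by move=> t; rewrite divr_gt0.
- move=> t; have [d1 _] := dif_midpoint t.
  apply: dif_ext (difB _ _ _ _ _ d1 (dif_const q.1 t)) => //.
  by rewrite /kap /l /rho; field.
- move=> t; have [_ d2] := dif_midpoint t.
  apply: dif_ext (difB _ _ _ _ _ d2 (dif_const q.2 t)) => //.
  by rewrite /kap /l /rho; field.
- move=> t; apply: dif_ext (difN _ _ _ (difM _ _ _ _ _ (dl t) (dif_sin t))) => //.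
  rewrite -[in RHS]mulrA P1 /kap /l.
  transitivity (- ((wht t)^-1 * (cA t - cB t)) * (cos t - cA t * sin t) / 2
     + (cA t - cB t) * (a t - b t) / 4 * sin t); last by field.
  by rewrite wE; field.
- move=> t; apply: dif_ext (difM _ _ _ _ _ (dl t) (dif_cos t)) => //.
  rewrite -[in RHS]mulrA P2 /kap /l.
  transitivity (- ((wht t)^-1 * (cA t - cB t)) * (sin t + cA t * cos t) / 2
     - (cA t - cB t) * (a t - b t) / 4 * cos t); last by field.
  by rewrite wE; field.
(* At angle [0] the normal is the first axis, and the first coordinate of [P - M] is the nonzero
   height of the pole. *)
- have := P1 0; rewrite sin0 cos0 mulr0 subr0 mulr1 => E.
  by apply/eqP => X0; move: E; rewrite X0 mulr0 => /esym/eqP; rewrite invr_eq0 (negPf (wN 0)).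
apply: (ellipse_of_boundary K q e1 e2) => // u /He [t ->].
have : (line (uvec t) (p t) `&` bd K) (pt t (p t) (a t)).
  by rewrite (chord_bd _ _ _ _ _ bK (chK t)); left.
move=> [_]; rewrite (_ : padd q _ = pt t (p t) (a t)) //.
by rewrite /padd /X1 /X2 /midpoint /pt /l /=; congr (_, _); field.
Qed.

End Matching.

(** * Poles in the rotating frame, and the conclusion *)

Section Poles.
Context {R : realType}.
Notation P := (R * R)%type.

Lemma padd_tangent (th s t c r : R) (v : P) : dot v (uvec' th) = c * dot v (uvec th) ->
  padd (pt th s t) (pscale r v) =
  pt th (s + r * dot v (uvec th)) (t + c * (r * dot v (uvec th))).
Proof.
by move=> vE; rewrite {1}(ptE th v) vE /padd /pscale /pt /=; congr (_, _); ring.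
Qed.

Lemma det2_tangent (th c c' : R) (v v' : P) :
  dot v (uvec' th) = c * dot v (uvec th) -> dot v' (uvec' th) = c' * dot v' (uvec th) ->
  det2 v v' = dot v (uvec th) * dot v' (uvec th) * (c' - c).
Proof.
move=> vE vE'; rewrite {1}(ptE th v) {1}(ptE th v') vE vE' /det2 /pt /=.
move: (dot v _) (dot v' _) => x y.
transitivity (x * y * (c' - c) * (cos th ^+ 2 + sin th ^+ 2)); first by ring.
by rewrite cos2Dsin2 mulr1.
Qed.

Lemma pt_inj (th s t s' t' : R) : pt th s t = pt th s' t' -> s = s' /\ t = t'.
Proof.
move=> E; split; first by rewrite -(dot_pt_u th s t) E dot_pt_u.
by rewrite -(dot_pt_u' th s t) E dot_pt_u'.
Qed.

(** Both tangents are graphs over the normal coordinate with slopes [cA] and [cB], so they meet at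
    height [(b - a) / (cA - cB)] above the chord. [is_pole] does not order the two boundary points,
    whence two symmetric cases. *)
Lemma is_poleP (K : set P) (th p a b cA cB : R) (x : P) : convex_body K ->
  C2_boundary K -> chord K th p a b ->
  (forall v, tangent_dir K (pt th p a) v ->
     dot v (uvec th) != 0 /\ dot v (uvec' th) = cA * dot v (uvec th)) ->
  (forall v, tangent_dir K (pt th p b) v ->
     dot v (uvec th) != 0 /\ dot v (uvec' th) = cB * dot v (uvec th)) ->
  is_pole K (line (uvec th) p) x <->
  cA != cB /\ x = pt th (p + ((cA - cB) / (b - a))^-1) (a + cA * ((cA - cB) / (b - a))^-1).
Proof.
move=> bK C2K chK SA SB; have [ab _ _] := chK; have bdE := chord_bd _ _ _ _ _ bK chK.
have abN : b - a != 0 by rewrite gt_eqF // subr_gt0.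
split.
  move=> [a0 [b0 [va [vb [ab0 [lE [ta [tb [_ [[s xs] [r xr]]]]]]]]]]].
  have key ra rb : x = pt th (p + ra) (a + cA * ra) -> x = pt th (p + rb) (b + cB * rb) ->
      cA != cB /\ x = pt th (p + ((cA - cB) / (b - a))^-1) (a + cA * ((cA - cB) / (b - a))^-1).
    move=> xa xb; have := xb; rewrite xa => /pt_inj [e1 e2].
    have e3 : ra = rb by apply: (addrI p).
    rewrite -e3 in e2.
    have e4 : (cA - cB) * ra = b - a by rewrite mulrBl; lra.
    have cN : cA - cB != 0.
      by apply/eqP => c0; move: e4 abN; rewrite c0 mul0r => <-; rewrite eqxx.
    split; first by rewrite -subr_eq0.
    have -> : ((cA - cB) / (b - a))^-1 = ra.
      by apply: (mulfI cN); rewrite e4; field; rewrite cN abN.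
    by [].
  have ina0 : [set pt th p a; pt th p b] a0 by rewrite -bdE lE; left.
  have inb0 : [set pt th p a; pt th p b] b0 by rewrite -bdE lE; right.
  case: ina0 inb0 => [a0E|a0E] [b0E|b0E].
  - by move: ab0; rewrite a0E b0E eqxx.
  - rewrite a0E in ta xs; rewrite b0E in tb xr.
    have [_ va'] := SA _ ta; have [_ vb'] := SB _ tb.
    rewrite (padd_tangent _ _ _ _ _ _ va') in xs; rewrite (padd_tangent _ _ _ _ _ _ vb') in xr.
    exact: key xs xr.
  - rewrite a0E in ta xs; rewrite b0E in tb xr.
    have [_ va'] := SB _ ta; have [_ vb'] := SA _ tb.
    rewrite (padd_tangent _ _ _ _ _ _ va') in xs; rewrite (padd_tangent _ _ _ _ _ _ vb') in xr.
    exact: key xr xs.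
  - by move: ab0; rewrite a0E b0E eqxx.
move=> [cN ->]; set tau := _^-1.
rewrite -subr_eq0 in cN.
have [va ta] : exists v, tangent_dir K (pt th p a) v.
  apply: (bd_tangent_dir K C2K).
  suff : (line (uvec th) p `&` bd K) (pt th p a) by case.
  by rewrite bdE; left.
have [vb tb] : exists v, tangent_dir K (pt th p b) v.
  apply: (bd_tangent_dir K C2K).
  suff : (line (uvec th) p `&` bd K) (pt th p b) by case.
  by rewrite bdE; right.
have [ua ua'] := SA _ ta; have [ub ub'] := SB _ tb.
exists (pt th p a), (pt th p b), va, vb; split.
  by apply/eqP => /pt_inj [_ E]; move: ab; rewrite E ltxx.
split => //; split => //; split => //; split.
  by rewrite (det2_tangent _ _ _ _ _ ua' ub') !mulf_neq0 // -opprB oppr_eq0.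
split.
  by exists (tau / dot va (uvec th)); rewrite (padd_tangent _ _ _ _ _ _ ua') mulfVK.
exists (tau / dot vb (uvec th)); rewrite (padd_tangent _ _ _ _ _ _ ub') mulfVK //.
by congr pt; rewrite /tau; field; rewrite cN abN.
Qed.

End Poles.

Theorem theorem4p10 (R : realType) (K : set (R * R)) (delta dh : R) :
  convex_body K -> C2_boundary K ->
  0 < delta -> (delta%:E < area K)%E ->
  0 < dh -> illum K dh = flot_poles K delta ->
  homothetic (flot_envelope K delta) (flot_centroids K delta) ->
  homothetic (flot_envelope K delta) (illum K dh) ->
  homothetic (flot_centroids K delta) (illum K dh) ->
  is_ellipse K.
Proof.
move=> bK C2K d0 dlt _ illE _ [q [lam [lam0 homE]]] _.
have Kreg := convex_body_regular K bK.
have {}dlt : delta < ar K by move: dlt; rewrite area_tame ?lte_fin //; exact: regular_tame.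
have [a [b chK]] := flot_chords K delta Kreg d0 dlt.
have dp := dif_flot K delta Kreg d0 dlt a b chK.
have p_uvec th th' : uvec th = uvec th' :> R * R -> flot_off K delta th = flot_off K delta th'.
  by rewrite /flot_off => ->.
have envE x : flot_envelope K delta x <->
    exists th, x = pt th (flot_off K delta th) ((a th + b th) / 2).
  split=> [[th /= [xu [_ xu']]]|[th ->]].
    by exists th; have [_ <-] := dif_D1 _ _ _ (dp th); rewrite -xu -xu'; exact: ptE.
  by exists th => /=; have [dd ->] := dif_D1 _ _ _ (dp th); rewrite dot_pt_u dot_pt_u'.
have polE x : illum K dh x <->
    exists th, is_pole K (line (uvec th) (flot_off K delta th)) x by rewrite illE.
move: (flot_off K delta) chK dp p_uvec envE polE => p chK dp p_uvec envE polE.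
have bdA th : bd K (pt th (p th) (a th)).
  suff : (line (uvec th) (p th) `&` bd K) (pt th (p th) (a th)) by case.
  by rewrite (chord_bd _ _ _ _ _ bK (chK th)); left.
have bdB th : bd K (pt th (p th) (b th)).
  suff : (line (uvec th) (p th) `&` bd K) (pt th (p th) (b th)) by case.
  by rewrite (chord_bd _ _ _ _ _ bK (chK th)); right.
have ctab th := chord_cts K p a b th Kreg chK (dif_cts _ _ _ (dp th)).
have ab th : a th < b th by have [] := chK th.
have aN th : a th != (a th + b th) / 2.
  by apply/eqP => E; have := ab th; lra.
have bN th : b th != (a th + b th) / 2.
  by apply/eqP => E; have := ab th; lra.
have [cA [SA da wA ccA]] := end_slope K p a b bK C2K chK dp a (fun th => (ctab th).1) bdA aN.
have [cB [SB db wB ccB]] := end_slope K p a b bK C2K chK dp b (fun th => (ctab th).2) bdB bN.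
apply: (@matching_ellipse R K dh q lam p a b cA cB) => //.
(* The factor in the support inequality is positive at [A] and negative at [B], which yields a lower
   bound for [K] at [A] and an upper bound at [B]. *)
- move=> th al t /wA; have abt := ab th.
  have m0 : 0 < (a th + b th) / 2 - a th by lra.
  by rewrite pmulr_lge0 //; lra.
- move=> th al t /wB; have abt := ab th.
  have m0 : (a th + b th) / 2 - b th < 0 by lra.
  by rewrite nmulr_lge0 //; lra.
- move=> th cN; apply/polE; exists th.
  by apply/(is_poleP _ _ _ _ _ (cA th) (cB th) _ bK C2K (chK th) (SA th) (SB th)).
- move=> x /polE [th].
  move=> /(is_poleP _ _ _ _ _ (cA th) (cB th) _ bK C2K (chK th) (SA th) (SB th)) [cN xE].
  by exists th.
- by move=> th; rewrite homE; exists (midpoint p a b th) => //; apply/envE; exists th.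
- by move=> x; rewrite homE => -[y /envE [th ->] <-]; exists th.
Qed.
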